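(* Let $s_1\ge s_2\ge 1$ be coprime integers and let $$X_0:\quad \dot x=P(x,y),\quad \dot y=Q(x,y)$$ be a real polynomial $(s_1,s_2)$-quasi-homogeneous system of weight degree $m$ with a center at the origin. Consider the one-parameter perturbation (analytic in $\epsilon$) $$\dot x=P(x,y)+\sum_{i=1}^\infty\epsilon^iP_i(x,y),\qquad \dot y=Q(x,y)+\sum_{i=1}^\infty\epsilon^iQ_i(x,y),$$ where all $P_i,Q_i$ are real polynomials of degree not greater than $n$. Let $$\mathcal S_{n+1,k}^{(s_1,s_2,m)}=\{is_1+js_2-l(s_1+s_2+m-1)\ :\ i,j,l\in\mathbb N,\ l\le i+j\le l(n+1),\ 1\le l\le k\}$$ and $$\tilde{\mathcal S}_{n+1,k}^{(s_1,s_2,m)}=\begin{cases}\mathcal S_{n+1,k}^{(s_1,s_2,m)}\cap 2\mathbb Z,& \text{if } s_1,s_2 \text{ are both odd},\\ \mathcal S_{n+1,k}^{(s_1,s_2,m)}\setminus 2\mathbb Z,&\text{if } s_1+s_2\text{ is odd}.\end{cases}$$ If the first non-vanishing Melnikov function of the perturbed system is the one of order $k$, $M_k(h)$, then $M_k(h)$ has at most $\sharp\tilde{\mathcal S}_{n+1,k}^{(s_1,s_2,m)}-1$ zeros on $(0,+\infty)$.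
   Context: $\mathbb N=\{0,1,2,\dots\}$; $\sharp S$ is the cardinality of $S$. The system $\dot x=P,\dot y=Q$ is $(s_1,s_2)$-quasi-homogeneous of weight degree $m$ if $P(\lambda^{s_1}x,\lambda^{s_2}y)=\lambda^{s_1+m-1}P(x,y)$ and $Q(\lambda^{s_1}x,\lambda^{s_2}y)=\lambda^{s_2+m-1}Q(x,y)$ for all $\lambda>0$. When it has a center at the origin, $\mathbb R^2\setminus\{(0,0)\}$ is filled by closed orbits around the origin (the period annulus). Melnikov functions: let $L$ be the positive $x$-half-axis (which is transverse to $X_0$), parametrized by $h\in(0,+\infty)$ through $x=s_1^{-1/(2s_2)}h^{s_1}$. The first return map of the perturbed system on $L$, defined for $h$ in compact subsets of $(0,+\infty)$ and $|\epsilon|$ small, expands as $\mathcal P(h,\epsilon)=h+\epsilon M_1(h)+\epsilon^2M_2(h)+\cdots$. The first non-vanishing Melnikov function is $M_k$, where $k$ is such that $M_1\equiv\dots\equiv M_{k-1}\equiv0$ and $M_k\not\equiv0$, so $\mathcal P(h,\epsilon)=h+\epsilon^kM_k(h)+O(\epsilon^{k+1})$. (The number of positive zeros of $M_k$ does not depend on the choice of the section and its analytic parametrization.) *)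

(* Defs.v *)
From HB Require Import structures.
From mathcomp Require Export all_boot all_order all_algebra.
From mathcomp Require Export polyXY finmap.
From mathcomp Require Export all_classical all_reals all_analysis.

Set Implicit Arguments.
Unset Strict Implicit.
Unset Printing Implicit Defensive.

Import Order.TTheory GRing.Theory Num.Theory.
Import numFieldNormedType.Exports.

Local Open Scope classical_set_scope.
Local Open Scope ring_scope.

(* A polynomial p in two variables is an element of {poly {poly R}} read as
   \sum_a \sum_b p`_a`_b x^a y^b, so that its value is p.[x, y] = p.[x%:P].[y]. *)
Definition total_degree_le (R : realType) (n : nat) (p : {poly {poly R}}) :=
  forall a b : nat, (n < a + b)%N -> p`_a`_b = 0.

Definition vector_field (R : realType) (P Q : {poly {poly R}}) (z : R * R) :
  R * R := (P.[z.1, z.2], Q.[z.1, z.2]).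

(* s1 + m - 1 and s2 + m - 1 are truncated subtractions, which are exact here
   because s1 and s2 are positive. *)
Definition quasi_homogeneous (R : realType) (s1 s2 m : nat)
    (P Q : {poly {poly R}}) :=
  forall l x y : R, 0 < l ->
    P.[l ^+ s1 * x, l ^+ s2 * y] = l ^+ (s1 + m - 1) * P.[x, y] /\
    Q.[l ^+ s1 * x, l ^+ s2 * y] = l ^+ (s2 + m - 1) * Q.[x, y].

Definition solution_on (R : realType) (I : set R) (V : R * R -> R * R)
    (g : R -> R * R) :=
  forall t : R, I t ->
    is_derive t (1 : R) (fun u : R => (g u).1) (V (g t)).1 /\
    is_derive t (1 : R) (fun u : R => (g u).2) (V (g t)).2.

(* The orbit through z is closed and is not reduced to a point. *)
Definition closed_orbit (R : realType) (V : R * R -> R * R) (z : R * R) :=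
  exists (T : R) (g : R -> R * R),
    [/\ 0 < T, g 0 = z, solution_on setT V g,
        forall t, g (t + T) = g t & exists t, g t <> z].

Definition center_at_origin (R : realType) (V : R * R -> R * R) :=
  V (0, 0) = (0, 0) /\ \forall z \near ((0, 0) : R * R)^', closed_orbit V z.

(* The terms p 0 and q 0 are not used. *)
Definition perturbed_field (R : realType) (P Q : {poly {poly R}})
    (p q : nat -> {poly {poly R}}) (eps : R) (z : R * R) : R * R :=
  (P.[z.1, z.2] + limn (fun N => \sum_(1 <= i < N) eps ^+ i * (p i).[z.1, z.2]),
   Q.[z.1, z.2] + limn (fun N => \sum_(1 <= i < N) eps ^+ i * (q i).[z.1, z.2])).

(* The coefficients of \sum_(i >= 1) eps^i p_i are power series in eps with a
   positive (common) radius of convergence. *)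
Definition analytic_perturbation (R : realType) (p : nat -> {poly {poly R}}) :=
  exists2 r : R, 0 < r & forall (eps : R) (a b : nat), `|eps| < r ->
    cvgn (fun N => \sum_(1 <= i < N) eps ^+ i * (p i)`_a`_b).

Definition section_param (R : realType) (s1 s2 : nat) (h : R) : R :=
  (s1%:R : R) `^ (- (2 * s2%:R)^-1) * h ^+ s1.

(* The orbit of V starting at parameter h on the positive x-half-axis meets this
   half-axis again, for the first time, at parameter h'. *)
Definition first_return (R : realType) (s1 s2 : nat) (V : R * R -> R * R)
    (h h' : R) :=
  0 < h' /\
  exists (T : R) (g : R -> R * R),
    [/\ 0 < T, solution_on [set t | 0 <= t <= T] V g,
        g 0 = (section_param s1 s2 h, 0), g T = (section_param s1 s2 h', 0) &
        forall t, 0 < t < T -> ~ (0 < (g t).1 /\ (g t).2 = 0)].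

(* M i is the coefficient of eps^i in the expansion at eps = 0 of the first
   return map, for i >= 1; the expansion holds for h in a compact set and |eps|
   small. This determines M i on ]0, +oo[. *)
Definition melnikov_functions (R : realType) (s1 s2 : nat)
    (P Q : {poly {poly R}}) (p q : nat -> {poly {poly R}})
    (M : nat -> R -> R) :=
  forall K : set R, compact K -> K `<=` [set h | 0 < h] ->
    exists2 e0 : R, 0 < e0 & forall h eps : R, K h -> `|eps| < e0 ->
      exists2 h' : R,
        first_return s1 s2 (perturbed_field P Q p q eps) h h' &
        (fun N => h + \sum_(1 <= i < N) eps ^+ i * M i h) @ \oo --> h'.

Definition first_nonvanishing (R : realType) (M : nat -> R -> R) (k : nat) :=
  [/\ (1 <= k)%N,
      forall i, (1 <= i < k)%N -> forall h, 0 < h -> M i h = 0 &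
      exists2 h, 0 < h & M k h <> 0].

(* The set S_{N,k}^{(s1,s2,m)}, with N in the place of n + 1. *)
Definition exponent_set (s1 s2 m N k : nat) : set int :=
  [set z : int | exists i j l : nat,
    [/\ (l <= i + j <= l * N)%N, (1 <= l <= k)%N &
        z = i%:Z * s1%:Z + j%:Z * s2%:Z
            - l%:Z * (s1%:Z + s2%:Z + m%:Z - 1)]].

Definition even_integers : set int := [set z : int | (2 %| z)%Z].

(* For coprime s1 and s2 the second case is the one where s1 + s2 is odd. *)
Definition parity_exponent_set (s1 s2 m N k : nat) : set int :=
  if odd s1 && odd s2 then exponent_set s1 s2 m N k `&` even_integers
  else exponent_set s1 s2 m N k `\` even_integers.

(* Main.v *)
(* Let (a, b) be the orbit of X_0 through the point h = 1 of the section. In the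
   coordinates x = r^s1 a(t), y = r^s2 b(t), which are regular because an orbit
   tangent to the dilations would be unbounded, the perturbed field is
   r^(m - 1) ((1 + beta) d_t + alpha r d_r), where the coefficients of eps^i in
   alpha and beta are combinations of r^e with e in S_(n+1, 1).

   The linear equation ((1 + beta) d_t + alpha r d_r) J = 0 can therefore be solved
   order by order in eps, with J = r + \sum_i eps^i J_i and J_i / r a combination of
   r^e with e in S_(n+1, i). Comparing the true orbits with approximate ones (Picard
   iteration for r as a function of t, then Gronwall's lemma in the plane) shows that
   any such J satisfies J_i(T, h) - J_i(0, h) = 0 for i < k and
   J_k(T, h) - J_k(0, h) = - M_k(h). If delta t + c denotes the time at which
   (a, b) passes through the image of (a, b)(t) under ((-1)^s1 x, (-1)^s2 y), with
   delta = 1 or -1, then - J(delta t + c, - r) is another such J, so that only one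
   parity of exponents survives in M_k. Finally a nonzero combination of N powers of h
   has at most N - 1 positive zeros. *)
Require Import Defs.
From HB Require Import structures.
From mathcomp Require Import all_boot all_order all_algebra.
From mathcomp Require Import polyXY finmap.
From mathcomp Require Import all_classical all_reals all_analysis.
From mathcomp Require Import zify ring lra.

Set Implicit Arguments.
Unset Strict Implicit.
Unset Printing Implicit Defensive.

Import Order.TTheory GRing.Theory Num.Theory.
Import numFieldNormedType.Exports.

Local Open Scope classical_set_scope.
Local Open Scope ring_scope.

(** * Derivatives of real functions *)

(** Differentiability of the flow in eps is never invoked. Every curve is compared with an explicit
    one, with an error of order eps^(k+1) whose constant does not depend on eps; hence constants are
    chosen before eps throughout. The first return is not constructed: its existence comes with the
    hypothesis on the M_i, and it only has to be located, which needs separate estimates near the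
    section.

    The J_i are mere antiderivatives in t and need not be periodic. Orders below k become T-periodic
    only once M_1, ..., M_(k-1) are known to vanish, and then the increment of J_k over a period
    does not depend on where the period starts. This is needed because the reflection shifts the
    time origin by c. Averaging the two resulting formulas for M_k gives r^d the weight (1 - delta
    (-1)^d) / 2, which is zero for one parity.

    The integral starts from J_0 = r, so that the change of J_0 along a return is h' - h itself; the
    exponents of M_k therefore exceed those of S by one. Radii are handled through their logarithm:
    r^d makes sense for every integer d, and dilations become translations. *)

(* Stated as a plain proposition to keep it out of type class resolution. *)
Definition derives (R : realType) (x : R) (f : R -> R) (df : R) : Prop :=
  is_derive x 1 f df.

Section real_functions.
Variable R : realType.
Implicit Types (f g df dg : R -> R) (x a b c : R).

Lemma derives_val x f a b : derives x f a -> a = b -> derives x f b.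
Proof. by move=> h <-. Qed.

Lemma derives_cst x c : derives x (fun=> c) 0.
Proof. exact: is_derive_cst. Qed.

Lemma derives_id x : derives x (fun y => y) 1.
Proof. exact: is_derive_id. Qed.

Lemma derivesD x f g a b : derives x f a -> derives x g b ->
  derives x (fun y => f y + g y) (a + b).
Proof. exact: is_deriveD. Qed.

Lemma derivesB x f g a b : derives x f a -> derives x g b ->
  derives x (fun y => f y - g y) (a - b).
Proof. exact: is_deriveB. Qed.

Lemma derivesN x f a : derives x f a -> derives x (fun y => - f y) (- a).
Proof. exact: is_deriveN. Qed.

Lemma derivesM x f g a b : derives x f a -> derives x g b ->
  derives x (fun y => f y * g y) (a * g x + f x * b).
Proof.
move=> hf hg; apply: derives_val (is_deriveM hf hg) _.
by rewrite /GRing.scale /=; ring.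
Qed.

Lemma derivesZ x f a c : derives x f a -> derives x (fun y => c * f y) (c * a).
Proof. exact: is_deriveZ. Qed.

Lemma derivesX x f a n : derives x f a ->
  derives x (fun y => f y ^+ n.+1) (n.+1%:R * f x ^+ n * a).
Proof.
move=> hf; elim: n => [|n IH]; first by rewrite mul1r expr0 mul1r.
apply: derives_val (derivesM hf IH) _.
by rewrite exprS -[n.+2%:R]natr1; ring.
Qed.

Lemma derives_comp x f g a b : derives (g x) f a -> derives x g b ->
  derives x (fun y => f (g y)) (a * b).
Proof. by move=> hf hg; apply: derives_val (is_derive1_comp hf hg) _. Qed.

Lemma derives_exp x f a : derives x f a ->
  derives x (fun y => expR (f y)) (expR (f x) * a).
Proof. by move=> hf; apply: derives_comp hf; exact: (is_derive_expR (f x)). Qed.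

Lemma derives_sum (I : Type) (s : seq I) (P : pred I) x
    (F : I -> R -> R) (dF : I -> R) : (forall i, derives x (F i) (dF i)) ->
  derives x (fun y => \sum_(i <- s | P i) F i y) (\sum_(i <- s | P i) dF i).
Proof.
move=> h; elim: s => [|i s IH].
  under [fun y => _]funext do rewrite big_nil.
  by rewrite big_nil; exact: derives_cst.
under [fun y => _]funext do rewrite big_cons.
by rewrite big_cons; case: (P i) => //; exact: derivesD.
Qed.

Lemma derives_continuous x f a : derives x f a -> {for x, continuous f}.
Proof. by case=> h _; apply: differentiable_continuous; apply/derivable1_diffP. Qed.

Lemma mean_value f df a b : a <= b ->
  (forall t, a <= t <= b -> derives t f (df t)) ->
  exists2 c, a <= c <= b & f b - f a = df c * (b - a).
Proof.
move=> ab h.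
have [||c] := @MVT_segment R f df a b ab.
- by move=> t; rewrite in_itv/= => /andP[? ?]; apply: h; rewrite !ltW.
- apply: derivable_within_continuous => t; rewrite in_itv/= => /h; case.
  by move=> + _.
- by rewrite in_itv/=; exists c.
Qed.

Lemma derive_bound f df a b C : a <= b ->
  (forall t, a <= t <= b -> derives t f (df t)) ->
  (forall t, a <= t <= b -> `|df t| <= C) -> `|f b - f a| <= C * (b - a).
Proof.
move=> ab h hC; have [c cab ->] := mean_value ab h.
by rewrite normrM (ger0_norm (_ : 0 <= b - a)) ?subr_ge0// ler_wpM2r ?subr_ge0// hC.
Qed.

Lemma derive_ge f df a b c : a <= b ->
  (forall t, a <= t <= b -> derives t f (df t)) ->
  (forall t, a <= t <= b -> c <= df t) -> c * (b - a) <= f b - f a.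
Proof.
move=> ab h hC; have [d cab ->] := mean_value ab h.
by rewrite ler_wpM2r ?subr_ge0// hC.
Qed.

Lemma derive0_cst f a b : a <= b ->
  (forall t, a <= t <= b -> derives t f 0) -> f a = f b.
Proof.
move=> ab h; have [c _ /eqP] := mean_value (df := fun=> 0) ab h.
by rewrite mul0r subr_eq0 => /eqP ->.
Qed.

Lemma derive0_const f : (forall t : R, derives t f 0) -> forall a b, f a = f b.
Proof.
move=> h a b; case: (leP a b) => [|/ltW] ab.
  exact: (derive0_cst ab).
by symmetry; apply: (derive0_cst ab).
Qed.

Lemma continuous_itv_bounded f a b :
  {in `[a, b], continuous f} -> exists2 C, 0 < C & forall t, a <= t <= b -> `|f t| <= C.
Proof.
move=> cf; case: (leP a b) => ab; last first.
  by exists 1 => // t /andP[/le_trans h /h]; rewrite leNgt ab.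
have cf' : {within `[a, b], continuous f}.
  by apply: continuous_in_subspaceT => t; rewrite inE => /cf.
have [c _ hc] := EVT_max ab cf'; have [d _ hd] := EVT_min ab cf'.
exists (`|f c| + `|f d| + 1); first by rewrite ltr_wpDl// addr_ge0.
move=> t tab; have {}tab : t \in `[a, b] by rewrite in_itv.
have := hc t tab; have := hd t tab.
rewrite ler_norml; have := ler_norm (f c); have := ler_normr (f d) (- f d).
have := normr_ge0 (f c); have := normr_ge0 (f d); have := ler_norm (- f d).
rewrite normrN; lra.
Qed.

Lemma continuous_itv_pos f a b : {in `[a, b], continuous f} ->
  (forall t, a <= t <= b -> 0 < f t) ->
  exists2 mu, 0 < mu & forall t, a <= t <= b -> mu <= f t.
Proof.
move=> cf f0; case: (leP a b) => ab; last first.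
  by exists 1 => // t /andP[/le_trans h /h]; rewrite leNgt ab.
have cf' : {within `[a, b], continuous f}.
  by apply: continuous_in_subspaceT => t; rewrite inE => /cf.
have [d dab hd] := EVT_min ab cf'.
exists (f d); first by apply: f0; move: dab; rewrite in_itv.
by move=> t tab; apply: hd; rewrite in_itv.
Qed.

Lemma ivt_zero f a b : a <= b -> {in `[a, b], continuous f} ->
  f a <= 0 -> 0 <= f b -> exists2 c, a <= c <= b & f c = 0.
Proof.
move=> ab cf fa fb.
have cf' : {within `[a, b], continuous f}.
  by apply: continuous_in_subspaceT => t; rewrite inE => /cf.
have [|c] := IVT (v := 0) ab cf'; last by rewrite in_itv; exists c.
by rewrite ge_min fa /= le_max fb orbT.
Qed.

End real_functions.

(** * Antiderivatives on the whole line *)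

Section antiderivative.
Variable R : realType.
Implicit Types f F : R -> R.

Lemma antiderivative_right f (a : R) : continuous f ->
  exists F, forall x : R, a < x -> derives x F (f x).
Proof.
move=> cf; exists (fun x => (\int[lebesgue_measure]_(t in `[a, x]) f t)%R).
move=> x ax.
have ci : (@lebesgue_measure R).-integrable `[a, x + 1] (EFin \o f).
  apply: continuous_compact_integrable; first exact: segment_compact.
  by move=> t; apply: continuous_subspaceT => ?; exact: cf.
have xx1 : x < x + 1 by rewrite ltrDl.
have [d e] := continuous_FTC1_closed xx1 ci ax (cf x).
apply: is_derive_eq (derivableP d) _.
by rewrite -e derive1E.
Qed.

(** An integral with fixed lower bound gives an antiderivative only to the right of that bound. The
    antiderivatives on the half-lines above -(n+1), normalised at 0, agree where both are defined,
    and are glued. *)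
Lemma antiderivative f : continuous f ->
  exists2 F, F 0 = 0 & forall x : R, derives x F (f x).
Proof.
move=> cf.
have /choice[G hG] : forall n : nat, exists G : R -> R,
    G 0 = 0 /\ forall x : R, - n.+1%:R < x -> derives x G (f x).
  move=> n; have [G hG] := antiderivative_right (- n.+1%:R) cf.
  exists (fun x => G x - G 0); split; first by rewrite subrr.
  move=> x /hG h; apply: derives_val (derivesB h (derives_cst _ _)) _.
  by rewrite subr0.
have eqG n n' (x : R) : - n.+1%:R < x -> - n'.+1%:R < x -> G n x = G n' x.
  have [h0 h] := hG n; have [h0' h'] := hG n'.
  move=> nx n'x; apply/eqP; rewrite -subr_eq0; apply/eqP.
  have D (y : R) : - n.+1%:R < y -> - n'.+1%:R < y ->
      derives y (fun x => G n x - G n' x) 0.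
    by move=> /h hy /h' hy'; apply: derives_val (derivesB hy hy') _; rewrite subrr.
  have n0 : - n.+1%:R < 0 :> R by rewrite oppr_lt0.
  have n0' : - n'.+1%:R < 0 :> R by rewrite oppr_lt0.
  have e0 : G n 0 - G n' 0 = 0 by rewrite h0 h0' subrr.
  case: (leP x 0) => [x0|/ltW x0]; rewrite -e0; [|symmetry].
    apply: (@derive0_cst _ (fun x => G n x - G n' x)) => // t /andP[xt t0].
    by apply: D; exact: lt_le_trans xt.
  apply: (@derive0_cst _ (fun x => G n x - G n' x)) => // t /andP[xt t0].
  by apply: D; [exact: lt_le_trans n0 xt|exact: lt_le_trans n0' xt].
pose N (x : R) := Num.truncn `|x|.
have hN x : - (N x).+1%:R < x.
  have := @truncnS_gt R `|x|; rewrite -/(N x).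
  have := ler_norm (- x); rewrite normrN; lra.
exists (fun x => G (N x) x); first by have [] := hG (N 0).
move=> x; have [_ /(_ _ (hN x)) hx] := hG (N x).
(* The index [N y] may differ from [N x] for [y] near [x], but the two antiderivatives agree
   there. *)
apply: near_eq_is_derive hx.
near=> y; apply: eqG => //.
by near: y; exact: lt_nbhsr.
Unshelve. all: by end_near. Qed.

End antiderivative.

(** * Gronwall's lemma and a continuity argument *)

Section gronwall.
Variable R : realType.

Lemma gronwall (N dN : R -> R) (c e S : R) : 0 <= c -> 0 <= e -> N 0 <= 0 ->
  (forall t, 0 <= t <= S -> derives t N (dN t)) ->
  (forall t, 0 <= t <= S -> dN t <= c * N t + e) ->
  forall t, 0 <= t <= S -> N t <= expR (c * S) * (e * S).
Proof.
move=> c0 e0 N0 hN hdN t /andP[t0 tS].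
(* [G] is nondecreasing: its derivative is e - exp(- c s) (dN - c N), where dN - c N <= e and exp(-
   c s) <= 1. *)
pose G s := e * s - expR (- c * s) * N s.
have hG (s : R) : 0 <= s <= S ->
    derives s G (e - (- c * expR (- c * s) * N s + expR (- c * s) * dN s)).
  move=> hs; apply: derives_val (derivesB (derivesZ e (derives_id s)) (derivesM
    (derives_exp (derivesZ (- c) (derives_id s))) (hN s hs))) _.
  by rewrite /=; ring.
have le1 s : 0 <= s -> expR (- c * s) <= 1.
  by move=> s0; rewrite expR_le1 mulNr oppr_le0 mulr_ge0.
have : 0 * (t - 0) <= G t - G 0.
  apply: (derive_ge t0) => s /andP[s0 st].
    by apply: hG; rewrite s0 (le_trans st).
  have sS : 0 <= s <= S by rewrite s0 (le_trans st).
  have := hdN s sS; have := le1 s s0; have := expR_gt0 (- c * s).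
  set E := expR _ => E0 E1 hs.
  have : E * dN s <= E * (c * N s + e) by rewrite ler_pM2l.
  have : E * e <= e by rewrite ler_piMl.
  lra.
rewrite mul0r /G mulr0 mulr0 expR0 mul1r => hh.
have {}hh : expR (- c * t) * N t <= e * t by lra.
have : expR (c * t) * (expR (- c * t) * N t) <= expR (c * t) * (e * t).
  by rewrite ler_pM2l ?expR_gt0.
rewrite mulrA -expRD mulNr subrr expR0 mul1r => /le_trans; apply.
apply: ler_pM; rewrite ?expR_ge0 ?mulr_ge0//.
  by rewrite ler_expR ler_wpM2l.
by rewrite ler_wpM2l.
Qed.

(** The times up to which [N] stays below 1 cannot stop early, because the better bound 1/2 holds
    there and leaves room to continue. An estimate may thus be proved under an a priori bound that
    it implies. *)
Lemma bootstrap (N : R -> R) (S : R) :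
  (forall t, 0 <= t <= S -> {for t, continuous N}) -> N 0 <= 0 ->
  (forall t, 0 <= t <= S -> (forall s, 0 <= s <= t -> N s <= 1) -> N t <= 2^-1) ->
  forall t, 0 <= t <= S -> N t <= 2^-1.
Proof.
move=> cN N0 hN t tS; rewrite leNgt; apply/negP => Nt.
have /andP[t0 tS'] := tS.
pose A := [set s | 0 <= s <= t /\ forall r, 0 <= r <= s -> N r <= 1].
have A0 : A 0.
  split; first by rewrite lexx.
  by move=> r; rewrite -eq_le => /eqP <-; lra.
have supA : has_sup A by split; [exists 0|exists t => s [/andP[]]].
pose s := sup A.
have s0 : 0 <= s by apply: ub_le_sup A0; case: supA.
have st : s <= t by apply: ge_sup => //; [exists 0|move=> r [/andP[]]].
have below r : 0 <= r < s -> N r <= 2^-1.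
  move=> /andP[r0 rs]; have sr0 : 0 < s - r by rewrite subr_gt0.
  have [u [/andP[u0 ut] hu] ru] := sup_adherent sr0 supA.
  apply: hN; first by rewrite r0 /=; lra.
  have ru' : r < u by move: ru; rewrite -/s; lra.
  by move=> v /andP[v0 vr]; apply: hu; rewrite v0 /=; lra.
have cNs : {for s, continuous N} by apply: cN; rewrite s0 (le_trans st).
have Ns : N s <= 2^-1.
  apply: hN; first by rewrite s0 (le_trans st).
  move=> r /andP[r0]; rewrite le_eqVlt => /orP[/eqP ->|rs]; last first.
    by apply: le_trans (below r _) _; rewrite ?r0//; lra.
  rewrite leNgt; apply/negP => Ns1.
  have /cNs[/= e e0 he] : nbhs (N s) [set x | 2^-1 < x].
    by apply: lt_nbhsr; lra.
  case: (eqVneq s 0) => [s00|sn0]; first by move: Ns1; rewrite s00; lra.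
  have sp : 0 < s by rewrite lt_def sn0.
  have [r' [r's r'0]] : exists r', r' < s /\ (0 <= r' /\ s - r' < e).
    case: (ltP (s - e / 2) 0) => h; first by exists 0; lra.
    by exists (s - e / 2); lra.
  have : N r' <= 2^-1 by apply: below; lra.
  rewrite leNgt => /negP; apply; apply: he => /=.
  by rewrite ger0_norm; lra.
have [e e0 he] : exists2 e, 0 < e & forall r, `|s - r| < e -> N r <= 1.
  have /cNs[/= e e0 he] : nbhs (N s) [set x | x < 1].
    by apply: lt_nbhsl; lra.
  by exists e => // r /he /ltW.
have sltt : s < t.
  rewrite lt_def st andbT; apply/eqP => ts; move: Nt; rewrite ts; lra.
(* A time strictly beyond [s] that still belongs to [A] contradicts the choice of [s] as
   supremum. *)
pose u := Num.min t (s + e / 2).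
have us : s < u by rewrite /u lt_min sltt; lra.
suff : A u by move=> /(ub_le_sup _) => /(_ (proj2 supA)); rewrite -/s; lra.
have ut : u <= t by rewrite /u ge_min lexx.
have ue : u <= s + e / 2 by rewrite /u ge_min lexx orbT.
split; first by rewrite ut andbT; lra.
move=> r /andP[r0 ru]; case: (ltP r s) => rs.
  by apply: le_trans (below r _) _; rewrite ?r0//; lra.
by apply: he; rewrite ler0_norm; lra.
Qed.

End gronwall.

(** * Periodic functions *)

Section periodic.
Variable R : realType.

Lemma periodic_reduce (T : R) : 0 < T ->
  forall t : R, exists2 z : int, 0 <= t + T *~ z & t + T *~ z <= T.
Proof.
move=> T0 t; exists (- Num.floor (t / T)).
  have := @floor_le R (t / T); rewrite ler_pdivlMr// mulrC mulrzr.
  by rewrite mulrNz; lra.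
have := @floorD1_gt R (t / T); rewrite ltr_pdivrMr// intrD mulrDl mul1r mulrC mulrzr.
by rewrite mulrNz; lra.
Qed.

Lemma periodic_int (f : R -> R) (T : R) : (forall t, f (t + T) = f t) ->
  forall (z : int) t, f (t + T *~ z) = f t.
Proof.
move=> h; have hn n t : f (t + T *+ n) = f t.
  elim: n t => [|n IH] t; first by rewrite addr0.
  by rewrite mulrSr addrA h IH.
case=> n t; first exact: hn.
by rewrite NegzE mulrNz -[in RHS](subrK (T *+ n.+1) t) hn.
Qed.

Lemma periodic_bounded (f : R -> R) (T : R) : 0 < T -> continuous f ->
  (forall t, f (t + T) = f t) -> exists2 C, 0 < C & forall t, `|f t| <= C.
Proof.
move=> T0 cf fT; have [C C0 hC] : exists2 C, 0 < C & forall t, 0 <= t <= T -> `|f t| <= C.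
  by apply: continuous_itv_bounded => t _; exact: cf.
exists C => // t; have [z z0 zT] := periodic_reduce T0 t.
by rewrite -(periodic_int fT z t) hC// z0.
Qed.

End periodic.

(** * Exponential sums and power series *)

Section exponential_sums.
Variable R : realType.

(** This is r^d for the radius r = e^x. In what follows the radial variable is nearly always this
    logarithm. *)
Definition ex (d : int) (x : R) : R := expR (d%:~R * x).

Lemma ex_gt0 d x : 0 < ex d x. Proof. exact: expR_gt0. Qed.

Lemma exD d e x : ex (d + e) x = ex d x * ex e x.
Proof. by rewrite /ex intrD mulrDl expRD. Qed.

Lemma exN d x : ex (- d) x = (ex d x)^-1.
Proof. by rewrite /ex intrN mulNr expRN. Qed.

Lemma exn (n : nat) x : ex n%:Z x = expR x ^+ n.
Proof. by rewrite /ex expRM_natl. Qed.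

Lemma derives_ex d (x : R) : derives x (ex d) (d%:~R * ex d x).
Proof.
apply: derives_val (derives_exp (derivesZ d%:~R (derives_id x))) _.
by rewrite mulr1 mulrC.
Qed.

Lemma rolle_zeros (f df : R -> R) : (forall x : R, derives x f (df x)) ->
  forall z0 zs, path <%R z0 zs -> (forall z, z \in z0 :: zs -> f z = 0) ->
  exists ws, [/\ size ws = size zs, path <%R z0 ws & forall w, w \in ws -> df w = 0].
Proof.
move=> hf z0 zs; elim: zs z0 => [|z1 zs IH] z0 /=; first by exists [::].
move=> /andP[z01 pz] hz.
have [w w01 dw] : exists2 w, w \in `]z0, z1[ & is_derive w 1 f 0.
  apply: Rolle => //.
  - by move=> x _; case: (hf x).
  - apply: derivable_within_continuous => x _; by case: (hf x).
  - by rewrite !hz// ?inE ?eqxx ?orbT.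
have [ws [sws pws hws]] := IH z1 pz (fun z h => hz z (mem_behead (s := z0 :: _) h)).
exists (w :: ws); split; first by rewrite /= sws.
  move: w01; rewrite in_itv/= => /andP[-> wz1] /=.
  case: ws pws {sws hws} => //= v ws /andP[zv ->]; by rewrite (lt_trans wz1).
move=> u; rewrite inE => /orP[/eqP ->|/hws //].
have d1 : is_derive w 1 f (df w) := hf w.
by rewrite -(@derive_val _ _ _ _ _ _ _ d1) (@derive_val _ _ _ _ _ _ _ dw).
Qed.

(* After division by one exponential, Rolle's theorem removes one term and one zero. *)
Lemma exponential_sum_zeros (ds : seq int) (c : int -> R) (zs : seq R) :
  uniq ds -> sorted <%R zs -> size zs = size ds ->
  (forall z, z \in zs -> \sum_(d <- ds) c d * ex d z = 0) ->
  forall d, d \in ds -> c d = 0.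
Proof.
elim: ds c zs => [//|d0 ds IH] c [//|z0 zs] /= /andP[d0ds uds] pz [szs] hz.
pose f x := \sum_(d <- d0 :: ds) c d * ex (d - d0) x.
pose df x := \sum_(d <- d0 :: ds) c d * ((d - d0)%:~R * ex (d - d0) x).
have hf (x : R) : derives x f (df x).
  by apply: derives_sum => d; apply: derivesZ; exact: derives_ex.
have fz z : z \in z0 :: zs -> f z = 0.
  move=> zz; have := hz z zz; rewrite (_ : \sum_(d <- _) _ = f z * ex d0 z).
    by move/eqP; rewrite mulf_eq0 (gt_eqF (ex_gt0 _ _)) orbF => /eqP.
  by rewrite big_distrl /=; apply: eq_bigr => d _; rewrite -mulrA -exD subrK.
have [ws [sws pws hws]] := rolle_zeros hf pz fz.
have c0 d : d \in ds -> c d = 0.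
  move=> dds; have : c d * (d - d0)%:~R = 0.
    apply: (IH (fun d => c d * (d - d0)%:~R) ws) => //.
    - exact: path_sorted pws.
    - by rewrite sws.
    move=> w /hws; rewrite /df big_cons subrr mulr0z mul0r mulr0 add0r => h.
    rewrite (_ : \sum_(_ <- _) _ = (\sum_(d1 <-
      ds) c d1 * ((d1 - d0)%:~R * ex (d1 - d0) w)) * ex d0 w).
      by rewrite h mul0r.
    by rewrite big_distrl /=; apply: eq_bigr => d' _; rewrite -!mulrA -exD subrK.
  move/eqP; rewrite mulf_eq0 intr_eq0 subr_eq0 => /orP[/eqP//|/eqP dd0].
  by move: d0ds; rewrite -dd0 dds.
move=> d; rewrite inE => /orP[/eqP ->|/c0//].
have := hz z0; rewrite inE eqxx => /(_ isT).
rewrite big_cons big_seq big1 ?addr0 => [/eqP|d' /c0 ->]; last by rewrite mul0r.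
by rewrite mulf_eq0 (gt_eqF (ex_gt0 _ _)) orbF => /eqP.
Qed.

End exponential_sums.

(** * Tails of power series *)

Section power_series.
Variable R : realType.
Implicit Types (c : nat -> R).

Lemma geometric_tail (q : R) (k N : nat) : 0 <= q <= 2^-1 -> (k <= N)%N ->
  \sum_(k <= i < N) q ^+ i <= 2 * q ^+ k.
Proof.
move=> /andP[q0 q2] kN.
(* The extra term 2 q^N makes the bound inductive, since q <= 1/2. *)
suff : \sum_(k <= i < N) q ^+ i + 2 * q ^+ N <= 2 * q ^+ k.
  by have : 0 <= q ^+ N := exprn_ge0 N q0; lra.
elim: N kN => [|N IH].
  by rewrite leqn0 => /eqP ->; rewrite big_geq// add0r.
rewrite leq_eqVlt => /orP[/eqP <-|kN]; first by rewrite big_geq// add0r.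
rewrite big_nat_recr//=; have := IH kN.
have : q * q ^+ N <= 2^-1 * q ^+ N by rewrite ler_wpM2r// exprn_ge0.
rewrite exprS; lra.
Qed.

Lemma power_series_remainder c (r : R) (k : nat) : 0 < r ->
  cvgn (fun N => \sum_(1 <= i < N) r ^+ i * c i) ->
  exists2 C, 0 < C & forall (e : R) (N : nat), `|e| <= r / 2 -> (k < N)%N ->
    `|\sum_(k.+1 <= i < N) e ^+ i * c i| <= C * `|e| ^+ k.+1.
Proof.
move=> r0 cv; have [B [_ hB]] := cvg_seq_bounded cv.
pose b := `|B| + 1.
have b0 : 0 < b by rewrite /b ltr_wpDl.
have {}hB n : `|\sum_(1 <= i < n) r ^+ i * c i| <= b.
  by apply: (hB b) => //; rewrite /b (le_lt_trans (ler_norm B))// ltrDl.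
have hc i : (0 < i)%N -> `|c i| * r ^+ i <= 2 * b.
  move=> i0; have := hB i; have := hB i.+1; rewrite big_nat_recr//= => h1 h2.
  rewrite -(ger0_norm (exprn_ge0 i (ltW r0))) -normrM mulrC.
  move: h1 h2; set u := \sum_(_ <= _ < _) _ => h1 h2.
  have -> : r ^+ i * c i = u + r ^+ i * c i - u by ring.
  by apply: le_trans (ler_normB _ _) _; lra.
exists (2 * (2 * b) / r ^+ k.+1); first by rewrite divr_gt0 ?exprn_gt0 ?mulr_gt0.
move=> e N er kN; apply: le_trans (ler_norm_sum _ _ _) _.
have q0 : 0 <= `|e| / r <= 2^-1.
  by apply/andP; split; [rewrite divr_ge0// ltW|rewrite ler_pdivrMr// mulrC].
apply: (@le_trans _ _ (\sum_(k.+1 <= i < N) 2 * b * (`|e| / r) ^+ i)).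
  rewrite big_nat [leRHS]big_nat; apply: ler_sum => i /andP[ki _].
  rewrite normrM normrX expr_div_n mulrCA ler_wpM2l ?exprn_ge0//.
  rewrite ler_pdivlMr ?exprn_gt0// hc//; exact: leq_trans ki.
rewrite -big_distrr /=.
have := geometric_tail q0 kN; rewrite expr_div_n => h.
have -> : 2 * (2 * b) / r ^+ k.+1 * `|e| ^+ k.+1 =
  2 * b * (2 * (`|e| ^+ k.+1 / r ^+ k.+1)) by ring.
by rewrite ler_pM2l// mulr_gt0.
Qed.

Lemma power_series_limit c (r : R) (k : nat) : 0 < r ->
  cvgn (fun N => \sum_(1 <= i < N) r ^+ i * c i) ->
  exists2 C, 0 < C & forall e l : R, `|e| <= r / 2 ->
    (fun N => \sum_(1 <= i < N) e ^+ i * c i) @ \oo --> l ->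
    `|l - \sum_(1 <= i < k.+1) e ^+ i * c i| <= C * `|e| ^+ k.+1.
Proof.
move=> r0 cv; have [C C0 hC] := power_series_remainder k r0 cv.
exists C => // e l er hl.
have hl' : (fun N => `|\sum_(1 <= i < N) e ^+ i * c i - \sum_(1 <= i < k.+1) e ^+ i * c i|)
    @ \oo --> `|l - \sum_(1 <= i < k.+1) e ^+ i * c i|.
  by apply: cvg_norm; apply: cvgB => //; exact: cvg_cst.
rewrite -(cvg_lim _ hl')//; apply: limr_le; first exact: cvgP hl'.
near=> N; have kN : (k < N)%N by near: N; exists k.+1.
by rewrite (big_cat_nat _ (n := k.+1))//= addrAC subrr add0r hC.
Unshelve. all: by end_near. Qed.

End power_series.

(** * Polynomial vector fields in the plane *)

Section plane_polynomials.
Variable R : realType.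
Implicit Types (p q : {poly {poly R}}) (x y : R).

Lemma hornerXY_sum p (N : nat) x y :
  (forall a b, (N <= a)%N || (N <= b)%N -> p`_a`_b = 0) ->
  p.[x, y] = \sum_(a < N) \sum_(b < N) p`_a`_b * (x ^+ a * y ^+ b).
Proof.
move=> hN.
have szp : (size p <= N)%N.
  by apply/leq_sizeP => a Na; apply/polyP => b; rewrite coef0 hN// Na.
rewrite (horner_coef_wide _ szp) horner_sum; apply: eq_bigr => a _.
rewrite -polyC_exp hornerM hornerC.
have sza : (size (p`_a)%R <= N)%N.
  by apply/leq_sizeP => b Nb; rewrite hN// Nb orbT.
rewrite (horner_coef_wide _ sza) big_distrl /=; apply: eq_bigr => b _.
by rewrite -mulrA; congr (_ * _); rewrite mulrC.
Qed.

Lemma bidegree_bound p :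
  exists N : nat, forall a b, (N <= a)%N || (N <= b)%N -> p`_a`_b = 0.
Proof.
exists (maxn (size p) (\max_(a < size p) size (p`_a)%R)) => a b.
case: (ltnP a (size p)) => [ap|pa _]; last first.
  by rewrite [p`_a]nth_default// nth_default// size_poly0.
rewrite !geq_max [(size p <= a)%N]leqNgt ap /= => /andP[_ hb].
rewrite nth_default//; apply: leq_trans hb.
exact: (leq_bigmax (Ordinal ap)).
Qed.

(** The sup bound is carried along because the Lipschitz constant of a product depends on it. *)
Definition lipschitz_box (B : R) (f : R -> R -> R) := exists2 L, 0 < L &
  forall x y x' y', `|x| <= B -> `|y| <= B -> `|x'| <= B -> `|y'| <= B ->
  `|f x y| <= L /\ `|f x y - f x' y'| <= L * (`|x - x'| + `|y - y'|).

Lemma lipschitz_box_cst B c : lipschitz_box B (fun _ _ => c).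
Proof.
exists (`|c| + 1); first by rewrite ltr_wpDl.
move=> x y x' y' _ _ _ _; rewrite subrr normr0 lerDl ler01.
by rewrite mulr_ge0// addr_ge0.
Qed.

Lemma lipschitz_box_fst B : lipschitz_box B (fun x _ => x).
Proof.
exists (`|B| + 1); first by rewrite ltr_wpDl.
move=> x y x' y' xB _ _ _; have := ler_norm B; split; first by lra.
rewrite mulrDl mul1r; have := normr_ge0 (y - y').
have : 0 <= `|B| * (`|x - x'| + `|y - y'|) by rewrite mulr_ge0// addr_ge0.
lra.
Qed.

Lemma lipschitz_box_snd B : lipschitz_box B (fun _ y => y).
Proof.
exists (`|B| + 1); first by rewrite ltr_wpDl.
move=> x y x' y' _ yB _ _; have := ler_norm B; split; first by lra.
rewrite mulrDl mul1r; have := normr_ge0 (x - x').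
have : 0 <= `|B| * (`|x - x'| + `|y - y'|) by rewrite mulr_ge0// addr_ge0.
lra.
Qed.

Lemma lipschitz_boxD B f g : lipschitz_box B f -> lipschitz_box B g ->
  lipschitz_box B (fun x y => f x y + g x y).
Proof.
move=> [L L0 hL] [K K0 hK]; exists (L + K); first by rewrite addr_gt0.
move=> x y x' y' xB yB x'B y'B.
have [f1 f2] := hL _ _ _ _ xB yB x'B y'B; have [g1 g2] := hK _ _ _ _ xB yB x'B y'B.
split; first by apply: le_trans (ler_normD _ _) _; lra.
rewrite opprD addrACA mulrDl; apply: le_trans (ler_normD _ _) _; lra.
Qed.

Lemma lipschitz_boxM B f g : lipschitz_box B f -> lipschitz_box B g ->
  lipschitz_box B (fun x y => f x y * g x y).
Proof.
move=> [L L0 hL] [K K0 hK].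
have LK : 0 < L * K by rewrite mulr_gt0.
exists (2 * (L * K)); first by rewrite mulr_gt0.
move=> x y x' y' xB yB x'B y'B.
have [f1 f2] := hL _ _ _ _ xB yB x'B y'B; have [g1 g2] := hK _ _ _ _ xB yB x'B y'B.
have [g1' _] := hK _ _ _ _ x'B y'B xB yB.
split.
  rewrite normrM; apply: (@le_trans _ _ (L * K)); first exact: ler_pM.
  lra.
have -> : f x y * g x y - f x' y' * g x' y' =
  f x y * (g x y - g x' y') + (f x y - f x' y') * g x' y' by ring.
apply: le_trans (ler_normD _ _) _; rewrite !normrM.
set s := `|x - x'| + `|y - y'| in f2 g2 *.
have h1 : `|f x y| * `|g x y - g x' y'| <= L * (K * s) by exact: ler_pM.
have h2 : `|f x y - f x' y'| * `|g x' y'| <= (L * s) * K by exact: ler_pM.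
apply: le_trans (lerD h1 h2) _.
rewrite le_eqVlt; apply/orP; left; apply/eqP; ring.
Qed.

Lemma lipschitz_box_sum B (I : Type) (s : seq I) (F : I -> R -> R -> R) :
  (forall i, lipschitz_box B (F i)) ->
  lipschitz_box B (fun x y => \sum_(i <- s) F i x y).
Proof.
move=> h; elim: s => [|i s IH].
  under [fun x => _]funext do under [fun y => _]funext do rewrite big_nil.
  exact: lipschitz_box_cst.
under [fun x => _]funext do under [fun y => _]funext do rewrite big_cons.
exact: lipschitz_boxD.
Qed.

Lemma lipschitz_boxX B f n : lipschitz_box B f ->
  lipschitz_box B (fun x y => f x y ^+ n).
Proof.
move=> hf; elim: n => [|n IH]; first exact: lipschitz_box_cst.
under [fun x => _]funext do under [fun y => _]funext do rewrite exprS.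
exact: lipschitz_boxM.
Qed.

Lemma lipschitz_box_poly B p : lipschitz_box B (fun x y => p.[x, y]).
Proof.
have [N hN] := bidegree_bound p.
under [fun x => _]funext do under [fun y => _]funext do rewrite (hornerXY_sum _ _ hN).
apply: lipschitz_box_sum => a; apply: lipschitz_box_sum => b.
apply: lipschitz_boxM; first exact: lipschitz_box_cst.
apply: lipschitz_boxM; apply: lipschitz_boxX.
  exact: lipschitz_box_fst.
exact: lipschitz_box_snd.
Qed.

Lemma continuous_hornerXY p (f g : R -> R) (t : R) :
  {for t, continuous f} -> {for t, continuous g} ->
  {for t, continuous (fun t => p.[f t, g t])}.
Proof.
move=> cf cg; have [N hN] := bidegree_bound p.
have -> : (fun s => p.[f s, g s]) =
    (fun s => \sum_(a < N) \sum_(b < N) p`_a`_b * (f s ^+ a * g s ^+ b)).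
  by apply/funext => s; rewrite (hornerXY_sum _ _ hN).
have X (h : R -> R) n : {for t, continuous h} -> {for t, continuous (fun t => h t ^+ n)}.
  move=> ch; elim: n => [|n IH]; first exact: cvg_cst.
  have -> : (fun s => h s ^+ n.+1) = (fun s => h s * h s ^+ n).
    by apply/funext => s; rewrite exprS.
  exact: cvgM.
have csum (F : 'I_N -> R -> R) : (forall i, {for t, continuous (F i)}) ->
    {for t, continuous (fun t => \sum_(i < N) F i t)}.
  by move=> hF; apply: cvg_big => [|i _]; [exact: add_continuous|exact: hF].
apply: (csum _) => a; apply: (csum _) => b; apply: cvgM; first exact: cvg_cst.
by apply: cvgM; exact: X.
Qed.

End plane_polynomials.

(** * Comparison of approximate orbits *)

Section comparison.
Variable R : realType.

(** With s = a1 + a2, the cross terms are absorbed by 4 eta s <= 4 eta^2 + s^2 and s^2 <= 2 (a1^2 +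
    a2^2). Here a1 and a2 are the sizes of the coordinate errors, and m1, m2 are half the
    derivatives of their squares. *)
Lemma energy_inequality (a1 a2 M eta m1 m2 : R) : 0 <= M ->
  m1 <= a1 * (2 * eta + M * (a1 + a2)) -> m2 <= a2 * (2 * eta + M * (a1 + a2)) ->
  2 * m1 + 2 * m2 <= (2 + 4 * M) * (a1 ^+ 2 + a2 ^+ 2) + 4 * eta ^+ 2.
Proof.
move=> M0 h1 h2.
have h3 : M * (a1 + a2) ^+ 2 <= M * (2 * (a1 ^+ 2 + a2 ^+ 2)).
  by rewrite ler_wpM2l//; have := sqr_ge0 (a1 - a2); lra.
have h4 := sqr_ge0 (a1 - a2); have h5 := sqr_ge0 (2 * eta - (a1 + a2)).
lra.
Qed.

(** The constants precede the fields, so that one choice serves all small eps. The curve [f] is not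
    assumed to stay in the box: [z] keeps a margin 1 inside it, and the bootstrap shows that [f]
    stays within distance 1 of [z]. The factor [kappa] is the speed of a common time change. *)
Lemma comparison (L B S K : R) : 0 <= L -> 0 <= S -> 0 <= K ->
  exists C eta0, [/\ 0 < C, 0 < eta0 & forall (X1 X2 : R -> R -> R)
    (kappa f1 f2 z1 z2 df1 df2 dz1 dz2 : R -> R) (eta S' : R),
  (forall x y x' y', `|x| <= B -> `|y| <= B -> `|x'| <= B -> `|y'| <= B ->
    `|X1 x y - X1 x' y'| <= L * (`|x - x'| + `|y - y'|) /\
    `|X2 x y - X2 x' y'| <= L * (`|x - x'| + `|y - y'|)) ->
  0 <= eta <= eta0 -> S' <= S -> f1 0 = z1 0 -> f2 0 = z2 0 ->
  (forall t, 0 <= t <= S' ->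
    [/\ derives t f1 (df1 t), derives t f2 (df2 t),
        derives t z1 (dz1 t) & derives t z2 (dz2 t)]) ->
  (forall t, 0 <= t <= S' ->
    [/\ `|kappa t| <= K, `|z1 t| <= B - 1, `|z2 t| <= B - 1,
        `|dz1 t - kappa t * X1 (z1 t) (z2 t)| <= eta &
        `|dz2 t - kappa t * X2 (z1 t) (z2 t)| <= eta]) ->
  (forall t, 0 <= t <= S' -> `|f1 t| <= B -> `|f2 t| <= B ->
    `|df1 t - kappa t * X1 (f1 t) (f2 t)| <= eta /\
    `|df2 t - kappa t * X2 (f1 t) (f2 t)| <= eta) ->
  forall t, 0 <= t <= S' -> `|f1 t - z1 t| <= C * eta /\ `|f2 t - z2 t| <= C * eta].
Proof.
move=> L0 S0 K0.
(* [c] is the rate in [energy_inequality] with M = K L. Gronwall bounds the squared distance by E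
   eta^2, and [eta0] makes this at most 1/2, as [bootstrap] requires. The final constant 1 + E
   replaces the square root of [E]. *)
pose c := 2 + 4 * (K * L).
have KL0 : 0 <= K * L by rewrite mulr_ge0.
have c0 : 0 <= c by rewrite /c; lra.
pose E := expR (c * S) * (4 * S).
have E0 : 0 <= E by rewrite mulr_ge0 ?expR_ge0// mulr_ge0.
exists (1 + E), ((2 * (1 + E))^-1); split; [lra|rewrite invr_gt0; lra|].
move=> X1 X2 kappa f1 f2 z1 z2 df1 df2 dz1 dz2 eta S' lipX /andP[eta_ge0 eta_le] S'S
  i1 i2 hD hz hf.
have Eeta : E * eta ^+ 2 <= 2^-1.
  have h1 : (1 + E) * eta <= 2^-1.
    by move: eta_le; rewrite invfM ler_pdivlMr ?[eta * _]mulrC//; lra.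
  have h2 : E * eta <= 2^-1 by lra.
  have h3 : eta <= 1 by have := mulr_ge0 E0 eta_ge0; lra.
  by rewrite expr2 mulrA; apply: le_trans h2; apply: ler_piMr => //; apply: mulr_ge0.
pose d1 t := f1 t - z1 t; pose d2 t := f2 t - z2 t.
pose N t := d1 t ^+ 2 + d2 t ^+ 2.
pose dN t := 2 * (d1 t * (df1 t - dz1 t)) + 2 * (d2 t * (df2 t - dz2 t)).
have N0 : N 0 <= 0 by rewrite /N /d1 /d2 i1 i2 !subrr expr0n /= addr0.
have hN t : 0 <= t <= S' -> derives t N (dN t).
  move=> /hD[h1 h2 h3 h4].
  apply: derives_val (derivesD (derivesX 1 (derivesB h1 h3)) (derivesX 1 (derivesB h2 h4))) _.
  by rewrite /dN /d1 /d2 /= !expr1; ring.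
have sq t : 0 <= t <= S' -> N t <= 1 -> dN t <= c * N t + 4 * eta ^+ 2.
  move=> tS Nt1.
  have [kt z1B z2B r1 r2] := hz t tS.
  have e1 : `|d1 t| <= 1.
    rewrite -ler_sqr ?nnegrE// real_normK ?num_real// expr1n.
    by have := sqr_ge0 (d2 t); move: Nt1; rewrite /N; lra.
  have e2 : `|d2 t| <= 1.
    rewrite -ler_sqr ?nnegrE// real_normK ?num_real// expr1n.
    by have := sqr_ge0 (d1 t); move: Nt1; rewrite /N; lra.
  have f1B : `|f1 t| <= B.
    have -> : f1 t = z1 t + d1 t by rewrite /d1; ring.
    by apply: le_trans (ler_normD _ _) _; apply: le_trans (lerD z1B e1) _; rewrite subrK.
  have f2B : `|f2 t| <= B.
    have -> : f2 t = z2 t + d2 t by rewrite /d2; ring.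
    by apply: le_trans (ler_normD _ _) _; apply: le_trans (lerD z2B e2) _; rewrite subrK.
  have [q1 q2] := hf t tS f1B f2B.
  have z1B' : `|z1 t| <= B by apply: le_trans z1B _; rewrite gerBl.
  have z2B' : `|z2 t| <= B by apply: le_trans z2B _; rewrite gerBl.
  have [l1 l2] := lipX (f1 t) (f2 t) (z1 t) (z2 t) f1B f2B z1B' z2B'.
  have bnd (X : R -> R -> R) df dz :
      `|df - kappa t * X (f1 t) (f2 t)| <= eta -> `|dz - kappa t * X (z1 t) (z2 t)| <= eta ->
      `|X (f1 t) (f2 t) - X (z1 t) (z2 t)| <= L * (`|f1 t - z1 t| + `|f2 t - z2 t|) ->
      `|df - dz| <= 2 * eta + K * L * (`|d1 t| + `|d2 t|).
    move=> u1 u2 u3.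
    have -> : df - dz = (df - kappa t * X (f1 t) (f2 t)) - (dz - kappa t * X (z1 t) (z2 t))
      + kappa t * (X (f1 t) (f2 t) - X (z1 t) (z2 t)) by ring.
    apply: le_trans (ler_normD _ _) _; apply: lerD.
      by apply: le_trans (ler_normB _ _) _; rewrite mulr_natl mulr2n lerD.
    by rewrite normrM -mulrA; apply: ler_pM.
  have b1 := bnd _ _ _ q1 r1 l1; have b2 := bnd _ _ _ q2 r2 l2.
  have m1 : d1 t * (df1 t - dz1 t) <= `|d1 t| * (2 * eta + K * L * (`|d1 t| + `|d2 t|)).
    by apply: le_trans (ler_norm _) _; rewrite normrM ler_wpM2l.
  have m2 : d2 t * (df2 t - dz2 t) <= `|d2 t| * (2 * eta + K * L * (`|d1 t| + `|d2 t|)).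
    by apply: le_trans (ler_norm _) _; rewrite normrM ler_wpM2l.
  have n1 : d1 t ^+ 2 = `|d1 t| ^+ 2 by rewrite real_normK// num_real.
  have n2 : d2 t ^+ 2 = `|d2 t| ^+ 2 by rewrite real_normK// num_real.
  have Nn : N t = `|d1 t| ^+ 2 + `|d2 t| ^+ 2 by rewrite /N n1 n2.
  by rewrite Nn /dN; exact: energy_inequality m1 m2.
(* Gronwall is applied on [0, t] only, since the a priori bound on [N] is known no further. *)
have grow t : 0 <= t <= S' -> (forall s, 0 <= s <= t -> N s <= 1) -> N t <= E * eta ^+ 2.
  move=> /andP[t0 tS'] N1.
  have h4 : 0 <= 4 * eta ^+ 2 by rewrite mulr_ge0// sqr_ge0.
  apply: le_trans (gronwall c0 h4 N0 _ _ (t := t) (S :=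
    t)  _) _ => [s /andP[s0 st]|s /andP[s0 st]||].
  - by apply: hN; rewrite s0 (le_trans st).
  - by apply: sq; [rewrite s0 (le_trans st)|apply: N1; rewrite s0 st].
  - by rewrite t0 lexx.
  have tS : t <= S by rewrite (le_trans tS').
  have -> : E * eta ^+ 2 = expR (c * S) * (4 * eta ^+ 2 * S) by rewrite /E; ring.
  apply: ler_pM; rewrite ?expR_ge0 ?mulr_ge0 ?sqr_ge0//.
    by rewrite ler_expR ler_wpM2l.
  by rewrite ler_wpM2l ?mulr_ge0 ?sqr_ge0.
have N2 t : 0 <= t <= S' -> N t <= 2^-1.
  apply: bootstrap => // s; first by move=> /hN/derives_continuous.
  by move=> sS hs; apply: le_trans (grow s sS hs) _.
have N3 t : 0 <= t <= S' -> N t <= E * eta ^+ 2.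
  move=> /andP[t0 tS']; apply: grow; rewrite ?t0// => s /andP[s0 st].
  by apply: le_trans (N2 s _) _; [rewrite s0 (le_trans st)|lra].
move=> t tS; have := N3 t tS; rewrite /N /d1 /d2.
have : E * eta ^+ 2 <= ((1 + E) * eta) ^+ 2.
  rewrite exprMn ler_wpM2r ?sqr_ge0// expr2.
  have := mulr_ge0 E0 E0; lra.
have := sqr_ge0 (f1 t - z1 t); have := sqr_ge0 (f2 t - z2 t).
have nn : 0 <= (1 + E) * eta by rewrite mulr_ge0//; lra.
move=> g1 g2 g3 g4; have g5 := le_trans g4 g3.
split; rewrite -ler_sqr ?nnegrE// real_normK ?num_real//; apply: le_trans g5.
  by rewrite lerDl.
by rewrite lerDr.
Qed.

End comparison.

(** * Quasi-homogeneous centers *)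

Section uniqueness.
Variables (R : realType) (P Q : {poly {poly R}}).

(** The speed [kappa] covers orbits (1), affine reparametrisations (a constant, possibly -1) and the
    curve traced by dilations, whose speed varies. *)
Definition integral_curve (kappa x y : R -> R) (t : R) :=
  derives t x (kappa t * P.[x t, y t]) /\ derives t y (kappa t * Q.[x t, y t]).

(** This is the case eta = 0 of [comparison], with a box built around the second curve. *)
Lemma integral_curve_unique_itv (kappa x y x' y' : R -> R) (S K : R) : 0 <= S ->
  (forall t, 0 <= t <= S -> `|kappa t| <= K) ->
  x 0 = x' 0 -> y 0 = y' 0 ->
  (forall t, 0 <= t <= S -> integral_curve kappa x y t) ->
  (forall t, 0 <= t <= S -> integral_curve kappa x' y' t) ->
  forall t, 0 <= t <= S -> x t = x' t /\ y t = y' t.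
Proof.
move=> S0 hK ex0 ey0 hxy hxy'.
have [B1 B10 hB1] : exists2 C, 0 < C & forall t, 0 <= t <= S -> `|x' t| <= C.
  apply: continuous_itv_bounded => t; rewrite in_itv/= => /hxy'[h _].
  exact: derives_continuous h.
have [B2 B20 hB2] : exists2 C, 0 < C & forall t, 0 <= t <= S -> `|y' t| <= C.
  apply: continuous_itv_bounded => t; rewrite in_itv/= => /hxy'[_ h].
  exact: derives_continuous h.
pose B := B1 + B2 + 1.
have [L1 L10 hL1] := lipschitz_box_poly B P.
have [L2 L20 hL2] := lipschitz_box_poly B Q.
have K0 : 0 <= K by apply: le_trans (hK 0 _); rewrite ?lexx.
have [C [eta0 [C0 e0 H]]] := @comparison R (L1 + L2) B S K (addr_ge0 (ltW L10) (ltW L20)) S0 K0.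
move=> t tS.
have [] : `|x t - x' t| <= C * 0 /\ `|y t - y' t| <= C * 0.
  apply: (H (fun u v => P.[u, v]) (fun u v => Q.[u, v]) kappa x y x' y'
    (fun t => kappa t * P.[x t, y t]) (fun t => kappa t * Q.[x t, y t])
    (fun t => kappa t * P.[x' t, y' t]) (fun t => kappa t * Q.[x' t, y' t]) 0 S) => //.
  - move=> u v u' v' hu hv hu' hv'.
    have s0 : 0 <= `|u - u'| + `|v - v'| by rewrite addr_ge0.
    have [_ h1] := hL1 _ _ _ _ hu hv hu' hv'; have [_ h2] := hL2 _ _ _ _ hu hv hu' hv'.
    split; [apply: le_trans h1 _|apply: le_trans h2 _];
      by rewrite ler_wpM2r// ?lerDl ?lerDr ltW.
  - by rewrite lexx ltW.
  - by move=> s sS; have [? ?] := hxy s sS; have [? ?] := hxy' s sS; split.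
  - move=> s sS; rewrite !subrr normr0 hK//; split => //.
      by apply: le_trans (hB1 s sS) _; rewrite /B; lra.
    by apply: le_trans (hB2 s sS) _; rewrite /B; lra.
  - by move=> s sS _ _; rewrite !subrr normr0.
by rewrite mulr0 !normr_le0 !subr_eq0 => /eqP -> /eqP ->.
Qed.

Lemma integral_curve_unique (kappa x y x' y' : R -> R) : continuous kappa ->
  x 0 = x' 0 -> y 0 = y' 0 ->
  (forall t, integral_curve kappa x y t) -> (forall t, integral_curve kappa x' y' t) ->
  forall t, x t = x' t /\ y t = y' t.
Proof.
move=> ck ex0 ey0 hxy hxy' t; case: (leP 0 t) => [t0|/ltW t0].
  have [K _ hK] : exists2 K, 0 < K & forall s, 0 <= s <= t -> `|kappa s| <= K.
    by apply: continuous_itv_bounded => s _; exact: ck.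
  have h s : 0 <= s <= t -> integral_curve kappa x y s by move=> _; exact: hxy.
  have h' s : 0 <= s <= t -> integral_curve kappa x' y' s by move=> _; exact: hxy'.
  by apply: (integral_curve_unique_itv t0 hK ex0 ey0 h h'); rewrite t0 lexx.
(* Negative times are reached by reversing time, which turns the speed into - kappa (- s). *)
have t0' : 0 <= - t by rewrite oppr_ge0.
have [K _ hK] : exists2 K, 0 < K & forall s, 0 <= s <= - t -> `|- kappa (- s)| <= K.
  apply: continuous_itv_bounded => s _; apply: cvgN.
  by apply: (@continuous_comp _ _ _ (fun s => - s) kappa);
    [exact: derives_continuous (derivesN (derives_id s))|exact: ck].
have op (u v : R -> R) : (forall s, integral_curve kappa u v s) -> forall s, 0 <= s <= - t ->
    integral_curve (fun s => - kappa (- s)) (fun s => u (- s)) (fun s => v (- s)) s.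
  move=> h s _; have [h1 h2] := h (- s); split.
    apply: derives_val (derives_comp h1 (derivesN (derives_id s))) _; ring.
  apply: derives_val (derives_comp h2 (derivesN (derives_id s))) _; ring.
have := integral_curve_unique_itv t0' hK _ _ (op _ _ hxy) (op _ _ hxy') (t := - t).
by rewrite oppr0 !opprK t0' lexx; apply.
Qed.

End uniqueness.

(** * Dilations and transversality of the field to them *)

Section quasi_homogeneity.
Variables (R : realType) (s1 s2 m : nat) (P Q : {poly {poly R}}).
Hypotheses (s1_gt0 : (0 < s1)%N) (s2_gt0 : (0 < s2)%N).
Hypothesis hqh : quasi_homogeneous s1 s2 m P Q.

(** An integer, because it equals -1 when m = 0. *)
Let mu : int := m%:Z - 1.

Lemma quasi_homogeneous_ex (rho x y : R) :
  P.[ex s1 rho * x, ex s2 rho * y] = ex s1 rho * ex mu rho * P.[x, y] /\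
  Q.[ex s1 rho * x, ex s2 rho * y] = ex s2 rho * ex mu rho * Q.[x, y].
Proof.
have e (s : nat) : (0 < s)%N -> ex (s + m - 1)%N rho = ex s rho * ex mu rho.
  move=> s0; have -> : (s + m - 1)%N = s%:Z + mu :> int by rewrite /mu; lia.
  exact: exD.
by rewrite -!e// !exn; exact/hqh/expR_gt0.
Qed.

Lemma poly_vanish_gt0 (p : {poly R}) : (forall l, 0 < l -> p.[l] = 0) -> p = 0.
Proof.
move=> h; apply/eqP; rewrite -[_ == _]negbK; apply/negP => p0.
pose rs := [seq i.+1%:R : R | i <- iota 0 (size p)].
have : (size rs < size p)%N.
  apply: max_poly_roots => //.
    apply/allP => _ /mapP[i _ ->]; apply/rootP; apply: h; exact: ltr0Sn.
  rewrite map_inj_uniq ?iota_uniq// => i j /eqP.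
  by rewrite eqr_nat => /eqP[].
by rewrite size_map size_iota ltnn.
Qed.

(** Both sides are polynomials in [l], so the identity extends from l > 0 to l = -1, which is the
    source of the symmetry of the field. *)
Lemma hornerXY_weighted_poly (p : {poly {poly R}}) (d : nat) (x y : R) :
  (forall l : R, 0 < l -> p.[l ^+ s1 * x, l ^+ s2 * y] = l ^+ d * p.[x, y]) ->
  forall l : R, p.[l ^+ s1 * x, l ^+ s2 * y] = l ^+ d * p.[x, y].
Proof.
move=> h; have [N hN] := bidegree_bound p.
pose u : {poly R} := \sum_(a < N) \sum_(b < N) (p`_a`_b * (x ^+ a * y ^+ b)) *: 'X^(s1 * a +
  s2 * b).
have hu l : u.[l] = p.[l ^+ s1 * x, l ^+ s2 * y].
  rewrite (hornerXY_sum _ _ hN) horner_sum; apply: eq_bigr => a _.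
  rewrite horner_sum; apply: eq_bigr => b _.
  by rewrite hornerZ hornerXn exprD !exprM !exprMn; ring.
have : u - p.[x, y] *: 'X^d = 0.
  apply: poly_vanish_gt0 => l l0.
  by rewrite hornerD hornerN hornerZ hornerXn hu h// mulrC subrr.
move=> /eqP; rewrite subr_eq0 => /eqP e l.
by rewrite -hu e hornerZ hornerXn mulrC.
Qed.

Lemma quasi_homogeneous_sign (x y : R) :
  P.[(-1) ^+ s1 * x, (-1) ^+ s2 * y] = (-1) ^+ s1 * (-1) ^+ m.+1 * P.[x, y] /\
  Q.[(-1) ^+ s1 * x, (-1) ^+ s2 * y] = (-1) ^+ s2 * (-1) ^+ m.+1 * Q.[x, y].
Proof.
have e (s : nat) : (0 < s)%N -> (-1) ^+ s * (-1) ^+ m.+1 = (-1) ^+ (s + m - 1) :> R.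
  by move=> s0; rewrite -exprD -signr_odd -[RHS]signr_odd; congr ((-1) ^+ _); lia.
by rewrite !e//; split; apply: hornerXY_weighted_poly => l l0; have [] := hqh x y l0.
Qed.

Lemma integral_curve_dilation (rho : R) (x y : R -> R) :
  (forall t, integral_curve P Q (fun=> 1) x y t) ->
  forall t, integral_curve P Q (fun=> 1) (fun t => ex s1 rho * x (ex mu rho * t))
    (fun t => ex s2 rho * y (ex mu rho * t)) t.
Proof.
move=> h t; have [h1 h2] := h (ex mu rho * t).
have [e1 e2] := quasi_homogeneous_ex rho (x (ex mu rho * t)) (y (ex mu rho * t)).
have dl := derivesZ (ex mu rho) (derives_id t).
split; [apply: derives_val (derivesZ _ (derives_comp h1 dl)) _
       |apply: derives_val (derivesZ _ (derives_comp h2 dl)) _];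
  rewrite ?e1 ?e2; ring.
Qed.

Hypothesis hcenter : center_at_origin (vector_field P Q).

(** The definition of a center gives closed orbits near the origin only; a dilation carries any
    point into that neighbourhood, and the inverse dilation carries the orbit back. *)
Lemma closed_orbit_through (x0 y0 : R) : (x0 != 0) || (y0 != 0) ->
  exists x y : R -> R, exists T : R,
    [/\ 0 < T, x 0 = x0 /\ y 0 = y0, forall t, integral_curve P Q (fun=> 1) x y t,
        forall t, x (t + T) = x t /\ y (t + T) = y t &
        exists t, (x t != x0) || (y t != y0)].
Proof.
move=> xy0; have [_ hc] := hcenter.
have [e e0 he] : exists2 e : R, 0 < e & forall x y : R, `|x| < e -> `|y| < e ->
    (x != 0) || (y != 0) -> closed_orbit (vector_field P Q) (x, y).
  move/nbhs_ballP : hc => [e /= e0 he]; exists e => // x y xe ye xy.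
  apply: he => /=; first by split; rewrite /ball/= sub0r normrN.
  by apply/eqP => -[x00 y00]; move: xy; rewrite x00 y00 eqxx.
(* Since l <= 1 and the weights are at least 1, l^s <= l for both weights; the factor 2 yields
   strict inequalities. *)
pose l := Num.min 1 (e / (2 * (1 + `|x0| + `|y0|))).
have D0 : 0 < 2 * (1 + `|x0| + `|y0|).
  by rewrite mulr_gt0// -addrA ltr_wpDr// addr_ge0.
have l0 : 0 < l by rewrite lt_min ltr01 divr_gt0.
have l1 : l <= 1 by rewrite /l ge_min lexx.
have lD : l * (2 * (1 + `|x0| + `|y0|)) <= e.
  by rewrite -ler_pdivlMr// /l ge_min lexx orbT.
have small (s : nat) z : (0 < s)%N -> `|z| <= `|x0| + `|y0| -> `|l ^+ s * z| < e.
  move=> s_gt0 hz; rewrite normrM ger0_norm ?exprn_ge0 ?(ltW l0)//.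
  have ls : l ^+ s <= l by rewrite -[leRHS]expr1 ler_wiXn2l// ltW.
  apply: (@le_lt_trans _ _ (l * (`|x0| + `|y0|))).
    by apply: ler_pM => //; rewrite exprn_ge0// ltW.
  have : 0 <= l * (`|x0| + `|y0|) by rewrite mulr_ge0 ?addr_ge0// ltW.
  lra.
pose rho := ln l.
have el (s : nat) : ex s rho = l ^+ s by rewrite exn lnK.
have [|||T [g [T0 g0 hg gT [t1 gt1]]]] := he (ex s1 rho * x0) (ex s2 rho * y0).
- by rewrite el small// lerDl.
- by rewrite el small// lerDr.
- by rewrite !mulf_eq0 !(gt_eqF (ex_gt0 _ _)).
have hG t : integral_curve P Q (fun=> 1) (fun t => (g t).1) (fun t => (g t).2) t.
  have [h1 h2] := hg t I; split; rewrite mul1r; [exact: h1|exact: h2].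
pose lam := ex mu (- rho).
have lam0 : 0 < lam by exact: ex_gt0.
exists (fun t => ex s1 (- rho) * (g (lam * t)).1),
  (fun t => ex s2 (- rho) * (g (lam * t)).2), (T / lam).
have exx d (u : R) : ex d (- rho) * (ex d rho * u) = u.
  by rewrite mulrA /ex -expRD mulrN addNr expR0 mul1r.
split.
- exact: divr_gt0.
- by rewrite mulr0 g0 /= !exx.
- exact: (integral_curve_dilation (- rho) hG).
- by move=> t; rewrite mulrDr [lam * (T / lam)]mulrC divfK ?gt_eqF// gT.
exists (t1 / lam); rewrite [lam * (t1 / lam)]mulrC divfK ?(gt_eqF lam0)//.
apply/negPn/negP; rewrite negb_or !negbK => /andP[/eqP e1 /eqP e2]; apply: gt1.
rewrite [g t1]surjective_pairing -e1 -e2 /ex !mulrN !expRN !mulrA.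
by rewrite !divff ?mul1r// expR_eq0.
Qed.

Lemma bounded_orbit (x y : R -> R) (T : R) : 0 < T ->
  (forall t, integral_curve P Q (fun=> 1) x y t) ->
  (forall t, x (t + T) = x t /\ y (t + T) = y t) ->
  exists2 C, 0 < C & forall t, `|x t| <= C /\ `|y t| <= C.
Proof.
move=> T0 h hT.
have cx : continuous x by move=> t; have [h1 _] := h t; exact: derives_continuous h1.
have cy : continuous y by move=> t; have [_ h2] := h t; exact: derives_continuous h2.
have [C C0 hC] := periodic_bounded T0 cx (fun t => proj1 (hT t)).
have [D D0 hD] := periodic_bounded T0 cy (fun t => proj2 (hT t)).
exists (C + D); first exact: addr_gt0.
by move=> t; have := hC t; have := hD t; split; lra.
Qed.

(* At a point where the field is parallel to the Euler field (s1 x, s2 y), the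
   orbit would be the unbounded curve described by the dilations of that point. *)
Lemma transverse_to_dilations (x0 y0 : R) : (x0 != 0) || (y0 != 0) ->
  s1%:R * x0 * Q.[x0, y0] - s2%:R * y0 * P.[x0, y0] != 0.
Proof.
move=> xy0; apply/eqP => W0.
have [x [y [T [T0 [xi yi] h hT [t1 nt1]]]]] := closed_orbit_through xy0.
have s1R : s1%:R != 0 :> R by rewrite pnatr_eq0 -lt0n.
have s2R : s2%:R != 0 :> R by rewrite pnatr_eq0 -lt0n.
have [nu [nuP nuQ]] : exists nu, P.[x0, y0] = nu * (s1%:R * x0) /\ Q.[x0, y0] =
  nu * (s2%:R * y0).
  have [x00|x0n] := eqVneq x0 0.
    have y0n : y0 != 0 by move: xy0; rewrite x00 eqxx.
    have P0 : P.[x0, y0] = 0.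
      move: W0; rewrite x00 mulr0 mul0r sub0r => /eqP; rewrite oppr_eq0 mulf_eq0.
      by rewrite mulf_eq0 (negbTE s2R) (negbTE y0n) /= => /eqP.
    exists (Q.[x0, y0] / (s2%:R * y0)); rewrite P0 {2}x00 !mulr0; split => //.
    by rewrite divfK// mulf_neq0.
  exists (P.[x0, y0] / (s1%:R * x0)); rewrite divfK ?mulf_neq0//; split => //.
  apply: (mulfI (x := s1%:R * x0)); first by rewrite mulf_neq0.
  move/eqP : W0; rewrite subr_eq0 => /eqP ->; field; rewrite ?s1R ?x0n //.
(* If [nu] is 0 the point is at rest, whereas its orbit is not constant. *)
have [nu0|nu0] := eqVneq nu 0.
  have hc t : integral_curve P Q (fun=> 1) (fun=> x0) (fun=> y0) t.
    by split; rewrite ?nuP ?nuQ nu0 !mul0r mulr0; exact: derives_cst.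
  have c1 : continuous (fun _ : R => 1 : R) by move=> ?; exact: cvg_cst.
  have [e1 e2] := integral_curve_unique c1 xi yi h hc t1.
  by move: nt1; rewrite e1 e2 !eqxx.
(* At (e^(s1 s) x0, e^(s2 s) y0) the field is nu e^(mu s) times the velocity of the dilation curve.
   The time change [tau] with derivative [kappa] makes that curve follow the orbit. *)
pose kappa s := ex (- mu) s / nu.
have ck : continuous kappa.
  move=> s; apply: cvgM; last exact: cvg_cst.
  exact: derives_continuous (derives_ex _ s).
have [tau tau0 htau] := antiderivative ck.
have hd s : integral_curve P Q kappa (fun s => ex s1 s * x0) (fun s => ex s2 s * y0) s.
  have [e1 e2] := quasi_homogeneous_ex s x0 y0.
  have em : ex mu s != 0 by rewrite gt_eqF ?ex_gt0.
  split; rewrite ?e1 ?e2 ?nuP ?nuQ /kappa exN.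
    apply: derives_val (derivesM (derives_ex s1 s) (derives_cst s x0)) _.
    by rewrite -pmulrn; field; rewrite em nu0.
  apply: derives_val (derivesM (derives_ex s2 s) (derives_cst s y0)) _.
  by rewrite -pmulrn; field; rewrite em nu0.
have hf s : integral_curve P Q kappa (fun s => x (tau s)) (fun s => y (tau s)) s.
  have [h1 h2] := h (tau s); split.
    by apply: derives_val (derives_comp h1 (htau s)) _; rewrite mul1r mulrC.
  by apply: derives_val (derives_comp h2 (htau s)) _; rewrite mul1r mulrC.
have ex0 (d : int) : ex d 0 = 1 :> R by rewrite /ex mulr0 expR0.
have key := integral_curve_unique ck _ _ hf hd.
have {}key s : x (tau s) = ex s1 s * x0 /\ y (tau s) = ex s2 s * y0.
  by apply: key; rewrite tau0 ex0 mul1r.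
have [C C0 hC] := bounded_orbit T0 h hT.
(* With q = C/|z| this reads q < e^(s q), which follows from e^y >= 1 + y and s >= 1. *)
have unb (s : nat) z : (0 < s)%N -> z != 0 -> C < `|ex s (C / `|z|) * z|.
  move=> s0 z0; rewrite normrM (gtr0_norm (ex_gt0 _ _)).
  rewrite -ltr_pdivrMr ?normr_gt0//; set q := C / _.
  have q0 : 0 < q by rewrite divr_gt0 ?normr_gt0.
  apply: lt_le_trans (expR_ge1Dx _).
  have : 1 * q <= s%:R * q by rewrite ler_pM2r// ler1n.
  rewrite -pmulrn; lra.
case/orP: xy0 => z0.
  have [h1 _] := hC (tau (C / `|x0|)); move: h1; rewrite (proj1 (key _)).
  by rewrite leNgt unb.
have [_ h1] := hC (tau (C / `|y0|)); move: h1; rewrite (proj2 (key _)).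
by rewrite leNgt unb.
Qed.

End quasi_homogeneity.

(** * The reference orbit and its symmetry *)

Section center_orbit.
Variables (R : realType) (s1 s2 m : nat) (P Q : {poly {poly R}}).
Hypotheses (s1_gt0 : (0 < s1)%N) (s2_gt0 : (0 < s2)%N).
Hypothesis hqh : quasi_homogeneous s1 s2 m P Q.
Hypothesis hcenter : center_at_origin (vector_field P Q).
Hypothesis hreturn : first_return s1 s2 (vector_field P Q) 1 1.

Let mu : int := m%:Z - 1.
Let A1 : R := section_param s1 s2 1.
(** The sign (-1)^(m-1), written without subtraction. The dilation of factor -1 maps the field to
    itself up to this sign, hence reverses time when it is -1. *)
Let delta : R := (-1) ^+ m.+1.

Lemma section_param_gt0 (h : R) : 0 < h -> 0 < section_param s1 s2 h.
Proof. by move=> h0; rewrite mulr_gt0 ?exprn_gt0// powR_gt0// ltr0n. Qed.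

Lemma integral_curve_affine (x y : R -> R) (l c : R) :
  (forall t, integral_curve P Q (fun=> 1) x y t) ->
  forall t, integral_curve P Q (fun=> l) (fun t => x (l * t + c)) (fun t => y (l * t + c)) t.
Proof.
move=> h t; have [h1 h2] := h (l * t + c).
have dl := derivesD (derivesZ l (derives_id t)) (derives_cst t c).
split; [apply: derives_val (derives_comp (g := fun t => l * t + c) h1 dl) _
       |apply: derives_val (derives_comp (g := fun t => l * t + c) h2 dl) _]; ring.
Qed.

Lemma integral_curve_eq (l : R) (x y x' y' : R -> R) :
  (forall t, integral_curve P Q (fun=> l) x y t) ->
  (forall t, integral_curve P Q (fun=> l) x' y' t) ->
  x 0 = x' 0 -> y 0 = y' 0 -> forall t, x t = x' t /\ y t = y' t.
Proof.
move=> h h' e1 e2; apply: (integral_curve_unique (kappa := fun=> l)) => //.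
by move=> ?; exact: cvg_cst.
Qed.

(** The time [T] is taken from the first return of the section point to itself rather than from the
    closed orbit, whose stated period could be a multiple of it; this rules out crossings in
    between. Uniqueness identifies the two curves on [0, T] and yields periodicity. *)
Lemma return_orbit : exists a b : R -> R, exists T : R,
  [/\ 0 < T, a 0 = A1 /\ b 0 = 0, forall t, integral_curve P Q (fun=> 1) a b t,
      forall t, a (t + T) = a t /\ b (t + T) = b t &
      forall t, 0 < t < T -> ~ (0 < a t /\ b t = 0)].
Proof.
have A10 : 0 < A1 := section_param_gt0 ltr01.
have [|a [b [T0 [_ [a0 b0] h _ _]]]] := closed_orbit_through s1_gt0 s2_gt0 hqh hcenter (x0 :=
  A1) (y0 := 0).
  by rewrite gt_eqF.
have [_ [T [g [T0' hg g0 gT hgT]]]] := hreturn.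
have eg t : 0 <= t <= T -> a t = (g t).1 /\ b t = (g t).2.
  apply: (@integral_curve_unique_itv R P Q (fun=> 1) a b
    (fun t => (g t).1) (fun t => (g t).2) T 1 (ltW T0')).
  - by move=> s _; rewrite normr1.
  - by rewrite g0.
  - by rewrite g0.
  - by move=> s _; exact: h.
  move=> s sT; have [h1 h2] := hg s sT; split; rewrite mul1r; [exact: h1|exact: h2].
exists a, b, T; split => //.
  have eT : forall t, integral_curve P Q (fun=> 1) (fun t => a (1 * t +
    T)) (fun t => b (1 * t + T)) t.
    exact: integral_curve_affine.
  have [|aT bT] := eg T; first by rewrite lexx ltW.
  have e1 : a (1 * 0 + T) = a 0 by rewrite mulr0 add0r aT gT a0.
  have e2 : b (1 * 0 + T) = b 0 by rewrite mulr0 add0r bT gT b0.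
  by move=> t; have := integral_curve_eq eT h e1 e2 t; rewrite mul1r.
move=> t tT; have [|-> ->] := eg t; last exact: hgT.
by case/andP: tT => /ltW -> /ltW ->.
Qed.

Section orbit.
Variables (a b : R -> R) (T : R).
Hypotheses (T0 : 0 < T) (a0 : a 0 = A1) (b0 : b 0 = 0).
Hypothesis hab : forall t, integral_curve P Q (fun=> 1) a b t.
Hypothesis abT : forall t, a (t + T) = a t /\ b (t + T) = b t.
Hypothesis ab_cross : forall t, 0 < t < T -> ~ (0 < a t /\ b t = 0).

Let w t := s1%:R * a t * Q.[a t, b t] - s2%:R * b t * P.[a t, b t].

Let ca : continuous a.
Proof. by move=> t; have [h _] := hab t; exact: derives_continuous h. Qed.

Let cb : continuous b.
Proof. by move=> t; have [_ h] := hab t; exact: derives_continuous h. Qed.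

(** By uniqueness an orbit through the rest point at the origin would stay there, but [a 0] is
    positive. *)
Lemma orbit_neq0 t : (a t != 0) || (b t != 0).
Proof.
apply/negPn/negP; rewrite negb_or !negbK => /andP[/eqP at0 /eqP bt0].
have [V0 _] := hcenter.
have [P0 Q0] : P.[0, 0] = 0 /\ Q.[0, 0] = 0 by case: V0.
have h0 s : integral_curve P Q (fun=> 1) (fun=> 0) (fun=> 0) s.
  by split; rewrite ?P0 ?Q0 mulr0; exact: derives_cst.
have h1 : forall s, integral_curve P Q (fun=> 1) (fun s => a (1 * s +
  t)) (fun s => b (1 * s + t)) s.
  exact: integral_curve_affine.
have [||e _] := integral_curve_eq h1 h0 _ _ (- t).
- by rewrite mulr0 add0r.
- by rewrite mulr0 add0r.
by move: e; rewrite mul1r addNr a0; apply/eqP; rewrite gt_eqF// section_param_gt0.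
Qed.

Lemma orbit_wedge_neq0 t : w t != 0.
Proof. exact: (transverse_to_dilations s1_gt0 s2_gt0 hqh hcenter (orbit_neq0 t)). Qed.

Lemma orbit_wedge_continuous : continuous w.
Proof.
move=> t.
have hP : {for t, continuous (fun t => P.[a t, b t])} :=
  @continuous_hornerXY R P a b t (@ca t) (@cb t).
have hQ : {for t, continuous (fun t => Q.[a t, b t])} :=
  @continuous_hornerXY R Q a b t (@ca t) (@cb t).
by apply: cvgB; (apply: cvgM; first apply: cvgM);
  [exact: cvg_cst|exact: ca|exact: hQ|exact: cvg_cst|exact: cb|exact: hP].
Qed.

Lemma orbit_wedge_sign t t' : 0 < w t * w t'.
Proof.
wlog tt' : t t' / t <= t'.
  by move=> H; case: (leP t t') => [/H//|/ltW/H]; rewrite mulrC.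
rewrite lt_def mulf_neq0 ?orbit_wedge_neq0//= leNgt; apply/negP => ww.
have [|||c _ /eqP] := @ivt_zero R (fun s => w t' * w s) t t' tt'.
- by move=> s _; apply: cvgM; [exact: cvg_cst|exact: orbit_wedge_continuous].
- by rewrite mulrC ltW.
- by rewrite -expr2 sqr_ge0.
by rewrite mulf_eq0 !(negbTE (orbit_wedge_neq0 _)).
Qed.

Lemma orbit_left_of_origin t : 0 < t < T -> b t = 0 -> a t < 0.
Proof.
move=> tT bt0; rewrite ltNge; apply/negP; rewrite le_eqVlt => /orP[/eqP at0|at0].
  by have := orbit_neq0 t; rewrite -at0 bt0 eqxx.
exact: (ab_cross tT).
Qed.

(** By periodicity [b] crosses zero in the same direction at 0 and at [T]. So q b is nonnegative
    just after 0 and nonpositive just before [T], and vanishes in between. *)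
Lemma orbit_crosses_left : exists2 t, 0 < t < T & b t = 0.
Proof.
pose q := Q.[A1, 0].
have A10 : 0 < A1 := section_param_gt0 ltr01.
have q0 : q != 0.
  have := orbit_wedge_neq0 0; rewrite /w a0 b0 mulr0 mul0r subr0.
  by rewrite mulf_eq0 negb_or => /andP[].
pose f t := q * b t; pose df t := q * Q.[a t, b t].
have hf (t : R) : derives t f (df t).
  by have [_ h] := hab t; apply: derives_val (derivesZ q h) _; rewrite mul1r.
have dfT t : df (t + T) = df t by rewrite /df; have [-> ->] := abT t.
have fT : f T = 0 by rewrite /f -[T]add0r; have [_ ->] := abT 0; rewrite b0 mulr0.
have f0 : f 0 = 0 by rewrite /f b0 mulr0.
have cdf : continuous df.
  by move=> t; apply: cvgM;
    [exact: cvg_cst|exact: (@continuous_hornerXY R Q a b t (@ca t) (@cb t))].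
have df0 : 0 < df 0 by rewrite /df a0 b0 -expr2 lt_def sqr_ge0 sqrf_eq0 q0.
have [e e0 he] : exists2 e : R, 0 < e & forall t : R, `|t| < e -> 0 <= df t.
  have /cdf[/= e e0 he] : nbhs (df 0) [set x | 0 < x] by exact: lt_nbhsr.
  by exists e => // t te; apply/ltW/he; rewrite /= sub0r normrN.
pose d := Num.min (e / 2) (T / 3).
have d0 : 0 < d by rewrite lt_min !divr_gt0.
have de : d < e by rewrite /d gt_min; apply/orP; left; lra.
have dT : d < T / 2.
  by rewrite /d gt_min ltr_pM2l ?ltf_pV2 ?posrE ?ltr_nat ?orbT.
have fd : 0 <= f d.
  have := @derive_ge R f df 0 d 0 (ltW d0) (fun t _ => hf t).
  rewrite mul0r f0 subr0; apply=> t /andP[t0 td]; apply: he.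
  by rewrite ger0_norm; lra.
have fTd : f (T - d) <= 0.
  have := @derive_ge R f df (T - d) T 0 _ (fun t _ => hf t).
  rewrite mul0r fT sub0r oppr_ge0; apply=> [|t /andP[t0 td]]; first by lra.
  by rewrite -(subrK T t) dfT; apply: he; rewrite ler0_norm; lra.
have [|||| c cd /eqP] := @ivt_zero R (fun t => - f t) d (T - d).
- by lra.
- by move=> t _; apply: cvgN; exact: derives_continuous (hf t).
- by rewrite oppr_le0.
- by rewrite oppr_ge0.
rewrite oppr_eq0 mulf_eq0 (negbTE q0) => /eqP c0.
by exists c => //; lra.
Qed.

Let delta2 : delta * delta = 1.
Proof. by rewrite /delta -expr2 sqrr_sign. Qed.

Lemma reflected_orbit t : integral_curve P Q (fun=> delta)
  (fun t => (-1) ^+ s1 * a t) (fun t => (-1) ^+ s2 * b t) t.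
Proof.
have [e1 e2] := quasi_homogeneous_sign s1_gt0 s2_gt0 hqh (a t) (b t).
have [h1 h2] := hab t; rewrite -/delta in e1 e2.
split; rewrite ?e1 ?e2.
  apply: derives_val (derivesZ _ h1) _; rewrite mul1r.
  by rewrite -[LHS]mul1r -[X in X * _ = _]delta2; ring.
apply: derives_val (derivesZ _ h2) _; rewrite mul1r.
by rewrite -[LHS]mul1r -[X in X * _ = _]delta2; ring.
Qed.

(** The reflected starting point lies on the x-axis: it is the starting point when s1 is even, and
    on the negative half-axis when s1 is odd. In that case a dilation carries the left crossing of
    the orbit onto it. That this dilation is trivial is shown afterwards. *)
Lemma reflected_start : exists t1 rho,
  ex s1 rho * a t1 = (-1) ^+ s1 * A1 /\ b t1 = 0.
Proof.
have A10 : 0 < A1 := section_param_gt0 ltr01.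
case s1odd: (odd s1); last first.
  exists 0, 0; rewrite a0 b0 /ex mulr0 expR0 mul1r.
  by rewrite -signr_odd s1odd mul1r.
have [t1 t1T bt1] := orbit_crosses_left.
have at1 := orbit_left_of_origin t1T bt1.
exists t1, (ln (A1 / - a t1) / s1%:R); split => //.
rewrite /ex -pmulrn [s1%:R * _]mulrC divfK ?pnatr_eq0 -?lt0n//.
rewrite lnK ?posrE ?divr_gt0 ?oppr_gt0//.
rewrite -signr_odd s1odd expr1 invrN; field; by rewrite lt_eqF.
Qed.

(** By uniqueness the reflected orbit is a dilation of the orbit. Both have the same supremum of
    |x|, which is finite and positive, so the dilation factor is 1. *)
Lemma orbit_symmetry : exists c, forall t,
  a (delta * t + c) = (-1) ^+ s1 * a t /\ b (delta * t + c) = (-1) ^+ s2 * b t.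
Proof.
have A10 : 0 < A1 := section_param_gt0 ltr01.
have [t1 [rho [e1 e2]]] := reflected_start.
pose l := ex mu rho.
have l0 : l != 0 by rewrite gt_eqF ?ex_gt0.
have hd := integral_curve_affine delta (t1 / l) (integral_curve_dilation s1_gt0 s2_gt0 hqh
  rho hab).
have lt1 : l * (delta * 0 + t1 / l) = t1 by rewrite mulr0 add0r mulrC divfK.
have e t : ex s1 rho * a (l * (delta * t + t1 / l)) = (-1) ^+ s1 * a t /\
    ex s2 rho * b (l * (delta * t + t1 / l)) = (-1) ^+ s2 * b t.
  have := integral_curve_eq hd reflected_orbit; apply.
    by rewrite -/l lt1 e1 a0.
  by rewrite -/l lt1 e2 b0 !mulr0.
have ea t : `|a t| = ex s1 rho * `|a (l * (delta * t + t1 / l))|.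
  have [h _] := e t.
  by rewrite -[in RHS](gtr0_norm (ex_gt0 s1 rho)) -normrM h normrM normrX normrN1 expr1n mul1r.
have [C C0 hC] := bounded_orbit T0 hab abT.
pose E := range (fun t => `|a t|).
have supE : has_sup E.
  split; first by exists `|a 0|; exists 0.
  by exists C => _ [t _ <-]; have [] := hC t.
have leM t : `|a t| <= sup E by apply: ub_le_sup; [case: supE|exists t].
have M0 : 0 < sup E by apply: lt_le_trans (leM 0); rewrite a0 normr_gt0 gt_eqF.
have ex1 : ex s1 rho = 1.
  apply/eqP; rewrite eq_le; apply/andP; split.
    rewrite -(ler_pM2r M0) mul1r mulrC -ler_pdivlMr ?ex_gt0//.
    apply: ge_sup; first by case: supE.
    move=> _ [u _ <-]; rewrite ler_pdivlMr ?ex_gt0//.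
    (* The affine change of time is onto, so every value of |a| occurs on the right-hand side of
       [ea]. *)
    have -> : u = l * (delta * (delta * ((u - t1) / l)) + t1 / l).
      by rewrite mulrA delta2 mul1r; field.
    by rewrite mulrC -ea.
  rewrite -(ler_pM2r M0) mul1r; apply: ge_sup; first by case: supE.
  by move=> _ [u _ <-]; rewrite ea ler_pM2l ?ex_gt0.
have rho0 : rho = 0.
  have : expR (s1%:~R * rho) = expR 0 :> R by rewrite expR0.
  move/expR_inj/eqP; rewrite mulf_eq0 intr_eq0 => /orP[|/eqP//].
  by move=> /eqP[s10]; move: s1_gt0; rewrite s10.
have ex0 (d : int) : ex d 0 = 1 :> R by rewrite /ex mulr0 expR0.
exists t1 => t; have := e t.
by rewrite /l rho0 !ex0 !mul1r divr1.
Qed.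

(** The wedge keeps a constant sign along the orbit, while the reflection multiplies it by (-1)^(s1
    + s2) delta; that product is therefore 1. *)
Lemma orbit_orientation c : (forall t,
    a (delta * t + c) = (-1) ^+ s1 * a t /\ b (delta * t + c) = (-1) ^+ s2 * b t) ->
  delta = (-1) ^+ (s1 + s2).
Proof.
move=> h; have := orbit_wedge_sign (delta * 0 + c) 0.
have -> : w (delta * 0 + c) = (-1) ^+ (s1 + s2) * delta * w 0.
  rewrite /w; have [-> ->] := h 0.
  have [-> ->] := quasi_homogeneous_sign s1_gt0 s2_gt0 hqh (a 0) (b 0).
  by rewrite -/delta exprD; ring.
rewrite (_ : _ * w 0 * w 0 = (-1) ^+ (s1 + s2) * delta * w 0 ^+ 2); last by ring.
have w2 : 0 < w 0 ^+ 2 by rewrite expr2 orbit_wedge_sign.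
rewrite pmulr_lgt0//.
rewrite /delta -(signr_odd _ m.+1) -(signr_odd _ (s1 + s2)).
case: (odd m.+1); case: (odd (s1 + s2)); rewrite /= ?expr1 ?expr0 // => h1; exfalso;
  move: h1; rewrite ?mulr1 ?mul1r; lra.
Qed.

End orbit.

End center_orbit.

(** * Formal first integrals *)

Lemma continuous_sum (R : realType) (I : Type) (s : seq I) (P : pred I) (F : I -> R -> R) :
  (forall i, P i -> continuous (F i)) -> continuous (fun t => \sum_(i <- s | P i) F i t).
Proof.
move=> h; elim: s => [|i s IH] t.
  have -> : (fun t => \sum_(i <- [::] | P i) F i t) = (fun=> 0).
    by apply/funext => u; rewrite big_nil.
  exact: cvg_cst.
have -> : (fun t => \sum_(i <- i :: s | P i) F i t) =
    (fun t => (if P i then F i t else 0) + \sum_(i <- s | P i) F i t).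
  by apply/funext => u; rewrite big_cons; case: (P i); rewrite ?add0r.
apply: cvgD; last exact: IH.
by case Pi : (P i); [exact: h|exact: cvg_cst].
Qed.

Section first_integrals.
Variables (R : realType) (I : finType) (e : I -> int) (A B : I -> R -> R) (mu : nat -> I -> R).

(* c i d is the coefficient of eps^i r^d in a formal first integral, with r = expR rho,
   and dc i d is its derivative in t; the recurrence says that
   (1 + beta) d_t + alpha r d_r kills it, where
   alpha = \sum_j eps^j \sum_x mu j x * A x * r^(e x) and likewise for beta and B. *)
Definition first_integral_rhs (c dc : nat -> int -> R -> R) (i : nat) (d : int) (t : R) : R :=
  - \sum_(1 <= j < i.+1) \sum_x mu j x *
      (B x t * dc (i - j)%N (d - e x) t + A x t * ((d - e x)%:~R * c (i - j)%N (d - e x) t)).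

Definition first_integral (k : nat) (c dc : nat -> int -> R -> R) :=
  forall i d, (i <= k)%N ->
    forall t : R, derives t (c i d) (dc i d t) /\ dc i d t = first_integral_rhs c dc i d t.

Lemma first_integral_rhs_ext c dc c' dc' i d t :
  (forall j d, (j < i)%N -> c j d t = c' j d t /\ dc j d t = dc' j d t) ->
  first_integral_rhs c dc i d t = first_integral_rhs c' dc' i d t.
Proof.
move=> h; rewrite /first_integral_rhs; congr (- _).
apply: eq_big_nat => j /andP[j0 ji]; apply: eq_bigr => x _.
have [|-> ->] // := h (i - j)%N (d - e x).
by rewrite ltn_subrL j0 (leq_trans j0).
Qed.

Hypotheses (cA : forall x, continuous (A x)) (cB : forall x, continuous (B x)).

(** The right-hand side at order i involves lower orders only, so each order costs one
    antiderivative in t, taken to vanish at 0. The predicate [E] records the exponents of J_i / r,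
    hence the argument d - 1. *)
Lemma first_integral_exists (E : nat -> int -> Prop) (k : nat) : E 0%N 0 ->
  (forall i j x z, (1 <= j <= i)%N -> mu j x != 0 -> E (i - j)%N z -> E i (z + e x)) ->
  exists c dc, [/\ first_integral k c dc,
    forall d t, c 0%N d t = (d == 1)%:R,
    forall i d, (0 < i <= k)%N -> c i d 0 = 0,
    forall i d, (i <= k)%N -> continuous (dc i d) &
    forall i d t, (i <= k)%N -> ~ E i (d - 1) -> c i d t = 0 /\ dc i d t = 0].
Proof.
move=> E0 EM; elim: k => [|k [c [dc [hI c0 ci0 cdc hE]]]].
  exists (fun _ d _ => (d == 1)%:R), (fun _ _ _ => 0); split => //.
  - move=> i d; rewrite leqn0 => /eqP -> t; split; first exact: derives_cst.
    by rewrite /first_integral_rhs big_geq// oppr0.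
  - by move=> i d /andP[/leq_trans h /h].
  - by move=> i d _ t; exact: cvg_cst.
  move=> i d t; rewrite leqn0 => /eqP -> hd; split => //.
  by have [d1|//] := eqVneq d 1; case: hd; rewrite d1 subrr.
pose g d t := first_integral_rhs c dc k.+1 d t.
have cc i d : (i <= k)%N -> continuous (c i d).
  by move=> ik t; have [h _] := hI i d ik t; exact: derives_continuous h.
have cg d : continuous (g d).
  (* The redundant guard keeps the bounds on [j] at hand inside [continuous_sum]. *)
  suff h : continuous (fun t => \sum_(1 <= j < k.+2 | (1 <= j < k.+2)%N) \sum_x mu j x *
      (B x t * dc (k.+1 - j)%N (d - e x) t
      + A x t * ((d - e x)%:~R * c (k.+1 - j)%N (d - e x) t))).
    have -> : g d = (fun t => - \sum_(1 <= j < k.+2 | (1 <= j < k.+2)%N) \sum_x mu j x *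
      (B x t * dc (k.+1 - j)%N (d - e x) t
      + A x t * ((d - e x)%:~R * c (k.+1 - j)%N (d - e x) t))).
      by apply/funext => t; congr (- _); exact: big_nat.
    by move=> t; apply: cvgN; exact: h.
  apply: continuous_sum => j /andP[j0 jk]; apply: continuous_sum => x _ t.
  have kj : (k.+1 - j <= k)%N by lia.
  apply: cvgM; first exact: cvg_cst.
  apply: cvgD; apply: cvgM; [exact: cB|exact: cdc|exact: cA|].
  by apply: cvgM; [exact: cvg_cst|exact: cc].
have /choice[G hG] : forall d, exists F : R -> R, F 0 = 0 /\ forall x : R, derives x F (g d x).
  by move=> d; have [F F0 hF] := antiderivative (cg d); exists F.
exists (fun i d => if i == k.+1 then G d else c i d),
  (fun i d => if i == k.+1 then g d else dc i d).
have lek i : (i <= k.+1)%N -> i != k.+1 -> (i <= k)%N.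
  by move=> ik1 ink; rewrite -ltnS ltn_neqAle ink.
have gE d t : ~ E k.+1 (d - 1) -> g d t = 0.
  move=> nE; rewrite /g /first_integral_rhs big_nat big1 ?oppr0// => j /andP[j0 jk].
  apply: big1 => x _; have [->|mux] := eqVneq (mu j x) 0; first by rewrite mul0r.
  have [| |-> ->] := hE (k.+1 - j)%N (d - e x) t; [by lia| |by rewrite !mulr0 addr0 mulr0].
  move=> hx; apply: nE; have -> : d - 1 = (d - e x - 1) + e x by ring.
  by apply: (EM _ j) => //; rewrite j0 -ltnS.
split.
- move=> i d ik t; case: eqVneq => [->|ink].
    have [_ hd] := hG d; split; first exact: hd.
    apply: first_integral_rhs_ext => j d' jk.
    by rewrite ltn_eqF.
  have [h1 h2] := hI i d (lek _ ik ink) t; split => //; rewrite h2.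
  apply: first_integral_rhs_ext => j d' ji.
  by rewrite ltn_eqF// (leq_trans ji).
- by move=> d t; exact: c0.
- move=> i d /andP[i0 ik]; case: eqVneq => [_|ink]; first by have [] := hG d.
  by apply: ci0; rewrite i0 lek.
- by move=> i d ik; case: eqVneq => [_|ink]; [exact: cg|exact/cdc/lek].
move=> i d t ik; case: eqVneq => [->|ink]; last by apply: hE; exact: lek.
move=> nE; split; last exact: gE.
(* Outside [E] the right-hand side vanishes, so the coefficient keeps its value 0 at t = 0. *)
have [<- hd] := hG d; apply: derive0_const => s.
by have := hd s; rewrite gE.
Qed.

(** Once the orders below i are T-periodic, so is the derivative at order i, and the increment over
    a period has derivative zero. At order k the increment itself need not vanish. *)
Lemma first_integral_shift (k : nat) (c dc : nat -> int -> R -> R) (T : R) :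
  (forall x t, A x (t + T) = A x t) -> (forall x t, B x (t + T) = B x t) ->
  first_integral k c dc ->
  (forall d t, c 0%N d t = c 0%N d 0) ->
  (forall i d, (0 < i < k)%N -> c i d T = c i d 0) ->
  forall i d t, (i <= k)%N -> c i d (t + T) - c i d t = c i d T - c i d 0 /\
    dc i d (t + T) = dc i d t.
Proof.
move=> hA hB hI c0 cT i; elim/ltn_ind: i => i IH d t ik.
have hdc s : dc i d (s + T) = dc i d s.
  have [_ ->] := hI i d ik s; have [_ ->] := hI i d ik (s + T).
  rewrite /first_integral_rhs; congr (- _); apply: eq_big_nat => j /andP[j0 ji].
  apply: eq_bigr => x _.
  have lt1 : (i - j < i)%N by rewrite ltn_subrL j0 (leq_trans j0).
  have [|h1 h2] := IH (i - j)%N lt1 (d - e x) s; first by rewrite ltnW// (leq_trans lt1).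
  rewrite hA hB h2; congr (_ * (_ + _ * (_ * _))).
  (* Order 0 is constant in time and is not covered by [cT]. *)
  have [ij0|ij0] := posnP (i - j)%N; first by rewrite ij0 !(c0 (d - e x)) .
  apply/eqP; rewrite -subr_eq0 h1 cT ?subrr// ij0.
  exact: leq_trans ik.
split => //.
have D (s : R) : derives s (fun s => c i d (s + T) - c i d s) 0.
  have [h1 _] := hI i d ik s; have [h2 _] := hI i d ik (s + T).
  have h3 := derives_comp (g := fun s => s + T) h2 (derivesD (derives_id s) (derives_cst s T)).
  by apply: derives_val (derivesB h3 h1) _; rewrite addr0 mulr1 hdc subrr.
by rewrite (derive0_const D t 0) add0r.
Qed.

(* The image of a first integral under (r, t) |-> (- r, delta t + c0). *)
Lemma first_integral_reflect (k : nat) (c dc : nat -> int -> R -> R) (delta c0 : R) :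
  delta * delta = 1 ->
  (forall x t, A x (delta * t + c0) = delta * (-1) ^ e x * A x t) ->
  (forall x t, B x (delta * t + c0) = (-1) ^ e x * B x t) ->
  first_integral k c dc ->
  first_integral k (fun i d t => - (-1) ^ d * c i d (delta * t + c0))
    (fun i d t => - (-1) ^ d * delta * dc i d (delta * t + c0)).
Proof.
move=> d2 hA hB hI i d ik t; have [h1 h2] := hI i d ik (delta * t + c0); split.
  apply: derives_val (derivesZ _ (derives_comp (g := fun t => delta * t + c0) h1
    (derivesD (derivesZ delta (derives_id t)) (derives_cst t c0)))) _.
  by ring.
rewrite h2 /first_integral_rhs mulrN; congr (- _).
rewrite big_distrr /=; apply: eq_bigr => j _; rewrite big_distrr /=; apply: eq_bigr => x _.
rewrite hA hB.
have ed : (-1) ^ d = (-1) ^ (d - e x) * (-1) ^ e x :> R.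
  by rewrite -expfzDr ?subrK// oppr_eq0 oner_eq0.
have ee : (-1) ^ e x * (-1) ^ e x = 1 :> R.
  by rewrite -expfzMl mulrNN mulr1 exp1rz.
rewrite ed; set u := (-1) ^ (d - e x); set v := (-1) ^ e x in ee *.
(* The signs are grouped into the squares v v and delta delta, both equal to 1. *)
transitivity (mu j x * (- u * delta * (v * v) * B x t * dc (i - j)%N (d - e x) (delta * t + c0)
  - u * (delta * delta) * (v * v) * A x t * ((d - e x)%:~R * c (i - j)%N (d - e x) (delta * t
    + c0)))).
  by ring.
by rewrite ee d2; ring.
Qed.

End first_integrals.

(** * Functions bounded and Lipschitz in the radius *)

Section tame_functions.
Variables (R : realType) (D : set R) (r0 : R).
Implicit Types f g : R -> R -> R.

(** As with [lipschitz_box], bound and Lipschitz constant go together for the sake of products.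
    Radius 1 suffices because a small perturbation moves ln r by at most 1 over the times
    considered. *)
Definition tame f := exists2 M, 0 < M & forall t r r', D t ->
  `|r - r0| <= 1 -> `|r' - r0| <= 1 ->
  `|f t r| <= M /\ `|f t r - f t r'| <= M * `|r - r'|.

Lemma tame_time (g : R -> R) M : (forall t, D t -> `|g t| <= M) -> tame (fun t _ => g t).
Proof.
move=> h; exists (`|M| + 1); first by rewrite ltr_wpDl.
move=> t r r' Dt _ _; rewrite subrr normr0; split.
  by apply: le_trans (h t Dt) _; have := ler_norm M; lra.
by rewrite mulr_ge0// addr_ge0.
Qed.

Lemma tame_cst (a : R) : tame (fun _ _ => a).
Proof. exact: (@tame_time (fun=> a) `|a|). Qed.

Lemma tame_ex d : tame (fun _ => ex d).
Proof.
pose N := expR (`|d%:~R| * (`|r0| + 1)) : R.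
have N0 : 0 < N by exact: expR_gt0.
have hN r : `|r - r0| <= 1 -> ex d r <= N.
  move=> hr; rewrite ler_expR; apply: le_trans (ler_norm _) _; rewrite normrM ler_wpM2l//.
  have -> : r = r0 + (r - r0) by ring.
  by apply: le_trans (ler_normD _ _) _; lra.
have dN0 : 0 <= `|d%:~R| * N by rewrite mulr_ge0// ltW.
exists (N + `|d%:~R| * N); first by rewrite ltr_pwDl.
move=> t r r' _ hr hr'; split.
  by rewrite (gtr0_norm (ex_gt0 _ _)); have := hN r hr; lra.
wlog rr' : r r' hr hr' / r <= r'.
  move=> H; case/orP: (le_total r r') => h; first exact: H.
  by rewrite distrC [X in _ <= _ * X]distrC; exact: H.
rewrite distrC [X in _ <= _ * X]distrC [X in _ <= _ * X]ger0_norm ?subr_ge0//.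
apply: le_trans (derive_bound rr' (fun s _ => derives_ex d s) (C := `|d%:~R| * N) _) _.
  move=> s /andP[rs sr']; rewrite normrM (gtr0_norm (ex_gt0 _ _)) ler_wpM2l// hN//.
  by move: hr hr'; rewrite !ler_norml; lra.
by rewrite ler_wpM2r ?subr_ge0// lerDr ltW.
Qed.

Lemma tameD f g : tame f -> tame g -> tame (fun t r => f t r + g t r).
Proof.
move=> [L L0 hL] [K K0 hK]; exists (L + K); first by rewrite addr_gt0.
move=> t r r' Dt hr hr'; have [f1 f2] := hL t r r' Dt hr hr'; have [g1 g2] :=
  hK t r r' Dt hr hr'.
split; first by apply: le_trans (ler_normD _ _) _; lra.
rewrite opprD addrACA mulrDl; apply: le_trans (ler_normD _ _) _; lra.
Qed.

Lemma tameM f g : tame f -> tame g -> tame (fun t r => f t r * g t r).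
Proof.
move=> [L L0 hL] [K K0 hK]; have LK : 0 < L * K by rewrite mulr_gt0.
exists (2 * (L * K)); first by rewrite mulr_gt0.
move=> t r r' Dt hr hr'; have [f1 f2] := hL t r r' Dt hr hr'; have [g1 g2] :=
  hK t r r' Dt hr hr'.
have [g1' _] := hK t r' r Dt hr' hr.
split.
  rewrite normrM; apply: (@le_trans _ _ (L * K)); first exact: ler_pM.
  lra.
have -> : f t r * g t r - f t r' * g t r' =
  f t r * (g t r - g t r') + (f t r - f t r') * g t r' by ring.
apply: le_trans (ler_normD _ _) _; rewrite !normrM.
have h1 : `|f t r| * `|g t r - g t r'| <= L * (K * `|r - r'|) by exact: ler_pM.
have h2 : `|f t r - f t r'| * `|g t r'| <= (L * `|r - r'|) * K by exact: ler_pM.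
apply: le_trans (lerD h1 h2) _.
rewrite le_eqVlt; apply/orP; left; apply/eqP; ring.
Qed.

Lemma tame_sum (I : Type) (s : seq I) (P : pred I) (F : I -> R -> R -> R) :
  (forall i, P i -> tame (F i)) -> tame (fun t r => \sum_(i <- s | P i) F i t r).
Proof.
move=> h; elim: s => [|i s IH].
  have -> : (fun t r => \sum_(i <- [::] | P i) F i t r) = (fun _ _ => 0).
    by apply/funext => t; apply/funext => r; rewrite big_nil.
  exact: tame_cst.
have -> : (fun t r => \sum_(i <- i :: s | P i) F i t r) =
    (fun t r => (if P i then F i t r else 0) + \sum_(i <- s | P i) F i t r).
  by apply/funext => t; apply/funext => r; rewrite big_cons; case: (P i); rewrite ?add0r.
by apply: tameD => //; case Pi : (P i); [exact: h|exact: tame_cst].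
Qed.

Lemma tame_power_sum (V : nat -> R -> R -> R) (l n : nat) :
  (forall j, (l <= j < n)%N -> tame (V j)) ->
  exists2 M, 0 < M & forall e t r r', `|e| <= 1 -> D t ->
    `|r - r0| <= 1 -> `|r' - r0| <= 1 ->
    `|\sum_(l <= j < n) e ^+ j * V j t r| <= M * `|e| ^+ l /\
    `|\sum_(l <= j < n) e ^+ j * V j t r - \sum_(l <= j < n) e ^+ j * V j t r'|
      <= M * `|e| ^+ l * `|r - r'|.
Proof.
move=> h; have /choice[M hM] : forall j, exists M, (l <= j < n)%N -> 0 < M /\ forall t r r',
  D t ->
    `|r - r0| <= 1 -> `|r' - r0| <= 1 ->
    `|V j t r| <= M /\ `|V j t r - V j t r'| <= M * `|r - r'|.
  move=> j; case ljn : (l <= j < n)%N; last by exists 1.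
  by have [M M0 hM] := h j ljn; exists M.
have S0 : 0 <= \sum_(l <= j < n) M j.
  by rewrite big_nat sumr_ge0// => j /hM[/ltW].
exists (\sum_(l <= j < n) M j + 1); first by rewrite ltr_wpDl.
move=> e t r r' e1 Dt hr hr'.
have el j : (l <= j)%N -> `|e ^+ j| <= `|e| ^+ l.
  by move=> lj; rewrite normrX ler_wiXn2l.
split.
  apply: le_trans (ler_norm_sum _ _ _) _; rewrite mulrDl mul1r.
  apply: (@le_trans _ _ ((\sum_(l <= j < n) M j) * `|e| ^+ l)); last by rewrite lerDl exprn_ge0.
  rewrite big_distrl /= big_nat [leRHS]big_nat; apply: ler_sum => j ljn.
  have [_ /(_ t r r' Dt hr hr')[h1 _]] := hM j ljn.
  by rewrite normrM mulrC; apply: ler_pM => //; apply: el; case/andP: ljn.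
rewrite -sumrB; apply: le_trans (ler_norm_sum _ _ _) _; rewrite mulrDl mul1r mulrDl.
apply: (@le_trans _ _ ((\sum_(l <= j < n) M j) * `|e| ^+ l * `|r - r'|)).
  rewrite -mulrA big_distrl /= big_nat [leRHS]big_nat; apply: ler_sum => j ljn.
  have [_ /(_ t r r' Dt hr hr')[_ h1]] := hM j ljn.
  rewrite -mulrBr normrM mulrCA; apply: ler_pM => //; apply: el; by case/andP: ljn.
by rewrite lerDl mulr_ge0 ?exprn_ge0.
Qed.

End tame_functions.

Section clamp.
Variables (R : realType) (r0 : R).

(** The projection onto [r0 - 1, r0 + 1], written so that continuity and the Lipschitz bound are
    immediate. Composed with it, the radial equation becomes globally Lipschitz, and Picard iterates
    need not be confined. *)
Definition clamp (r : R) : R := r0 + (`|r - (r0 - 1)| - `|r - (r0 + 1)|) / 2.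

Lemma clamp_id r : `|r - r0| <= 1 -> clamp r = r.
Proof.
rewrite ler_norml => /andP[h1 h2]; rewrite /clamp ger0_norm; last by lra.
by rewrite ler0_norm; lra.
Qed.

Lemma clamp_near r : `|clamp r - r0| <= 1.
Proof.
rewrite /clamp addrAC subrr add0r normrM [ `|2^-1|]ger0_norm//.
have := ler_dist_dist (r - (r0 - 1)) (r - (r0 + 1)).
have -> : r - (r0 - 1) - (r - (r0 + 1)) = 2 by ring.
rewrite [ `|2|]ger0_norm//; lra.
Qed.

Lemma clamp_lipschitz r r' : `|clamp r - clamp r'| <= `|r - r'|.
Proof.
have := ler_dist_dist (r - (r0 - 1)) (r' - (r0 - 1)).
have := ler_dist_dist (r - (r0 + 1)) (r' - (r0 + 1)).
have -> : r - (r0 - 1) - (r' - (r0 - 1)) = r - r' by ring.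
have -> : r - (r0 + 1) - (r' - (r0 + 1)) = r - r' by ring.
rewrite /clamp !ler_norml => /andP[? ?] /andP[? ?]; apply/andP; split; lra.
Qed.

Lemma continuous_clamp : continuous clamp.
Proof.
move=> r; apply: cvgD; first exact: cvg_cst.
apply: cvgM; last exact: cvg_cst.
by apply: cvgB; apply: cvg_norm; apply: cvgB; exact: cvg_id || exact: cvg_cst.
Qed.

End clamp.

(** * Approximate solutions of the radial equation *)

Section picard.
Variables (R : realType) (S r0 C e0 : R) (F : R -> R -> R -> R).
Hypotheses (S0 : 0 <= S) (C0 : 0 < C).
Hypothesis cF : forall e (u : R -> R), `|e| <= e0 -> continuous u ->
  continuous (fun t => F e t (u t)).
Hypothesis hF : forall e t r r', `|e| <= e0 ->
  `|F e t r| <= C * `|e| /\ `|F e t r - F e t r'| <= C * `|e| * `|r - r'|.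

(* Each Picard iteration gains one power of the small parameter. *)
Lemma picard_approximation (k : nat) : exists2 C', 0 < C' & forall e, `|e| <= e0 ->
  exists u du : R -> R, [/\ u 0 = r0, forall t : R, derives t u (du t), continuous du &
    forall t, 0 <= t <= S -> [/\ `|u t - r0| <= C * S * `|e|, `|du t| <= C * `|e| &
      `|du t - F e t (u t)| <= C' * `|e| ^+ k.+1]].
Proof.
elim: k => [|k [C' C'0 IH]].
  exists C => // e ee; exists (fun=> r0), (fun=> 0); split => //.
  - by move=> t; exact: derives_cst.
  - by move=> t; exact: cvg_cst.
  move=> t tS; rewrite subrr !normr0 sub0r normrN expr1; split.
  - by rewrite !mulr_ge0// ltW.
  - by rewrite mulr_ge0// ltW.
  - by have [] := hF t r0 r0 ee.
(* The summand 1 keeps the constant positive when S = 0. *)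
exists (C * C' * S + 1).
  by rewrite ltr_wpDl// !mulr_ge0// ltW.
move=> e ee; have [u [du [u0 hu cdu hS]]] := IH e ee.
have cu : continuous u by move=> t; exact: derives_continuous (hu t).
pose dv t := F e t (u t).
have cdv : continuous dv := cF ee cu.
have [v v0 hv] := antiderivative cdv.
have hdv t : `|dv t| <= C * `|e| by have [] := hF t (u t) (u t) ee.
exists (fun t => r0 + v t), dv; split => //.
- by rewrite v0 addr0.
- by move=> t; apply: derives_val (derivesD (derives_cst t r0) (hv t)) _; rewrite add0r.
move=> t /andP[t0 tS]; split => //.
  rewrite addrAC subrr add0r -[v t]subr0 -v0.
  apply: le_trans (derive_bound t0 (fun s _ => hv s) (fun s _ => hdv s)) _.
  by rewrite subr0 mulrAC ler_wpM2r// ler_wpM2l// ltW.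
have vu : `|r0 + v t - u t| <= C' * `|e| ^+ k.+1 * t.
  have := @derive_bound R (fun s => v s - u s) (fun s => dv s - du s) 0 t (C' * `|e| ^+ k.+1)
    t0.
  rewrite v0 u0 subr0 sub0r opprK.
  rewrite (_ : v t - u t + r0 = r0 + v t - u t); last by ring.
  apply.
    by move=> s _; exact: derivesB.
  move=> s /andP[s0 st]; have [|_ _] := hS s; first by rewrite s0 (le_trans st).
  by rewrite distrC.
have [_ h2] := hF t (u t) (r0 + v t) ee.
apply: le_trans h2 _; rewrite distrC.
apply: (@le_trans _ _ (C * `|e| * (C' * `|e| ^+ k.+1 * t))).
  by rewrite ler_wpM2l// mulr_ge0// ltW.
apply: (@le_trans _ _ (C * C' * `|e| ^+ k.+2 * S)).
  rewrite [X in _ * X * S]exprS (_ : _ * _ * (_ * _) = C * C' * (`|e| * `|e| ^+ k.+1) * t);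
    last by ring.
  by rewrite ler_wpM2l// !mulr_ge0 ?exprn_ge0// ltW.
by rewrite mulrDl mul1r mulrAC lerDl exprn_ge0.
Qed.

End picard.

(** * Finite windows of exponents and reindexing of sums *)

Section integer_boxes.
Variable R : realType.

Definition int_box (N : nat) : seq int := [seq i%:Z - N%:Z | i <- iota 0 (2 * N).+1].

Lemma int_box_uniq N : uniq (int_box N).
Proof. by rewrite map_inj_uniq ?iota_uniq// => i j /addIr[]. Qed.

Lemma mem_int_box N d : (d \in int_box N) = (`|d| <= N)%N.
Proof.
apply/mapP/idP => [[i]|dN]; first by rewrite mem_iota => iN ->; lia.
by exists (absz (d + N%:Z)%R); [rewrite mem_iota; lia|lia].
Qed.

Lemma sum_over_support (f : int -> R) (s s' : seq int) : uniq s -> uniq s' ->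
  (forall d, f d != 0 -> (d \in s) && (d \in s')) ->
  \sum_(d <- s) f d = \sum_(d <- s') f d.
Proof.
move=> us us' h.
have restr (r : seq int) : \sum_(d <- r) f d = \sum_(d <- [seq d <- r | f d != 0]) f d.
  rewrite big_filter [LHS](bigID (fun d => f d != 0)) /= [X in _ + X]big1 ?addr0//.
  by move=> d /negPn/eqP.
rewrite restr [RHS]restr; apply: perm_big; apply: uniq_perm; rewrite ?filter_uniq// => d.
rewrite !mem_filter; case: (boolP (f d != 0)) => //= /h /andP[-> ->] //.
Qed.

(** The larger window absorbs the shift of exponents caused by multiplication by r^e. *)
Lemma sum_int_box_shift (f : int -> R) (N N' : nat) (e : int) :
  (forall d, (N < `|d|)%N -> f d = 0) -> (N + `|e| <= N')%N ->
  \sum_(d <- int_box N') f (d - e) = \sum_(d <- int_box N) f d.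
Proof.
move=> h NN'; rewrite -(big_map (fun d => d - e) predT f).
apply: sum_over_support; rewrite ?int_box_uniq//.
  by rewrite map_inj_uniq ?int_box_uniq// => i j /addIr.
move=> d fd; have dN : (`|d| <= N)%N by rewrite leqNgt; apply/negP => /h h0;
  rewrite h0 eqxx in fd.
apply/andP; split; last by rewrite mem_int_box.
apply/mapP; exists (d + e); last by rewrite addrK.
by rewrite mem_int_box; lia.
Qed.

Lemma sum_int_box_widen (f : int -> R) (N N' : nat) :
  (forall d, (N < `|d|)%N -> f d = 0) -> (N <= N')%N ->
  \sum_(d <- int_box N') f d = \sum_(d <- int_box N) f d.
Proof.
move=> h NN'; rewrite -(@sum_int_box_shift f N N' 0) ?addn0//.
by apply: eq_bigr => d _; rewrite subr0.
Qed.

(** The change of index n = i + j of a Cauchy product, truncated at order k. *)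
Lemma sum_triangle (F : nat -> nat -> R) (k : nat) :
  \sum_(1 <= j < k.+1) \sum_(0 <= i < k.+1 | (i + j <= k)%N) F j i =
  \sum_(0 <= n < k.+1) \sum_(1 <= j < n.+1) F j (n - j)%N.
Proof.
have inner j : (1 <= j < k.+1)%N ->
    \sum_(0 <= i < k.+1 | (i + j <= k)%N) F j i =
    \sum_(0 <= n < k.+1 | (j <= n)%N) F j (n - j)%N.
  move=> /andP[j1 jk].
  rewrite -[RHS](@big_nat_widenl _ _ _ j 0 _ predT)//.
  rewrite -[X in _ = \sum_(X <= _ < _) _]add0n big_addn.
  rewrite [RHS](big_nat_widen _ _ k.+1) ?leq_subr//.
  rewrite big_nat_cond [RHS]big_nat_cond; apply: eq_big => [i|i _]; last by rewrite addnK.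
  by lia.
rewrite (eq_big_nat _ _ inner) (exchange_big_dep xpredT)//=.
apply: eq_big_nat => n /andP[_ nk].
by rewrite [RHS](big_nat_widen _ _ k.+1).
Qed.

End integer_boxes.

(** * Near conservation of the truncated first integral *)

Section conservation.
Variables (R : realType) (I : finType) (e : I -> int) (A B : I -> R -> R) (mu : nat -> I -> R).
Variable k : nat.

(** Taking V = [A] gives the radial coefficient alpha, V = [B] the angular coefficient beta. *)
Definition alpha_coef (V : I -> R -> R) (j : nat) (t r : R) : R :=
  \sum_x mu j x * V x t * ex (e x) r.

Definition alpha (V : I -> R -> R) (eps t r : R) : R :=
  \sum_(1 <= j < k.+1) eps ^+ j * alpha_coef V j t r.

Variables (c dc : nat -> int -> R -> R) (N : nat).
Hypothesis hI : first_integral e A B mu k c dc.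
Hypothesis hN : forall i d t, (i <= k)%N -> (N < `|d|)%N -> c i d t = 0 /\ dc i d t = 0.

(** [K], [G] and [H] are the coefficients of eps^i in J, in its time derivative and in its
    derivative in the logarithmic radius. *)
Let K i t r := \sum_(d <- int_box N) c i d t * ex d r.
Let G i t r := \sum_(d <- int_box N) dc i d t * ex d r.
Let H i t r := \sum_(d <- int_box N) d%:~R * c i d t * ex d r.

Definition formal_value (eps t r : R) : R := \sum_(0 <= i < k.+1) eps ^+ i * K i t r.
Definition formal_dt (eps t r : R) : R := \sum_(0 <= i < k.+1) eps ^+ i * G i t r.
Definition formal_dr (eps t r : R) : R := \sum_(0 <= i < k.+1) eps ^+ i * H i t r.

Lemma first_integral_order i t r : (i <= k)%N ->
  G i t r = - \sum_(1 <= j < i.+1)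
    (alpha_coef B j t r * G (i - j)%N t r + alpha_coef A j t r * H (i - j)%N t r).
Proof.
(* The largest shift of exponents; the window N + E leaves room for all of them. *)
move=> ik; pose E := \max_x `|e x|%N.
have eE x : (`|e x| <= E)%N by exact: (leq_bigmax x).
have -> : G i t r = \sum_(d <- int_box (N + E)) dc i d t * ex d r.
  symmetry; apply: sum_int_box_widen; last exact: leq_addr.
  by move=> d dN; have [_ ->] := hN t ik dN; rewrite mul0r.
transitivity (- \sum_(d <- int_box (N + E)) \sum_(1 <= j < i.+1) \sum_x mu j x *
      (B x t * dc (i - j)%N (d - e x) t +
        A x t * ((d - e x)%:~R * c (i - j)%N (d - e x) t)) * ex d r).
  rewrite -sumrN; apply: eq_bigr => d _; have [_ ->] := hI d ik t.
  rewrite /first_integral_rhs mulNr; congr (- _); rewrite big_distrl /=; apply: eq_bigr => j _.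
  by rewrite big_distrl.
congr (- _); rewrite exchange_big /=; apply: eq_big_nat => j /andP[j1 ji].
rewrite exchange_big /= /alpha_coef !big_distrl -big_split /=; apply: eq_bigr => x _.
pose f d := mu j x * ex (e x) r * (B x t * (dc (i - j)%N d t * ex d r)
   + A x t * (d%:~R * c (i - j)%N d t * ex d r)).
transitivity (\sum_(d <- int_box (N + E)) f (d - e x)).
  apply: eq_bigr => d _; rewrite /f.
  have -> : ex d r = ex (e x) r * ex (d - e x) r by rewrite -exD addrC subrK.
  ring.
rewrite (@sum_int_box_shift R f N (N + E)%N) ?leq_add2l//; last first.
  move=> d dN; rewrite /f; have [|-> ->] := @hN (i - j)%N d t _ dN; first by lia.
  by rewrite !(mul0r, mulr0) addr0 mulr0.
rewrite /f /G /H -big_distrr big_split -!big_distrr /=; ring.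
Qed.

(** All orders up to k cancel by the recurrence; only the products of truncated sums with i + j > k
    are left. *)
Lemma formal_remainder eps t r :
  (1 + alpha B eps t r) * formal_dt eps t r + alpha A eps t r * formal_dr eps t r =
  \sum_(1 <= j < k.+1) \sum_(0 <= i < k.+1 | (k < i + j)%N) eps ^+ (i + j) *
    (alpha_coef B j t r * G i t r + alpha_coef A j t r * H i t r).
Proof.
pose F j i := eps ^+ (i + j) * (alpha_coef B j t r * G i t r + alpha_coef A j t r * H i t r).
have -> : (1 + alpha B eps t r) * formal_dt eps t r + alpha A eps t r * formal_dr eps t r =
    formal_dt eps t r + \sum_(1 <= j < k.+1) \sum_(0 <= i < k.+1) F j i.
  rewrite mulrDl mul1r -addrA; congr (_ + _).
  rewrite /alpha /formal_dt /formal_dr !big_distrl -big_split /=; apply: eq_bigr => j _.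
  rewrite [X in X + _]big_distrr [X in _ + X]big_distrr -big_split /=; apply: eq_bigr => i _.
  by rewrite /F exprD; ring.
have -> : formal_dt eps t r = - \sum_(0 <= n < k.+1) \sum_(1 <= j < n.+1) F j (n - j)%N.
  rewrite -sumrN; apply: eq_big_nat => n /andP[_ nk].
  rewrite first_integral_order// mulrN big_distrr /=; congr (- _).
  by apply: eq_big_nat => j /andP[j1 jn]; rewrite /F subnK.
rewrite -sum_triangle.
have -> : \sum_(1 <= j < k.+1) \sum_(0 <= i < k.+1) F j i =
    \sum_(1 <= j < k.+1) \sum_(0 <= i < k.+1 | (i + j <= k)%N) F j i +
    \sum_(1 <= j < k.+1) \sum_(0 <= i < k.+1 | (k < i + j)%N) F j i.
  rewrite -big_split /=; apply: eq_bigr => j _; rewrite (bigID (fun i => (i + j <= k)%N)) /=.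
  by congr (_ + _); apply: eq_bigl => i; rewrite -ltnNge.
by rewrite addrA addNr add0r.
Qed.

Variables (S r0 : R).
Hypothesis S0 : 0 <= S.
Hypothesis bA : forall x, exists2 C, 0 < C & forall t, `|A x t| <= C.
Hypothesis bB : forall x, exists2 C, 0 < C & forall t, `|B x t| <= C.
Hypothesis cdc : forall i d, (i <= k)%N -> continuous (dc i d).

Lemma tame_alpha_coef D (V : I -> R -> R) j :
  (forall x, exists2 C, 0 < C & forall t, `|V x t| <= C) -> tame D r0 (alpha_coef V j).
Proof.
move=> hV; apply: tame_sum => x _; apply: tameM; last exact: tame_ex.
have [C _ hC] := hV x.
apply: tameM; first exact: tame_cst.
by apply: (@tame_time _ _ _ (V x) C) => t _; exact: hC.
Qed.

Let D := [set t : R | 0 <= t <= S].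

Let tame_c i d : (i <= k)%N -> tame D r0 (fun t _ => c i d t).
Proof.
move=> ik; have [C _ hC] : exists2 C, 0 < C & forall t, 0 <= t <= S -> `|c i d t| <= C.
  apply: continuous_itv_bounded => t _; have [h _] := hI d ik t; exact: derives_continuous h.
exact: tame_time hC.
Qed.

Let tame_dc i d : (i <= k)%N -> tame D r0 (fun t _ => dc i d t).
Proof.
move=> ik; have [C _ hC] : exists2 C, 0 < C & forall t, 0 <= t <= S -> `|dc i d t| <= C.
  by apply: continuous_itv_bounded => t _; exact: cdc.
exact: tame_time hC.
Qed.

Let tame_G i : (i <= k)%N -> tame D r0 (G i).
Proof. by move=> ik; apply: tame_sum => d _; apply: tameM; [exact: tame_dc|exact: tame_ex]. Qed.

Let tame_H i : (i <= k)%N -> tame D r0 (H i).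
Proof.
move=> ik; apply: tame_sum => d _; apply: tameM; last exact: tame_ex.
by apply: tameM; [exact: tame_cst|exact: tame_c].
Qed.

Lemma tame_formal_value i : (i <= k)%N -> tame D r0 (K i).
Proof. by move=> ik; apply: tame_sum => d _; apply: tameM; [exact: tame_c|exact: tame_ex]. Qed.

Lemma formal_remainder_bound : exists2 M, 0 < M & forall eps t r, `|eps| <= 1 ->
  0 <= t <= S -> `|r - r0| <= 1 ->
  `|(1 + alpha B eps t r) * formal_dt eps t r + alpha A eps t r * formal_dr eps t r| <=
    M * `|eps| ^+ k.+1.
Proof.
have /choice[M hM] : forall ji : nat * nat, exists M, (ji.2 <= k)%N -> 0 < M /\ forall t r,
  0 <= t <= S ->
    `|r - r0| <= 1 ->
    `|alpha_coef B ji.1 t r * G ji.2 t r + alpha_coef A ji.1 t r * H ji.2 t r| <= M.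
  move=> [j i] /=; case: (leqP i k) => ik; last by exists 1.
  have [M M0 hM] : tame D r0 (fun t r => alpha_coef B j t r * G i t r +
    alpha_coef A j t r * H i t r).
    apply: tameD; apply: tameM; first exact: tame_alpha_coef.
    - exact: tame_G.
    - exact: tame_alpha_coef.
    - exact: tame_H.
  by exists M; split => // t r tS hr; have [] := hM t r r tS hr hr.
have M0 j i : (i <= k)%N -> 0 < M (j, i) by move=> ik; have [] := hM (j, i) ik.
have S1 : 0 <= \sum_(1 <= j < k.+1) \sum_(0 <= i < k.+1 | (k < i + j)%N) M (j, i).
  apply: sumr_ge0 => j _; rewrite big_nat_cond; apply: sumr_ge0 => i /andP[/andP[_ ik] _].
  by rewrite ltW// M0.
exists (\sum_(1 <= j < k.+1) \sum_(0 <= i < k.+1 | (k < i + j)%N) M (j, i) + 1).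
  by rewrite ltr_wpDl.
move=> eps t r e1 tS hr; rewrite formal_remainder.
apply: (@le_trans _ _ ((\sum_(1 <= j < k.+1) \sum_(0 <= i < k.+1 | (k < i + j)%N) M (j,
  i)) * `|eps| ^+ k.+1)); last first.
  by rewrite mulrDl mul1r lerDl exprn_ge0.
apply: le_trans (ler_norm_sum _ _ _) _; rewrite big_distrl /=; apply: ler_sum => j _.
apply: le_trans (ler_norm_sum _ _ _) _; rewrite big_distrl /=.
rewrite big_nat_cond [leRHS]big_nat_cond; apply: ler_sum => i /andP[/andP[_ ik] kij].
have [_ h] := hM (j, i) ik.
rewrite normrM mulrC; apply: ler_pM => //; first exact: h.
by rewrite normrX ler_wiXn2l.
Qed.

(** Along [u] the derivative of J is the formal remainder divided by 1 + beta, plus the radial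
    derivative of J times the defect of [u] in its equation. Both are of order eps^(k+1). *)
Lemma formal_conservation (C0 : R) : 0 < C0 -> exists C e1, [/\ 0 < C, 0 < e1 &
  forall eps (u du : R -> R) (t1 : R), `|eps| <= e1 -> 0 <= t1 <= S ->
  (forall t, 0 <= t <= S -> [/\ derives t u (du t), `|u t - r0| <= 1 &
    `|du t - alpha A eps t (u t) / (1 + alpha B eps t (u t))| <= C0 * `|eps| ^+ k.+1]) ->
  `|formal_value eps t1 (u t1) - formal_value eps 0 (u 0)| <= C * `|eps| ^+ k.+1].
Proof.
move=> C00.
have [M1 M10 h1] := formal_remainder_bound.
have [M2 M20 h2] := tame_power_sum (l := 0) (n := k.+1) (V := H) (D := D) (r0 :=
  r0) (fun j hj => tame_H (proj2 (andP hj))).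
have [M3 M30 h3] := tame_power_sum (l := 1) (n := k.+1) (D := D) (r0 :=
  r0) (fun j _ => tame_alpha_coef D j bB).
(* The bound (2 M3)^-1 forces |beta| <= 1/2, whence 1/(1 + beta) <= 2. *)
exists ((2 * M1 + M2 * C0) * (S + 1)), (Num.min 1 (2 * M3)^-1).
have MM : 0 < 2 * M1 + M2 * C0 by rewrite addr_gt0 ?mulr_gt0.
split; first by rewrite mulr_gt0// ltr_wpDl.
  by rewrite lt_min ltr01 invr_gt0 mulr_gt0.
move=> eps u du t1; rewrite le_min => /andP[e1 e3] /andP[t10 t1S] hu.
have beta_half t : 0 <= t <= S -> `|alpha B eps t (u t)| <= 2^-1.
  move=> tS; have [_ hr _] := hu t tS.
  have [h _] := h3 eps t (u t) (u t) e1 tS hr hr; apply: le_trans h _.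
  by rewrite expr1; move: e3; rewrite invfM ler_pdivlMr ?[_ * M3]mulrC//; lra.
have dK t : 0 <= t <= S -> derives t (fun t => formal_value eps t (u t))
    (formal_dt eps t (u t) + formal_dr eps t (u t) * du t).
  move=> tS; have [du1 _ _] := hu t tS.
  have dKi i : (i <= k)%N -> derives t (fun t => K i t (u t)) (G i t (u t) +
    H i t (u t) * du t).
    move=> ik; apply: derives_val (derives_sum (int_box N) predT
      (F := fun d t => c i d t * ex d (u t))
      (dF := fun d => dc i d t * ex d (u t) + c i d t * (d%:~R * ex d (u t) * du t)) _) _.
      move=> d; apply: derivesM; first by have [] := hI d ik t.
      exact: derives_comp (derives_ex d (u t)) du1.
    rewrite big_split /=; congr (_ + _); rewrite /H big_distrl /=; apply: eq_bigr => d _; ring.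
  rewrite /formal_value.
  have -> : (fun t => \sum_(0 <= i < k.+1) eps ^+ i * K i t (u t)) =
      (fun t => \sum_(i < k.+1) eps ^+ i * K i t (u t)).
    by apply/funext => s; rewrite big_mkord.
  apply: derives_val (derives_sum (index_enum 'I_k.+1) predT
      (F := fun i t => eps ^+ i * K i t (u t))
      (dF := fun i : 'I_k.+1 => eps ^+ i * (G i t (u t) + H i t (u t) * du t)) _) _.
    by move=> i; apply: derivesZ; apply: dKi; rewrite -ltnS.
  rewrite /formal_dt /formal_dr !big_mkord big_distrl -big_split /=; apply: eq_bigr => i _;
    ring.
have bK t : 0 <= t <= S -> `|formal_dt eps t (u t) + formal_dr eps t (u t) * du t| <=
    (2 * M1 + M2 * C0) * `|eps| ^+ k.+1.
  move=> tS; have [_ hr hd] := hu t tS; have b2 := beta_half t tS.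
  have b0 : 2^-1 <= 1 + alpha B eps t (u t) by move: b2; rewrite ler_norml; lra.
  have bn : 1 + alpha B eps t (u t) != 0 by rewrite gt_eqF//; lra.
  have -> : formal_dt eps t (u t) + formal_dr eps t (u t) * du t =
     ((1 + alpha B eps t (u t)) * formal_dt eps t (u t) +
       alpha A eps t (u t) * formal_dr eps t (u t))
       / (1 + alpha B eps t (u t)) + formal_dr eps t (u t) *
       (du t - alpha A eps t (u t) / (1 + alpha B eps t (u t))) by field.
  apply: le_trans (ler_normD _ _) _; rewrite [leRHS]mulrDl; apply: lerD.
    rewrite normrM [X in X <= _]mulrC -mulrA; apply: ler_pM => //; last exact: h1.
    rewrite normfV (ger0_norm (le_trans _ b0))// -[leRHS]invrK lef_pV2 ?posrE//; lra.
  rewrite normrM -mulrA; apply: ler_pM => //.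
  by have [h _] := h2 eps t (u t) (u t) e1 tS hr hr; rewrite expr0 mulr1 in h.
have sub t : 0 <= t <= t1 -> 0 <= t <= S by move=> /andP[-> h]; rewrite (le_trans h).
apply: le_trans (derive_bound t10 (fun t tt => dK t (sub t tt)) (fun t tt => bK t (sub t
  tt))) _.
rewrite subr0 mulrAC ler_wpM2r ?exprn_ge0// ler_wpM2l ?(ltW MM)//; lra.
Qed.

End conservation.

(** * Generalized polar coordinates *)

Section truncation.
Variables (R : realType) (n k : nat).

Definition truncated (P : {poly {poly R}}) (p : nat -> {poly {poly R}}) (eps x y : R) : R :=
  P.[x, y] + \sum_(1 <= j < k.+1) eps ^+ j * (p j).[x, y].

Lemma hornerXY_degree (p : {poly {poly R}}) x y : total_degree_le n p ->
  p.[x, y] = \sum_(i : 'I_n.+1 * 'I_n.+1) p`_(i.1)`_(i.2) * (x ^+ i.1 * y ^+ i.2).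
Proof.
move=> h; rewrite (@hornerXY_sum R p n.+1); first by rewrite pair_bigA.
by move=> a b ab; apply: h; lia.
Qed.

(** The common degree bound leaves finitely many coefficients, each a convergent power series in
    eps; their tail estimates combine uniformly on the box. *)
Lemma truncation_error (P : {poly {poly R}}) (p : nat -> {poly {poly R}}) (B : R) :
  analytic_perturbation p -> (forall i, (1 <= i)%N -> total_degree_le n (p i)) ->
  exists C e1, [/\ 0 < C, 0 < e1 & forall eps x y, `|eps| <= e1 -> `|x| <= B -> `|y| <= B ->
    `|P.[x, y] + limn (fun N => \sum_(1 <= i < N) eps ^+ i * (p i).[x,
      y]) - truncated P p eps x y|
      <= C * `|eps| ^+ k.+1].
Proof.
move=> [r r0 hr] hd.
pose cf (i : 'I_n.+1 * 'I_n.+1) j := (p j)`_(i.1)`_(i.2).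
(* Convergence is granted only for |eps| < r, so the tail lemma is used at radius r/2, valid for
   |eps| <= r/4. *)
have r20 : 0 < r / 2 by rewrite divr_gt0.
have /choice[C hC] : forall i, exists C, 0 < C /\ forall e l : R, `|e| <= r / 2 / 2 ->
    (fun N => \sum_(1 <= j < N) e ^+ j * cf i j) @ \oo --> l ->
    `|l - \sum_(1 <= j < k.+1) e ^+ j * cf i j| <= C * `|e| ^+ k.+1.
  move=> i; have [|C C0 hC] := @power_series_limit R (cf i) (r / 2) k r20.
    by apply: hr; rewrite ger0_norm ?ltW//; lra.
  by exists C.
pose M := (1 + `|B|) ^+ n * (1 + `|B|) ^+ n.
have B1 : 1 <= 1 + `|B| by rewrite lerDl.
have M0 : 0 < M by rewrite mulr_gt0// exprn_gt0// (lt_le_trans ltr01).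
have C0 : 0 <= \sum_i C i by apply: sumr_ge0 => i _; have [/ltW] := hC i.
exists ((\sum_i C i + 1) * M), (r / 4); split.
- by rewrite mulr_gt0// ltr_wpDl.
- by rewrite divr_gt0.
move=> eps x y he hx hy.
have he2 : `|eps| <= r / 2 / 2 by lra.
have her : `|eps| < r by lra.
pose l i := limn (fun N => \sum_(1 <= j < N) eps ^+ j * cf i j).
have hl i : (fun N => \sum_(1 <= j < N) eps ^+ j * cf i j) @ \oo --> l i by exact: hr.
have sumE N : \sum_(1 <= j < N) eps ^+ j * (p j).[x, y] =
    \sum_i (\sum_(1 <= j < N) eps ^+ j * cf i j) * (x ^+ i.1 * y ^+ i.2).
  under [RHS]eq_bigr do rewrite big_distrl /=.
  rewrite exchange_big /=; apply: eq_big_nat => j /andP[j1 _].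
  rewrite (hornerXY_degree _ _ (hd j j1)) big_distrr /=; apply: eq_bigr => i _.
  by rewrite /cf; ring.
have -> : limn (fun N => \sum_(1 <= i < N) eps ^+ i * (p i).[x, y]) =
    \sum_i l i * (x ^+ i.1 * y ^+ i.2).
  apply: cvg_lim => //; under [fun N => _]funext do rewrite sumE.
  apply: cvg_big => [|i _]; first exact: add_continuous.
  by apply: cvgM; [exact: hl|exact: cvg_cst].
rewrite /truncated opprD addrACA subrr add0r sumE -sumrB.
apply: le_trans (ler_norm_sum _ _ _) _.
rewrite mulrAC mulrDl mul1r mulrDl.
apply: (@le_trans _ _ ((\sum_i C i) * `|eps| ^+ k.+1 * M)); last first.
  by rewrite lerDl mulr_ge0 ?exprn_ge0// ltW.
rewrite -mulrA big_distrl /=; apply: ler_sum => i _.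
rewrite -mulrBl normrM mulrA; have [_ h] := hC i.
have pw z (j : 'I_n.+1) : `|z| <= B -> `|z ^+ j| <= (1 + `|B|) ^+ n.
  move=> zB; rewrite normrX; apply: (@le_trans _ _ ((1 + `|B|) ^+ j)).
    apply: lerXn2r; rewrite ?nnegrE ?(le_trans ler01 B1)//.
    by apply: le_trans zB _; have := ler_norm B; lra.
  by rewrite ler_weXn2l// -ltnS.
apply: ler_pM => //; first exact: h.
by rewrite normrM; apply: ler_pM => //; exact: pw.
Qed.

Lemma truncated_lipschitz (P : {poly {poly R}}) (p : nat -> {poly {poly R}}) (B : R) :
  exists2 L, 0 < L & forall eps x y x' y', `|eps| <= 1 ->
    `|x| <= B -> `|y| <= B -> `|x'| <= B -> `|y'| <= B ->
    `|truncated P p eps x y - truncated P p eps x' y'| <= L * (`|x - x'| + `|y - y'|).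
Proof.
have [L0 L00 h0] := lipschitz_box_poly B P.
have /choice[L hL] : forall j, exists L, 0 < L /\ forall x y x' y', `|x| <= B -> `|y| <= B ->
  `|x'| <= B -> `|y'| <= B ->
  `|(p j).[x, y]| <= L /\ `|(p j).[x, y] - (p j).[x', y']| <= L * (`|x - x'| + `|y - y'|).
  by move=> j; have [L L1 hL] := lipschitz_box_poly B (p j); exists L.
have S0 : 0 <= \sum_(1 <= j < k.+1) L j by apply: sumr_ge0 => j _; have [/ltW] := hL j.
exists (L0 + \sum_(1 <= j < k.+1) L j); first by rewrite ltr_wpDr.
move=> eps x y x' y' e1 hx hy hx' hy'.
rewrite /truncated opprD addrACA mulrDl -sumrB.
apply: le_trans (ler_normD _ _) _; apply: lerD; first by have [_] := h0 x y x' y' hx hy hx' hy'.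
apply: le_trans (ler_norm_sum _ _ _) _; rewrite big_distrl /=; apply: ler_sum => j _.
have [_ /(_ x y x' y' hx hy hx' hy')[_ h]] := hL j.
rewrite -mulrBr normrM -[leRHS]mul1r; apply: ler_pM => //.
by rewrite normrX exprn_ile1.
Qed.

End truncation.

(** * The perturbed field in coordinates adapted to the reference orbit *)

Section polar_coordinates.
Variables (R : realType) (s1 s2 m n k : nat) (P Q : {poly {poly R}}) (p q : nat ->
  {poly {poly R}}).
Variables (a b : R -> R).
Hypotheses (s1_gt0 : (0 < s1)%N) (s2_gt0 : (0 < s2)%N).
Hypothesis hqh : quasi_homogeneous s1 s2 m P Q.
Hypothesis hpn : forall i, (1 <= i)%N -> total_degree_le n (p i).
Hypothesis hqn : forall i, (1 <= i)%N -> total_degree_le n (q i).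

Let nu : int := m%:Z - 1.
Let da t := P.[a t, b t].
Let db t := Q.[a t, b t].

Definition wedge t := s1%:R * a t * Q.[a t, b t] - s2%:R * b t * P.[a t, b t].

(* (true, i, j) stands for the monomial x^i y^j in the first component of the
   perturbation and (false, i, j) for the same monomial in the second one. *)
Definition monomial : finType := (bool * ('I_n.+1 * 'I_n.+1))%type.

(** A monomial has weight i s1 + j s2. Subtracted from it are the weight of its component and m - 1,
    the degree of the common factor r^(m - 1). *)
Definition mexp (x : monomial) : int :=
  x.2.1%:Z * s1%:Z + x.2.2%:Z * s2%:Z - (if x.1 then s1 else s2)%:Z - nu.
Definition mcoef (j : nat) (x : monomial) : R :=
  if x.1 then (p j)`_(x.2.1)`_(x.2.2) else (q j)`_(x.2.1)`_(x.2.2).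
(** Cramer's rule: [mradial] and [mangular] are the coordinates of the monomial vector in the basis
    formed by the Euler vector (s1 a, s2 b) and the velocity (a', b'), whose determinant is
    [wedge]. *)
Definition mradial (x : monomial) (t : R) : R :=
  a t ^+ x.2.1 * b t ^+ x.2.2 * (if x.1 then Q.[a t, b t] else - P.[a t, b t]) / wedge t.
Definition mangular (x : monomial) (t : R) : R :=
  a t ^+ x.2.1 * b t ^+ x.2.2 * (if x.1 then - (s2%:R * b t) else s1%:R * a t) / wedge t.

Lemma monomial_ex (x : monomial) t r :
  ex (mexp x) r * (a t ^+ x.2.1 * b t ^+ x.2.2) =
  ex (- ((if x.1 then s1 else s2)%:Z + nu)) r *
    ((ex s1 r * a t) ^+ x.2.1 * (ex s2 r * b t) ^+ x.2.2).
Proof.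
rewrite !exprMn /mexp -addrA -opprD exD exD.
have e (i s : nat) : ex (i%:Z * s%:Z) r = ex s r ^+ i.
  by rewrite -PoszM !exn mulnC exprM.
by rewrite !e; ring.
Qed.

Lemma polar_order (j : nat) t r : (1 <= j)%N -> wedge t != 0 ->
  alpha_coef mexp mcoef mangular j t r * da t +
    alpha_coef mexp mcoef mradial j t r * (s1%:R * a t) =
    ex (- (s1%:Z + nu)) r * (p j).[ex s1 r * a t, ex s2 r * b t] /\
  alpha_coef mexp mcoef mangular j t r * db t +
    alpha_coef mexp mcoef mradial j t r * (s2%:R * b t) =
    ex (- (s2%:Z + nu)) r * (q j).[ex s1 r * a t, ex s2 r * b t].
Proof.
move=> j1 w0.
rewrite (hornerXY_degree _ _ (hpn j1)) (hornerXY_degree _ _ (hqn j1)).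
have split_sum (F : monomial -> R) : \sum_x F x =
    \sum_(i : 'I_n.+1 * 'I_n.+1) F (true, i) + \sum_(i : 'I_n.+1 * 'I_n.+1) F (false, i).
  transitivity (\sum_(c : bool) \sum_(i : 'I_n.+1 * 'I_n.+1) F (c, i)).
    by rewrite pair_bigA; apply: eq_bigr => -[].
  by rewrite big_bool.
rewrite /alpha_coef !big_distrl -!big_split /= !split_sum.
split.
  (* The monomials of the second component contribute nothing to the first one: their radial and
     angular parts cancel there. *)
  rewrite [X in _ + X]big1 ?addr0 => [|i _]; last first.
    by rewrite /mcoef /mangular /mradial /da /=; ring.
  rewrite big_distrr /=; apply: eq_bigr => i _.
  have := monomial_ex (true, i) t r; rewrite /= => h.
  rewrite /mcoef /mangular /mradial /=.
  transitivity ((p j)`_(i.1)`_(i.2) * (ex (mexp (true, i)) r * (a t ^+ i.1 * b t ^+ i.2)) *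
    (wedge t / wedge t)); last by rewrite divff// mulr1 h; ring.
  by rewrite {3}/wedge /da /db; ring.
rewrite [X in X + _]big1 ?add0r => [|i _]; last first.
  by rewrite /mcoef /mangular /mradial /db /=; ring.
rewrite big_distrr /=; apply: eq_bigr => i _.
have := monomial_ex (false, i) t r; rewrite /= => h.
rewrite /mcoef /mangular /mradial /=.
transitivity ((q j)`_(i.1)`_(i.2) * (ex (mexp (false, i)) r * (a t ^+ i.1 * b t ^+ i.2)) *
  (wedge t / wedge t)); last by rewrite divff// mulr1 h; ring.
by rewrite {3}/wedge /da /db; ring.
Qed.

Let al eps t r := alpha mexp mcoef k mradial eps t r.
Let be eps t r := alpha mexp mcoef k mangular eps t r.

Lemma truncated_polar eps t r : wedge t != 0 ->
  truncated k P p eps (ex s1 r * a t) (ex s2 r * b t) =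
    ex s1 r * ex nu r * ((1 + be eps t r) * da t + al eps t r * (s1%:R * a t)) /\
  truncated k Q q eps (ex s1 r * a t) (ex s2 r * b t) =
    ex s2 r * ex nu r * ((1 + be eps t r) * db t + al eps t r * (s2%:R * b t)).
Proof.
move=> w0; have [e1 e2] := quasi_homogeneous_ex s1_gt0 s2_gt0 hqh r (a t) (b t).
have inv (s : nat) z : ex s r * ex nu r * (ex (- (s%:Z + nu)) r * z) = z.
  by rewrite exN exD mulrA mulfV ?mul1r// mulf_neq0// gt_eqF ?ex_gt0.
have tot (s : nat) (z : R) (g : R -> R) (f : nat -> R) dz :
  (forall j, (1 <= j)%N -> alpha_coef mexp mcoef mangular j t r * dz +
    alpha_coef mexp mcoef mradial j t r * (s%:R * z)
     = ex (- (s%:Z + nu)) r * f j) ->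
  ex s r * ex nu r * dz + \sum_(1 <= j < k.+1) eps ^+ j * f j =
  ex s r * ex nu r * ((1 + be eps t r) * dz + al eps t r * (s%:R * z)).
  move=> h; rewrite mulrDl mul1r -addrA mulrDr; congr (_ + _).
  rewrite /be /al /alpha !big_distrl -big_split big_distrr /=.
  apply: eq_big_nat => j /andP[j1 _].
  by rewrite -{1}(inv s (f j)) -h//; ring.
by split; rewrite /truncated ?e1 ?e2; apply: tot => //; move=> j j1;
  have [] := polar_order r j1 w0.
Qed.

End polar_coordinates.

Lemma positive_sum4 (R : realDomainType) (x1 x2 x3 x4 : R) : 0 < x1 -> 0 < x2 -> 0 < x3 ->
  0 < x4 ->
  let s := x1 + x2 + x3 + x4 in [/\ 0 < s, x1 <= s, x2 <= s, x3 <= s & x4 <= s].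
Proof. by move=> h1 h2 h3 h4 /=; split; lra. Qed.

Lemma positive_sum5 (R : realDomainType) (x1 x2 x3 x4 x5 : R) :
  0 < x1 -> 0 < x2 -> 0 < x3 -> 0 < x4 -> 0 < x5 ->
  let s := x1 + x2 + x3 + x4 + x5 in
  [/\ 0 < s, x1 <= s, x2 <= s, x2 + x3 <= s & x2 + x4 <= s].
Proof. by move=> h1 h2 h3 h4 h5 /=; split; lra. Qed.

(** * The slow drift of the radius *)

Section drift.
Variables (R : realType) (J : finType) (e : J -> int) (A B : J -> R -> R) (mu : nat -> J -> R).
Variables (k : nat) (nu : int) (S r0 : R).
Hypothesis S0 : 0 <= S.
Hypotheses (cA : forall x, continuous (A x)) (cB : forall x, continuous (B x)).
Hypothesis bA : forall x, exists2 C, 0 < C & forall t, `|A x t| <= C.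
Hypothesis bB : forall x, exists2 C, 0 < C & forall t, `|B x t| <= C.

Let al := alpha e mu k A.
Let be := alpha e mu k B.

Lemma continuous_alpha (V : J -> R -> R) eps (u : R -> R) :
  (forall x, continuous (V x)) -> continuous u ->
  continuous (fun t => alpha e mu k V eps t (u t)).
Proof.
move=> cV cu; apply: continuous_sum => j _ t; apply: cvgM; first exact: cvg_cst.
move: t; apply: continuous_sum => x _ t; apply: cvgM.
  by apply: cvgM; [exact: cvg_cst|exact: cV].
by apply: (@continuous_comp _ _ _ u (ex (e x)));
  [exact: cu|exact: derives_continuous (derives_ex _ _)].
Qed.

(* The approximate solution of d r / d t = alpha / (1 + beta) and the speed kappa
   of the time change that turns it into an approximate orbit. *)
Lemma drift : exists C e1, [/\ 0 < C, 0 < e1, e1 <= 1 & forall eps, `|eps| <= e1 ->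
  exists u du kappa : R -> R, [/\ u 0 = r0, forall t : R, derives t u (du t), continuous kappa,
    forall t, 0 < kappa t & forall t, 0 <= t <= S ->
    [/\ `|u t - r0| <= 1 /\ `|u t - r0| <= C * `|eps|,
        `|du t| <= C /\ `|al eps t (u t) / (1 + be eps t (u t))| <= C * `|eps|,
        `|du t - al eps t (u t) / (1 + be eps t (u t))| <= C * `|eps| ^+ k.+1,
        1 + be eps t (u t) != 0 &
        kappa t <= C /\ kappa t = ex (- nu) (u t) / (1 + be eps t (u t))]]].
Proof.
have [M3 M30 h3] := tame_power_sum (l := 1) (n := k.+1) (D := setT) (r0 := r0)
  (fun j _ => tame_alpha_coef e mu r0 setT j bB).
have [M4 M40 h4] := tame_power_sum (l := 1) (n := k.+1) (D := setT) (r0 := r0)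
  (fun j _ => tame_alpha_coef e mu r0 setT j bA).
have [N N0 hN] := @tame_ex R setT r0 (- nu).
(* This bound on eps keeps 1 + beta at least 1/2. *)
pose e0 := Num.min 1 (2 * M3)^-1.
have M320 : 0 < 2 * M3 by rewrite mulr_gt0.
have e00 : 0 < e0 by rewrite lt_min ltr01 invr_gt0.
have bhalf eps t r : `|eps| <= e0 -> `|r - r0| <= 1 -> `|be eps t r| <= 2^-1.
  rewrite le_min => /andP[e1 e3] hr; have [h _] := h3 eps t r r e1 I hr hr.
  by apply: le_trans h _; rewrite expr1; move: e3;
    rewrite invfM ler_pdivlMr ?[_ * M3]mulrC//; lra.
have b1 eps t r : `|eps| <= e0 -> `|r - r0| <= 1 -> 2^-1 <= 1 + be eps t r.
  by move=> h hr; have := bhalf eps t r h hr; rewrite ler_norml; lra.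
have inv2 (x : R) : 2^-1 <= x -> `|x^-1| <= 2.
  move=> hx; rewrite normfV ger0_norm; last by lra.
  by rewrite -[leRHS]invrK lef_pV2 ?posrE ?invr_gt0//; lra.
pose F eps t r := al eps t (clamp r0 r) / (1 + be eps t (clamp r0 r)).
(* The term 2 M4 comes from the numerator; 4 M3 M4 comes from the variation of the denominator,
   where each inverse is at most 2. *)
pose CF := 2 * M4 + 4 * (M3 * M4).
have MM : 0 < M3 * M4 by rewrite mulr_gt0.
have CF0 : 0 < CF by rewrite /CF; lra.
have cF eps (u : R -> R) : `|eps| <= e0 -> continuous u -> continuous (fun t => F eps t (u t)).
  move=> he cu; have ccu : continuous (fun t => clamp r0 (u t)).
    by move=> t; apply: (@continuous_comp _ _ _ u (clamp r0));
      [exact: cu|exact: continuous_clamp].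
  move=> t; apply: cvgM; first exact: continuous_alpha.
  apply: cvgV; first by rewrite gt_eqF// (lt_le_trans _ (b1 _ _ _ he (clamp_near _ _))).
  by apply: cvgD; [exact: cvg_cst|exact: continuous_alpha].
have hF eps t r r' : `|eps| <= e0 -> `|F eps t r| <= CF * `|eps| /\
    `|F eps t r - F eps t r'| <= CF * `|eps| * `|r - r'|.
  move=> he; have e1 : `|eps| <= 1 by move: he; rewrite le_min => /andP[].
  have [a1 a2] := h4 eps t _ _ e1 I (clamp_near r0 r) (clamp_near r0 r').
  have [a1' _] := h4 eps t _ _ e1 I (clamp_near r0 r') (clamp_near r0 r).
  have [_ a3] := h3 eps t _ _ e1 I (clamp_near r0 r') (clamp_near r0 r).
  have i1 := inv2 _ (b1 eps t _ he (clamp_near r0 r)).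
  have i2 := inv2 _ (b1 eps t _ he (clamp_near r0 r')).
  have n1 : 1 + be eps t (clamp r0 r) != 0.
    by rewrite gt_eqF// (lt_le_trans _ (b1 _ _ _ he (clamp_near _ _))).
  have n2 : 1 + be eps t (clamp r0 r') != 0.
    by rewrite gt_eqF// (lt_le_trans _ (b1 _ _ _ he (clamp_near _ _))).
  rewrite !expr1 in a1 a2 a1' a3.
  have cl := clamp_lipschitz r0 r r'; have cl' := clamp_lipschitz r0 r' r.
  rewrite distrC [X in _ <= X]distrC in cl'.
  have Me : 0 <= M4 * `|eps| by rewrite mulr_ge0// ltW.
  have Me3 : 0 <= M3 * `|eps| by rewrite mulr_ge0// ltW.
  split.
    rewrite normrM; apply: (@le_trans _ _ (M4 * `|eps| * 2)); first exact: ler_pM.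
    have -> : CF * `|eps| = M4 * `|eps| * 2 + 4 * (M3 * M4) * `|eps| by rewrite /CF; ring.
    by rewrite lerDl !mulr_ge0// ltW.
  have -> : F eps t r - F eps t r' =
    (al eps t (clamp r0 r) - al eps t (clamp r0 r')) * (1 + be eps t (clamp r0 r))^-1 +
    al eps t (clamp r0 r') * ((be eps t (clamp r0 r') - be eps t (clamp r0 r)) *
      ((1 + be eps t (clamp r0 r))^-1 * (1 + be eps t (clamp r0 r'))^-1)).
    by rewrite /F; field; rewrite n1 n2.
  have d0 := normr_ge0 (r - r').
  apply: le_trans (ler_normD _ _) _; rewrite !normrM.
  have t1 : `|al eps t (clamp r0 r) - al eps t (clamp r0 r')| * `|(1 +
    be eps t (clamp r0 r))^-1| <=
      M4 * `|eps| * `|r - r'| * 2.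
    by apply: ler_pM => //; apply: le_trans a2 _; rewrite ler_wpM2l.
  have t2 : `|be eps t (clamp r0 r') - be eps t (clamp r0 r)| <= M3 * `|eps| * `|r - r'|.
    by apply: le_trans a3 _; rewrite ler_wpM2l// distrC.
  have t3 : `|(1 + be eps t (clamp r0 r))^-1| * `|(1 + be eps t (clamp r0 r'))^-1| <= 2 * 2.
    exact: ler_pM.
  have t4 : `|al eps t (clamp r0 r')| * (`|be eps t (clamp r0 r') - be eps t (clamp r0 r)| *
      (`|(1 + be eps t (clamp r0 r))^-1| * `|(1 + be eps t (clamp r0 r'))^-1|)) <=
      M4 * 1 * (M3 * `|eps| * `|r - r'| * (2 * 2)).
    apply: ler_pM => //; rewrite ?mulr_ge0//; last by apply: ler_pM; rewrite ?mulr_ge0.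
    by apply: le_trans a1' _; rewrite ler_wpM2l// ltW.
  apply: le_trans (lerD t1 t4) _; rewrite le_eqVlt; apply/orP; left; apply/eqP.
  by rewrite /CF; ring.
have [C' C'0 hC'] := @picard_approximation R S r0 CF e0 F S0 CF0 cF hF k.
pose C := CF * (S + 1) + CF + C' + 2 * N.
have CS : 0 < CF * (S + 1) by rewrite mulr_gt0// ltr_wpDl.
have N20 : 0 < 2 * N by rewrite mulr_gt0.
have [C0 CSC CFC C'C N2C] : [/\ 0 < C, CF * (S + 1) <= C, CF <= C, C' <= C & 2 * N <= C].
  exact: positive_sum4.
(* The second bound keeps [u] within distance 1 of [r0] on [0, S], where the clamp is the identity;
   S + 1 avoids dividing by zero. *)
exists C, (Num.min e0 (CF * (S + 1))^-1); split.
- exact: C0.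
- by rewrite lt_min e00 invr_gt0.
- by rewrite /e0 !ge_min lexx.
move=> eps; rewrite le_min => /andP[he heS].
have e1 : `|eps| <= 1 by move: he; rewrite le_min => /andP[].
have [u [du [u0 hu cdu hS]]] := hC' eps he.
have cu : continuous u by move=> t; exact: derives_continuous (hu t).
have ccu : continuous (fun t => clamp r0 (u t)).
  by move=> t; apply: (@continuous_comp _ _ _ u (clamp r0));
    [exact: cu|exact: continuous_clamp].
(* Clamping makes [kappa] continuous and positive for all times, so that its antiderivative is a
   genuine time change. *)
pose kappa t := ex (- nu) (clamp r0 (u t)) / (1 + be eps t (clamp r0 (u t))).
have bp t : 0 < 1 + be eps t (clamp r0 (u t)).
  by apply: lt_le_trans (b1 _ _ _ he (clamp_near _ _)).
exists u, du, kappa; split => //.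
- move=> t; apply: cvgM.
    apply: (@continuous_comp _ _ _ (fun t => clamp r0 (u t)) (ex (- nu))); first exact: ccu.
    exact: derives_continuous (derives_ex _ _).
  apply: cvgV; first by rewrite gt_eqF.
  by apply: cvgD; [exact: cvg_cst|exact: continuous_alpha].
- by move=> t; rewrite /kappa divr_gt0// ex_gt0.
move=> t tS; have [k1 k2 k3] := hS t tS.
have en := normr_ge0 eps.
have S1e : CF * S * `|eps| <= CF * (S + 1) * `|eps|.
  by rewrite ler_wpM2r// ler_wpM2l ?(ltW CF0)// lerDl.
have near1 : `|u t - r0| <= 1.
  apply: le_trans k1 _; apply: le_trans S1e _.
  by rewrite mulrC -ler_pdivlMr// mul1r.
have cid : clamp r0 (u t) = u t by exact: clamp_id.
have Fe : F eps t (u t) = al eps t (u t) / (1 + be eps t (u t)) by rewrite /F cid.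
have wC (x y : R) : 0 <= y -> x <= C -> x * y <= C * y by move=> y0 xC; rewrite ler_wpM2r.
split.
- by split => //; apply: le_trans k1 _; apply: le_trans S1e _; exact: wC.
- rewrite -Fe; split.
    apply: le_trans k2 _; apply: (@le_trans _ _ (CF * 1)); first by rewrite ler_wpM2l// ltW.
    by rewrite mulr1.
  have [f1 _] := hF eps t (u t) (u t) he; apply: le_trans f1 _; exact: wC.
- by rewrite -Fe; apply: le_trans k3 _; apply: wC; rewrite ?exprn_ge0.
- by rewrite -cid gt_eqF.
split; last by rewrite /kappa cid.
have [n1 _] := hN t _ _ I (clamp_near r0 (u t)) (clamp_near r0 (u t)).
apply: (@le_trans _ _ (N * 2)); last by rewrite mulrC.
apply: ler_pM; rewrite ?(ltW (ex_gt0 _ _)) ?invr_ge0 ?(ltW (bp t))//.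
  exact: le_trans (ler_norm _) n1.
exact: le_trans (ler_norm _) (inv2 _ (b1 _ _ _ he (clamp_near _ _))).
Qed.

End drift.

(** * The return map *)

Section tracking.
Variables (R : realType) (s1 s2 m n k : nat) (P Q : {poly {poly R}}) (p q : nat ->
  {poly {poly R}}).
Variables (a b : R -> R) (T : R).
Hypotheses (s1_gt0 : (0 < s1)%N) (s2_gt0 : (0 < s2)%N).
Hypothesis hqh : quasi_homogeneous s1 s2 m P Q.
Hypotheses (hp : analytic_perturbation p) (hq : analytic_perturbation q).
Hypothesis hpn : forall i, (1 <= i)%N -> total_degree_le n (p i).
Hypothesis hqn : forall i, (1 <= i)%N -> total_degree_le n (q i).
Hypothesis T0 : 0 < T.
Hypothesis hab : forall t, integral_curve P Q (fun=> 1) a b t.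
Hypothesis abT : forall t, a (t + T) = a t /\ b (t + T) = b t.
Hypothesis hw : forall t, wedge s1 s2 P Q a b t != 0.

Let nu : int := m%:Z - 1.

Lemma orbit_continuous : continuous a /\ continuous b.
Proof. by split=> t; have [h h'] := hab t;
  [exact: derives_continuous h|exact: derives_continuous h']. Qed.

Lemma orbit_field_continuous (f : {poly {poly R}}) : continuous (fun t => f.[a t, b t]).
Proof. by have [ca cb] := orbit_continuous; move=> t; apply: continuous_hornerXY;
  [exact: ca|exact: cb]. Qed.

Lemma continuous_pow (g : R -> R) (i : nat) : continuous g -> continuous (fun t => g t ^+ i).
Proof.
move=> cg; elim: i => [|i IH] t; first exact: cvg_cst.
have -> : (fun s => g s ^+ i.+1) = (fun s => g s * g s ^+ i).
  by apply/funext => s; rewrite exprS.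
by apply: cvgM; [exact: cg|exact: IH].
Qed.

Lemma wedge_continuous : continuous (wedge s1 s2 P Q a b).
Proof.
have [ca cb] := orbit_continuous.
move=> t; apply: cvgB; apply: cvgM; try exact: orbit_field_continuous.
  by apply: cvgM; [exact: cvg_cst|exact: ca].
by apply: cvgM; [exact: cvg_cst|exact: cb].
Qed.

Lemma mradial_continuous (x : monomial n) : continuous (mradial s1 s2 P Q a b x).
Proof.
have [ca cb] := orbit_continuous => t; apply: cvgM; last first.
  by apply: cvgV; [exact: hw|exact: wedge_continuous].
apply: cvgM; first by apply: cvgM; exact: continuous_pow.
by case: (x.1); [exact: orbit_field_continuous|apply: cvgN; exact: orbit_field_continuous].
Qed.

Lemma mangular_continuous (x : monomial n) : continuous (mangular s1 s2 P Q a b x).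
Proof.
have [ca cb] := orbit_continuous => t; apply: cvgM; last first.
  by apply: cvgV; [exact: hw|exact: wedge_continuous].
apply: cvgM; first by apply: cvgM; exact: continuous_pow.
case: (x.1); last by apply: cvgM; [exact: cvg_cst|exact: ca].
by apply: cvgN; apply: cvgM; [exact: cvg_cst|exact: cb].
Qed.

Lemma mradial_periodic (x : monomial n) t :
  mradial s1 s2 P Q a b x (t + T) = mradial s1 s2 P Q a b x t.
Proof. by rewrite /mradial /wedge; have [-> ->] := abT t. Qed.

Lemma mangular_periodic (x : monomial n) t :
  mangular s1 s2 P Q a b x (t + T) = mangular s1 s2 P Q a b x t.
Proof. by rewrite /mangular /wedge; have [-> ->] := abT t. Qed.

Lemma mradial_bounded (x : monomial n) :
  exists2 C, 0 < C & forall t, `|mradial s1 s2 P Q a b x t| <= C.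
Proof. exact: (periodic_bounded T0 (@mradial_continuous x) (mradial_periodic x)). Qed.

Lemma mangular_bounded (x : monomial n) :
  exists2 C, 0 < C & forall t, `|mangular s1 s2 P Q a b x t| <= C.
Proof. exact: (periodic_bounded T0 (@mangular_continuous x) (mangular_periodic x)). Qed.

Let al eps t r := alpha (mexp s1 s2 m (n := n)) (mcoef (n :=
  n) p q) k (mradial s1 s2 P Q a b (n := n)) eps t r.
Let be eps t r := alpha (mexp s1 s2 m (n := n)) (mcoef (n :=
  n) p q) k (mangular s1 s2 P Q a b (n := n)) eps t r.

Variables (S r0 : R).
Hypothesis S0 : 0 <= S.

(** The true orbit [g] is read in the time t of the reference orbit, through [tau]. Two scales are
    needed: order eps^(k+1) with respect to the drifting curve, for the value of the return map, and
    order eps with respect to the unperturbed orbit, including the derivative of the second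
    coordinate, for locating the return. The orbit is known up to [Tg] only, hence the condition on
    [tau t1]. *)
Lemma tracking : exists C e1, [/\ 0 < C, 0 < e1, e1 <= 1 & forall eps, `|eps| <= e1 ->
  exists u du tau kappa : R -> R, [/\
    [/\ u 0 = r0, tau 0 = 0, forall t : R, derives t u (du t),
        forall t : R, derives t tau (kappa t) & forall t, 0 < kappa t],
    forall t, 0 <= t <= S ->
      [/\ `|u t - r0| <= 1, `|u t - r0| <= C * `|eps|, `|du t| <= C &
        `|du t - al eps t (u t) / (1 + be eps t (u t))| <= C * `|eps| ^+ k.+1] &
    forall (Tg : R) (g : R -> R * R), solution_on [set t | 0 <= t <=
      Tg] (perturbed_field P Q p q eps) g ->
      g 0 = (ex s1 r0 * a 0, ex s2 r0 * b 0) ->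
      forall t1, 0 <= t1 <= S -> tau t1 <= Tg -> forall t, 0 <= t <= t1 ->
      [/\ `|(g (tau t)).1 - ex s1 (u t) * a t| <= C * `|eps| ^+ k.+1 /\
          `|(g (tau t)).2 - ex s2 (u t) * b t| <= C * `|eps| ^+ k.+1,
        `|(g (tau t)).1 - ex s1 r0 * a t| <= C * `|eps| /\
        `|(g (tau t)).2 - ex s2 r0 * b t| <= C * `|eps| &
        exists2 df, derives t (fun s => (g (tau s)).2) df &
          `|df - ex s2 r0 * Q.[a t, b t]| <= C * `|eps|]]].
Proof.
have [C1 [e1 [C10 e10 e11 hdrift]]] := @drift R (monomial n) (mexp s1 s2 m (n := n))
  (mradial s1 s2 P Q a b (n := n)) (mangular s1 s2 P Q a b (n := n)) (mcoef (n :=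
    n) p q) k nu S r0 S0
  mradial_continuous mangular_continuous mradial_bounded mangular_bounded.
have [Ca Ca0 hCa] := bounded_orbit T0 hab abT.
have [Cd Cd0 hCd] := @periodic_bounded R (fun t => Q.[a t, b t]) T T0
  (@orbit_field_continuous Q) (fun t => ltac:(by have [-> ->] := abT t)).
have [N1 N10 hN1] := @tame_ex R setT r0 s1.
have [N2 N20 hN2] := @tame_ex R setT r0 s2.
have r0r0 : `|r0 - r0| <= 1 by rewrite subrr normr0.
(* The summand 1 is the margin required by [comparison]. *)
pose B := (N1 + N2) * Ca + 1.
have [D1 [d1 [D10 d10 hD1]]] := truncation_error k P B hp hpn.
have [D2 [d2 [D20 d20 hD2]]] := truncation_error k Q B hq hqn.
have [L1 L10 hL1] := truncated_lipschitz k P p B.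
have [L2 L20 hL2] := truncated_lipschitz k Q q B.
pose L := L1 + L2.
have L0 : 0 <= L by rewrite /L; lra.
have [Cc [eta0 [Cc0 eta00 hcomp]]] := @comparison R L B S C1 L0 S0 (ltW C10).
pose E1 := N1 * (s1%:R * Ca * C1); pose E2 := N2 * (s2%:R * Ca * C1).
have s1R : 0 < s1%:R :> R by rewrite ltr0n.
have s2R : 0 < s2%:R :> R by rewrite ltr0n.
have E10 : 0 < E1 by rewrite /E1 !mulr_gt0.
have E20 : 0 < E2 by rewrite /E2 !mulr_gt0.
(* [H] bounds all residuals: E1 and E2 come from the defect of [u], and the products with D1 and D2
   from truncating the field, multiplied by the bound on [kappa]. *)
pose H := E1 + E2 + C1 * D1 + C1 * D2.
have CD1 : 0 < C1 * D1 by rewrite mulr_gt0.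
have CD2 : 0 < C1 * D2 by rewrite mulr_gt0.
have [H0 E1H E2H CD1H CD2H] : [/\ 0 < H, E1 <= H, E2 <= H, C1 * D1 <= H & C1 * D2 <= H].
  exact: positive_sum4.
pose W1 := Cc * H; pose W2 := N1 * C1 * Ca; pose W3 := N2 * C1 * Ca.
pose W4 := H + C1 * (L * (W1 + W1)) + N2 * C1 * Cd + N2 * (s2%:R * Ca * C1).
have W10 : 0 < W1 by rewrite /W1 mulr_gt0.
have W20 : 0 < W2 by rewrite /W2 !mulr_gt0.
have W30 : 0 < W3 by rewrite /W3 !mulr_gt0.
have W40 : 0 < W4.
  rewrite /W4; apply: addr_gt0; last by rewrite !mulr_gt0.
  apply: addr_gt0; last by rewrite !mulr_gt0.
  by apply: ltr_pwDl => //; rewrite !mulr_ge0 ?addr_ge0// ltW.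
pose C := C1 + W1 + W2 + W3 + W4.
have [C0 C1C W1C W12C W13C] : [/\ 0 < C, C1 <= C, W1 <= C, W1 + W2 <= C & W1 + W3 <= C].
  exact: positive_sum5.
have W4C : W4 <= C by rewrite /C lerDr !addr_ge0 ?ltW.
(* eta0 / H makes the residual admissible for [comparison]; the inverse of [W1] keeps the true orbit
   within distance 1 of the approximate one, hence in the box; d1 and d2 validate the truncation. *)
exists C, (Num.min (Num.min e1 (Num.min (eta0 / H) W1^-1)) (Num.min d1 d2)); split.
- exact: C0.
- by rewrite !lt_min e10 d10 d20 invr_gt0 W10 divr_gt0.
- by rewrite !ge_min e11.
move=> eps; rewrite !le_min => /andP[/andP[ee1 /andP[eeta eW1]] /andP[ed1 ed2]].
have eps1 : `|eps| <= 1 by exact: le_trans e11.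
have epsk : `|eps| ^+ k.+1 <= `|eps| by rewrite -[leRHS]expr1 ler_wiXn2l.
have epsk0 : 0 <= `|eps| ^+ k.+1 by rewrite exprn_ge0.
have eps0 := normr_ge0 eps.
have [u [du [kappa [u0 hu ck kp hS]]]] := hdrift eps ee1.
have [tau tau0 htau] := antiderivative ck.
exists u, du, tau, kappa; split => //.
  move=> t tS; have [[x1 x2] [x3 _] x4 _ _] := hS t tS.
  split => //; [apply: le_trans x2 _|exact: le_trans x3 _|apply: le_trans x4 _];
    exact: ler_wpM2r.
move=> Tg g hg g0 t1 /andP[t10 t1S] tau1.
have tauD s t : s <= t -> tau s <= tau t.
  move=> st; have := derive_ge st (fun x _ => htau x) (c := 0) (fun x _ => ltW (kp x)).
  by rewrite mul0r subr_ge0.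
have gdom t : 0 <= t <= t1 -> 0 <= tau t <= Tg.
  by move=> /andP[t0' tt1]; rewrite -tau0 tauD//= (le_trans (tauD _ _ tt1)).
have sub t : 0 <= t <= t1 -> 0 <= t <= S by move=> /andP[-> h]; rewrite (le_trans h).
pose f1 t := (g (tau t)).1; pose f2 t := (g (tau t)).2.
pose df1 t := (perturbed_field P Q p q eps (g (tau t))).1 * kappa t.
pose df2 t := (perturbed_field P Q p q eps (g (tau t))).2 * kappa t.
have hf t : 0 <= t <= t1 -> derives t f1 (df1 t) /\ derives t f2 (df2 t).
  move=> tt; have [h1 h2] := hg (tau t) (gdom t tt); split.
    exact: (derives_comp (h1 : derives _ _ _) (htau t)).
  exact: (derives_comp (h2 : derives _ _ _) (htau t)).
pose z1 t := ex s1 (u t) * a t; pose z2 t := ex s2 (u t) * b t.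
pose dz1 t := ex s1 (u t) * (P.[a t, b t] + du t * (s1%:R * a t)).
pose dz2 t := ex s2 (u t) * (Q.[a t, b t] + du t * (s2%:R * b t)).
have hz t : derives t z1 (dz1 t) /\ derives t z2 (dz2 t).
  have [h1 h2] := hab t; split.
    apply: derives_val (derivesM (derives_comp (derives_ex s1 (u t)) (hu t)) h1) _.
    by rewrite /dz1 /= -pmulrn; ring.
  apply: derives_val (derivesM (derives_comp (derives_ex s2 (u t)) (hu t)) h2) _.
  by rewrite /dz2 /= -pmulrn; ring.
pose Ff t := al eps t (u t) / (1 + be eps t (u t)).
(* [kappa] cancels the factor e^(nu u) (1 + beta), so the rescaled field is the velocity of [z] with
   its drift [du] replaced by alpha / (1 + beta). *)
have kX t : 0 <= t <= S ->
    kappa t * truncated k P p eps (z1 t) (z2 t) = ex s1 (u t) * (P.[a t, b t] +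
      Ff t * (s1%:R * a t)) /\
    kappa t * truncated k Q q eps (z1 t) (z2 t) = ex s2 (u t) * (Q.[a t, b t] +
      Ff t * (s2%:R * b t)).
  move=> tS; have [_ _ _ bn [_ ->]] := hS t tS.
  have [-> ->] : truncated k P p eps (z1 t) (z2 t) =
      ex s1 (u t) * ex nu (u t) * ((1 + be eps t (u t)) * P.[a t, b t] +
        al eps t (u t) * (s1%:R * a t)) /\
    truncated k Q q eps (z1 t) (z2 t) =
      ex s2 (u t) * ex nu (u t) * ((1 + be eps t (u t)) * Q.[a t, b t] +
        al eps t (u t) * (s2%:R * b t)).
    exact: (truncated_polar k s1_gt0 s2_gt0 hqh hpn hqn eps (u t) (hw t)).
  move: bn; rewrite -/(be eps t (u t)) => bn.
  have en : ex nu (u t) != 0 by rewrite gt_eqF ?ex_gt0.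
  rewrite -/(be eps t (u t)) /Ff exN; split; field; apply/andP; split => //.
pose ebound (s : nat) N := forall t r r' : R, setT t -> `|r - r0| <= 1 -> `|r' - r0| <= 1 ->
    `|ex s r| <= N /\ `|ex s r - ex s r'| <= N * `|r - r'|.
have exb (s : nat) N : ebound s N -> forall v, 0 <= v <= S -> `|ex s (u v)| <= N.
  by move=> hN v vS; have [[x1 _] _ _ _ _] := hS v vS; have [] := hN 0 (u v) (u v) I x1 x1.
have zB t : 0 <= t <= S -> `|z1 t| <= B - 1 /\ `|z2 t| <= B - 1.
  move=> tS; have [ha hb] := hCa t; rewrite /B addrK mulrDl; split.
    rewrite normrM; apply: le_trans (ler_pM (normr_ge0 _) (normr_ge0 _) (exb _ _ hN1 t tS)
      ha) _.
    by rewrite lerDl mulr_ge0// ltW.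
  rewrite normrM; apply: le_trans (ler_pM (normr_ge0 _) (normr_ge0 _) (exb _ _ hN2 t tS) hb) _.
  by rewrite lerDr mulr_ge0// ltW.
pose eta := H * `|eps| ^+ k.+1.
have eta_ge0 : 0 <= eta by rewrite mulr_ge0// ltW.
have eta_le : eta <= eta0.
  apply: (@le_trans _ _ (H * `|eps|)); first by rewrite ler_wpM2l// ltW.
  by rewrite mulrC -ler_pdivlMr.
have resz t : 0 <= t <= S ->
    `|dz1 t - kappa t * truncated k P p eps (z1 t) (z2 t)| <= eta /\
    `|dz2 t - kappa t * truncated k Q q eps (z1 t) (z2 t)| <= eta.
  move=> tS; have [-> ->] := kX t tS; have [_ _ x4 _ _] := hS t tS; have [ha hb] := hCa t.
  have red (s : nat) N x y E : N * (s%:R * Ca * C1) <= H -> `|ex s (u t)| <= N -> `|y| <= Ca ->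
      `|ex s (u t) * (x + du t * (s%:R * y)) - ex s (u t) * (x + Ff t * (s%:R * y))| <= eta.
    move=> NE hE hy.
    have -> : ex s (u t) * (x + du t * (s%:R * y)) - ex s (u t) * (x + Ff t * (s%:R * y)) =
      ex s (u t) * (s%:R * y * (du t - Ff t)) by ring.
    rewrite !normrM; apply: (@le_trans _ _ (N * (s%:R * Ca * (C1 * `|eps| ^+ k.+1)))).
      apply: ler_pM; rewrite ?mulr_ge0//; apply: ler_pM; rewrite ?mulr_ge0//.
      by rewrite ger0_norm// ler_wpM2l.
    rewrite /eta (_ : _ * _ = N * (s%:R * Ca * C1) * `|eps| ^+ k.+1); last by ring.
    exact: ler_wpM2r.
  split.
    exact: red (exb _ _ hN1 t tS) ha.
  exact: red (exb _ _ hN2 t tS) hb.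
have resf t : 0 <= t <= t1 -> `|f1 t| <= B -> `|f2 t| <= B ->
    `|df1 t - kappa t * truncated k P p eps (f1 t) (f2 t)| <= eta /\
    `|df2 t - kappa t * truncated k Q q eps (f1 t) (f2 t)| <= eta.
  move=> tt b1 b2; have [_ _ _ _ [kC _]] := hS t (sub t tt).
  have h1 := hD1 eps (f1 t) (f2 t) ed1 b1 b2; have h2 := hD2 eps (f1 t) (f2 t) ed2 b1 b2.
  have kn : `|kappa t| <= C1 by rewrite gtr0_norm.
  rewrite /df1 /df2 ![_ * kappa t]mulrC -!mulrBr !normrM; split.
    apply: le_trans (ler_pM (normr_ge0 _) (normr_ge0 _) kn h1) _.
    by rewrite /eta mulrA ler_wpM2r.
  apply: le_trans (ler_pM (normr_ge0 _) (normr_ge0 _) kn h2) _.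
  by rewrite /eta mulrA ler_wpM2r.
have lipX x y x' y' : `|x| <= B -> `|y| <= B -> `|x'| <= B -> `|y'| <= B ->
    `|truncated k P p eps x y - truncated k P p eps x' y'| <= L * (`|x - x'| + `|y - y'|) /\
    `|truncated k Q q eps x y - truncated k Q q eps x' y'| <= L * (`|x - x'| + `|y - y'|).
  move=> b1 b2 b3 b4; have s0 : 0 <= `|x - x'| + `|y - y'| by rewrite addr_ge0.
  split.
    by apply: le_trans (hL1 eps x y x' y' eps1 b1 b2 b3 b4) _; rewrite ler_wpM2r// /L lerDl ltW.
  by apply: le_trans (hL2 eps x y x' y' eps1 b1 b2 b3 b4) _; rewrite ler_wpM2r// /L lerDr ltW.
have close t : 0 <= t <= t1 -> `|f1 t - z1 t| <= Cc * eta /\ `|f2 t - z2 t| <= Cc * eta.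
  apply: (hcomp (truncated k P p eps) (truncated k Q q eps) kappa f1 f2 z1 z2 df1 df2 dz1 dz2
    eta t1) => //.
  - by rewrite eta_ge0.
  - by rewrite /f1 /z1 tau0 g0 u0.
  - by rewrite /f2 /z2 tau0 g0 u0.
  - by move=> s ss; have [? ?] := hf s ss; have [? ?] := hz s; split.
  move=> s ss; have [_ _ _ _ [kC _]] := hS s (sub s ss); have [? ?] := zB s (sub s ss).
  by have [? ?] := resz s (sub s ss); split => //; rewrite gtr0_norm.
move=> t tt; have tS := sub t tt.
have [c1 c2] := close t tt.
have [[x1 x2] [_ x5] _ _ [kC _]] := hS t tS; have [ha hb] := hCa t.
have W1e : Cc * eta = W1 * `|eps| ^+ k.+1 by rewrite /W1 /eta mulrA.
rewrite W1e in c1 c2.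
have W1eps : W1 * `|eps| ^+ k.+1 <= W1 * `|eps| by rewrite ler_wpM2l// ltW.
have fC (x y : R) : 0 <= y -> x <= C -> x * y <= C * y by move=> y0 xC; rewrite ler_wpM2r.
have exd (s : nat) N : ebound s N -> 0 < N -> `|ex s (u t) - ex s r0| <= N * C1 * `|eps|.
  move=> hN N0; have [_ h] := hN 0 (u t) r0 I x1 r0r0; apply: le_trans h _.
  by rewrite -mulrA ler_wpM2l// ltW.
have zr (s : nat) N y M : `|ex s (u t) - ex s r0| <= N * C1 * `|eps| -> `|y| <= M ->
    `|ex s (u t) * y - ex s r0 * y| <= N * C1 * M * `|eps|.
  move=> h hy; rewrite -mulrBl normrM mulrAC; exact: ler_pM.
have zr1 := zr _ _ _ _ (exd _ _ hN1 N10) ha; have zr2 := zr _ _ _ _ (exd _ _ hN2 N20) hb.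
rewrite -/W2 in zr1; rewrite -/W3 in zr2.
split.
- by split; [apply: le_trans c1 _|apply: le_trans c2 _]; exact: fC.
- split.
    apply: (@le_trans _ _ ((W1 + W2) * `|eps|)); last by exact: fC.
    rewrite mulrDl (_ : _ - _ = (f1 t - z1 t) + (z1 t - ex s1 r0 * a t));
      last by rewrite /f1; ring.
    by apply: le_trans (ler_normD _ _) _; apply: lerD => //; exact: le_trans W1eps.
  apply: (@le_trans _ _ ((W1 + W3) * `|eps|)); last by exact: fC.
  rewrite mulrDl (_ : _ - _ = (f2 t - z2 t) + (z2 t - ex s2 r0 * b t)); last by rewrite /f2;
    ring.
  by apply: le_trans (ler_normD _ _) _; apply: lerD => //; exact: le_trans W1eps.
exists (df2 t); first by have [] := hf t tt.
apply: (@le_trans _ _ (W4 * `|eps|)); last by exact: fC.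
have [z1B z2B] := zB t tS.
have Ceta1 : W1 * `|eps| ^+ k.+1 <= 1.
  apply: le_trans W1eps _.
  by rewrite mulrC -ler_pdivlMr// mul1r.
have f1B : `|f1 t| <= B.
  have -> : f1 t = (f1 t - z1 t) + z1 t by ring.
  apply: le_trans (ler_normD _ _) _.
  by apply: le_trans (lerD (le_trans c1 Ceta1) z1B) _; rewrite addrC subrK.
have f2B : `|f2 t| <= B.
  have -> : f2 t = (f2 t - z2 t) + z2 t by ring.
  apply: le_trans (ler_normD _ _) _.
  by apply: le_trans (lerD (le_trans c2 Ceta1) z2B) _; rewrite addrC subrK.
have z1B' : `|z1 t| <= B by apply: le_trans z1B _; rewrite gerBl.
have z2B' : `|z2 t| <= B by apply: le_trans z2B _; rewrite gerBl.
have [_ rf] := resf t tt f1B f2B.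
have [_ lp] := lipX (f1 t) (f2 t) (z1 t) (z2 t) f1B f2B z1B' z2B'.
have [_ kz] := kX t tS.
have zd := zr _ _ _ _ (exd _ _ hN2 N20) (hCd t).
(* Four sources of error: truncation, distance between the orbits, drift of the radius, and the
   radial velocity. *)
have -> : df2 t - ex s2 r0 * Q.[a t, b t] =
  (df2 t - kappa t * truncated k Q q eps (f1 t) (f2 t)) +
  kappa t * (truncated k Q q eps (f1 t) (f2 t) - truncated k Q q eps (z1 t) (z2 t)) +
  (ex s2 (u t) * Q.[a t, b t] - ex s2 r0 * Q.[a t, b t]) +
  ex s2 (u t) * (s2%:R * b t * Ff t).
  have -> : ex s2 (u t) * (s2%:R * b t * Ff t) =
    kappa t * truncated k Q q eps (z1 t) (z2 t) - ex s2 (u t) * Q.[a t, b t] by rewrite kz;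
      ring.
  by ring.
have -> : W4 * `|eps| = H * `|eps| + C1 * (L * (W1 + W1)) * `|eps| + N2 * C1 * Cd * `|eps| +
  N2 * (s2%:R * Ca * C1) * `|eps| by rewrite /W4; ring.
apply: le_trans (ler_normD _ _) _; apply: lerD; last first.
  rewrite normrM [X in _ * X]normrM [X in _ * (X * _)]normrM.
  apply: (@le_trans _ _ (N2 * (s2%:R * Ca * (C1 * `|eps|)))).
    apply: ler_pM; rewrite ?mulr_ge0//; first exact: exb hN2 t tS.
    apply: ler_pM; rewrite ?mulr_ge0//.
    by rewrite (ger0_norm (ltW s2R)) ler_wpM2l// ltW.
  by rewrite !mulrA.
apply: le_trans (ler_normD _ _) _; apply: lerD => //.
apply: le_trans (ler_normD _ _) _; apply: lerD.
  by apply: le_trans rf _; rewrite /eta ler_wpM2l// ltW.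
rewrite normrM gtr0_norm// -mulrA; apply: ler_pM => //; first exact: ltW.
apply: le_trans lp _; rewrite -mulrA ler_wpM2l// mulrDl.
by apply: lerD; [apply: le_trans c1 _|apply: le_trans c2 _].
Qed.

End tracking.

(** * Crossings of the section by a nearby curve *)

Section return_geometry.
Variables (R : realType) (P Q : {poly {poly R}}) (a b : R -> R) (T ca cb : R).
Hypotheses (T0 : 0 < T) (ca0 : 0 < ca) (cb0 : 0 < cb).
Hypothesis hab : forall t, integral_curve P Q (fun=> 1) a b t.
Hypothesis abT : forall t, a (t + T) = a t /\ b (t + T) = b t.
Hypotheses (a0 : 0 < a 0) (b0 : b 0 = 0) (Q0 : Q.[a 0, b 0] != 0).
Hypothesis hleft : forall t, 0 < t < T -> b t = 0 -> a t < 0.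

Let q := Q.[a 0, b 0].
Let db t := Q.[a t, b t].

Lemma near_section : exists eta d0, [/\ 0 < eta <= 1, eta < T / 2, 0 < d0,
  forall t, `|t| <= eta -> d0 <= q * db t /\ a 0 / 2 <= a t &
  forall t, `|t - T| <= eta -> d0 <= q * db t /\ a 0 / 2 <= a t].
Proof.
have [ca' cb'] := orbit_continuous hab.
have cdb : continuous (fun t => q * db t).
  by move=> t; apply: cvgM; [exact: cvg_cst|exact: orbit_field_continuous hab Q t].
pose d0 := q * q / 2.
have qq : 0 < q * q by rewrite -expr2 lt_def sqr_ge0 sqrf_eq0 Q0.
have d00 : 0 < d0 by rewrite divr_gt0.
have [e1 e10 he1] : exists2 e : R, 0 < e & forall t : R, `|t| < e -> d0 <= q * db t.
  have /cdb[/= e e0 he] : nbhs (q * db 0) [set x | d0 < x].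
    by apply: lt_nbhsr; rewrite /d0 /db -/q; lra.
  by exists e => // t te; apply/ltW/he; rewrite /= sub0r normrN.
have [e2 e20 he2] : exists2 e : R, 0 < e & forall t : R, `|t| < e -> a 0 / 2 <= a t.
  have /ca'[/= e e0 he] : nbhs (a 0) [set x | a 0 / 2 < x].
    by apply: lt_nbhsr; move: a0; lra.
  by exists e => // t te; apply/ltW/he; rewrite /= sub0r normrN.
pose eta := Num.min (Num.min (e1 / 2) (e2 / 2)) (Num.min 1 (T / 3)).
have eta0 : 0 < eta by rewrite !lt_min !divr_gt0// ltr01.
have [l1 l2 l3 l4] : [/\ eta <= e1 / 2, eta <= e2 / 2, eta <= 1 & eta <= T / 3].
  by rewrite /eta !ge_min !lexx !orbT.
have near0 t : `|t| <= eta -> d0 <= q * db t /\ a 0 / 2 <= a t.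
  by move=> ht; split; [apply: he1|apply: he2]; lra.
exists eta, d0; split => //.
- by rewrite eta0.
- by apply: le_lt_trans l4 _; rewrite ltr_pM2l ?ltf_pV2 ?posrE ?ltr_nat.
move=> t ht; have [h1 h2] := near0 _ ht.
by have [e3 e4] := abT (t - T); rewrite subrK in e3 e4; rewrite /db e3 e4.
Qed.

(** Closeness of the curves alone cannot exclude a spurious crossing right after the start, since f2
    vanishes at 0; closeness of the derivative makes q f2 increase there. In the middle the orbit
    stays away from the half-axis, and around [T] transversality forces a change of sign of f2. *)
Lemma return_geometry : exists eta d0 mu, [/\ 0 < eta <= 1, eta < T / 2, 0 < d0, 0 < mu &
  (forall t, `|t - T| <= eta -> d0 <= q * db t) /\
  forall (t1 : R) (f1 f2 df2 : R -> R), f2 0 = 0 ->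
    (forall t, 0 <= t <= t1 -> [/\ `|f1 t - ca * a t| <= mu, `|f2 t - cb * b t| <= mu,
       derives t f2 (df2 t) & `|df2 t - cb * db t| <= mu]) ->
    (forall t, 0 < t -> t <= t1 -> t <= T - eta -> ~ (0 < f1 t /\ f2 t = 0)) /\
    (t1 = T + eta -> exists2 t0, T - eta <= t0 < T + eta & 0 < f1 t0 /\ f2 t0 = 0)].
Proof.
have [ca' cb'] := orbit_continuous hab.
have [eta [d0 [/andP[eta0 eta1] etaT d00 h0 hT]]] := near_section.
(* [phi] is zero exactly when the orbit lies on the closed positive half-axis, so it has a positive
   minimum away from the endpoints. *)
pose phi t := `|b t| + (`|a t| - a t).
have [phi0 phi00 hphi] : exists2 mu, 0 < mu & forall t, eta <= t <= T - eta -> mu <= phi t.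
  apply: continuous_itv_pos.
    move=> t _; apply: cvgD; first by apply: cvg_norm; exact: cb'.
    by apply: cvgB; [apply: cvg_norm|]; exact: ca'.
  move=> t /andP[t1 t2]; have tT : 0 < t < T by apply/andP; split; lra.
  have := ler_norm (a t); have := normr_ge0 (b t); rewrite /phi.
  have [bt|bt] := eqVneq (b t) 0; last by rewrite -normr_gt0 in bt; lra.
  by have := hleft tT bt; have := normr_ge0 (a t); lra.
have qn : 0 < `|q| by rewrite normr_gt0.
(* [m1] controls the slope of f2 near 0 and its signs at T - eta and T + eta, [m2] excludes
   crossings in the middle, and [m3] keeps f1 positive near [T]. *)
pose m1 := cb * d0 * eta / (2 * `|q|).
pose m2 := phi0 / (2 * (cb^-1 + 2 / ca)).
pose m3 := ca * a 0 / 4.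
have m10 : 0 < m1 by rewrite !mulr_gt0// invr_gt0 mulr_gt0.
have cbca : 0 < cb^-1 + 2 / ca by rewrite addr_gt0 ?invr_gt0// divr_gt0.
have m20 : 0 < m2 by rewrite divr_gt0// mulr_gt0.
have m30 : 0 < m3 by rewrite !mulr_gt0.
exists eta, d0, (Num.min m1 (Num.min m2 m3)); split => //.
- by rewrite eta0.
- by rewrite !lt_min m10 m20.
set mu := Num.min _ _; split; first by move=> t /hT[].
have [lm1 lm2 lm3] : [/\ mu <= m1, mu <= m2 & mu <= m3].
  by rewrite /mu !ge_min !lexx !orbT.
have mu0 : 0 < mu by rewrite !lt_min m10 m20.
have qmu : `|q| * mu <= cb * d0 * eta / 2.
  apply: (@le_trans _ _ (`|q| * m1)); first by rewrite ler_wpM2l.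
  by rewrite /m1 le_eqVlt; apply/orP; left; apply/eqP; field; rewrite gt_eqF.
have cbd : 0 < cb * d0 * eta by rewrite !mulr_gt0.
have cbd1 : cb * d0 * eta <= cb * d0 by rewrite ler_piMr// ltW// mulr_gt0.
move=> t1 f1 f2 df2 f20 hf.
have qclose x y : `|x - cb * y| <= mu -> cb * (q * y) - `|q| * mu <= q * x <= cb * (q * y) +
  `|q| * mu.
  move=> h; have : `|q * x - cb * (q * y)| <= `|q| * mu.
    by rewrite (_ : _ - _ = q * (x - cb * y)); [rewrite normrM ler_wpM2l|ring].
  by rewrite ler_distl.
have start t : 0 < t -> t <= t1 -> t <= eta -> f2 t != 0.
  move=> t0 tt1 te; have D s : 0 <= s <= t -> cb * d0 / 2 <= q * df2 s.
    move=> /andP[s0 st]; have [|_ _ _ h] := hf s; first by rewrite s0 (le_trans st).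
    have [|h1 _] := h0 s; first by rewrite ger0_norm// (le_trans st).
    have /andP[h2 _] := qclose _ _ h.
    have : cb * d0 <= cb * (q * db s) by rewrite ler_pM2l.
    by lra.
  have dq s : 0 <= s <= t -> derives s (fun s => q * f2 s) (q * df2 s).
    move=> /andP[s0 st]; have [|_ _ h _] := hf s; first by rewrite s0 (le_trans st).
    exact: derivesZ.
  have := derive_ge (ltW t0) dq D; rewrite f20 mulr0 !subr0 => h.
  apply/eqP => ft; move: h; rewrite ft mulr0 leNgt => /negP; apply.
  by rewrite !mulr_gt0.
have fpos t : 0 <= t <= t1 -> `|t - T| <= eta -> 0 < f1 t.
  move=> tt ht; have [h _ _ _] := hf t tt; have [_ h2] := hT t ht.
  have : ca * (a 0 / 2) <= ca * a t by rewrite ler_pM2l.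
  by move: h; rewrite ler_norml => /andP[h3 _]; move: lm3 m30; rewrite /m3; lra.
split.
  move=> t t0 tt1 tT [f1t f2t].
  case: (leP t eta) => te; first by move/eqP : (start t t0 tt1 te); apply.
  have [|h1 h2 _ _] := hf t; first by rewrite ltW.
  have := hphi t; rewrite (ltW te) tT => /(_ isT).
  rewrite leNgt => /negP; apply.
  have k1 : `|b t| <= mu / cb.
    rewrite ler_pdivlMr// mulrC -[cb]gtr0_norm// -normrM.
    by move: h2; rewrite f2t sub0r normrN.
  have k2 : - a t <= mu / ca.
    rewrite ler_pdivlMr// mulrC; move: h1; rewrite ler_norml => /andP[_ h3]; lra.
  have k3 : `|a t| - a t <= 2 * (mu / ca).
    case: (ger0P (a t)) => at0; last by lra.
    by rewrite subrr mulr_ge0// divr_ge0 ?ltW.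
  have m2e : m2 * (cb^-1 + 2 / ca) = phi0 / 2.
    by rewrite /m2 invfM mulrA -mulrA mulVf ?mulr1// gt_eqF.
  have : mu * (cb^-1 + 2 / ca) <= phi0 / 2 by rewrite -m2e ler_wpM2r// ltW.
  have -> : mu * (cb^-1 + 2 / ca) = mu / cb + 2 * (mu / ca) by ring.
  by rewrite /phi; lra.
move=> t1E.
have bq t : `|t - T| <= eta -> (T <= t -> d0 * (t - T) <= q * b t) /\ (t <= T -> q * b t <=
  - (d0 * (T - t))).
  move=> ht; have bT : b T = 0 by have [_] := abT 0; rewrite add0r b0.
  have dq s : derives s (fun s => q * b s) (q * db s).
    by have [_ h] := hab s; apply: derives_val (derivesZ q h) _; rewrite mul1r.
  split=> tT.
    have := @derive_ge R _ _ T t d0 tT (fun s _ => dq s); rewrite bT mulr0 subr0;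
      apply=> s /andP[s1 s2].
    have [] // := hT s; rewrite ger0_norm ?subr_ge0//; apply: le_trans ht.
    by apply: le_trans (ler_norm _); rewrite lerD2r.
  have := @derive_ge R _ _ t T d0 tT (fun s _ => dq s); rewrite bT mulr0 sub0r lerNr;
    apply=> s /andP[s1 s2].
  have [] // := hT s; rewrite distrC ger0_norm ?subr_ge0//; apply: le_trans ht.
  by rewrite distrC; apply: le_trans (ler_norm _); rewrite lerD2l lerN2.
have etaT' : eta <= T.
  by apply: le_trans (ltW etaT) _; rewrite ler_pdivrMr// ler_pMr// ler1n.
have Nee : - eta <= eta by apply: le_trans (ltW eta0); rewrite oppr_le0 ltW.
have tm : 0 <= T - eta <= t1 by rewrite t1E subr_ge0 etaT' lerD2l.
have tp : 0 <= T + eta <= t1 by rewrite t1E lexx andbT addr_ge0// ltW.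
have nm : `|T - eta - T| <= eta by rewrite addrAC subrr add0r normrN gtr0_norm.
have np : `|T + eta - T| <= eta by rewrite addrAC subrr add0r gtr0_norm.
have negm : q * f2 (T - eta) < 0.
  have [_ h _ _] := hf _ tm; have /andP[_ h2] := qclose _ _ h.
  have [_ h3] := bq _ nm.
  have h4 : q * b (T - eta) <= - (d0 * eta).
    by rewrite -[X in d0 * X](_ : T - (T - eta) = eta); [apply: h3; rewrite gerBl ltW|ring].
  have : cb * (q * b (T - eta)) <= cb * (- (d0 * eta)) by rewrite ler_pM2l.
  lra.
have posp : 0 < q * f2 (T + eta).
  have [_ h _ _] := hf _ tp; have /andP[h2 _] := qclose _ _ h.
  have [h3 _] := bq _ np.
  have h4 : d0 * eta <= q * b (T + eta).
    by rewrite -[X in d0 * X](_ : T + eta - T = eta); [apply: h3; rewrite lerDl ltW|ring].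
  have : cb * (d0 * eta) <= cb * (q * b (T + eta)) by rewrite ler_pM2l.
  lra.
have [|||| t0 /andP[t01 t02] /eqP] := @ivt_zero R (fun t => q * f2 t) (T - eta) (T + eta).
- by rewrite lerD2l.
- move=> t; rewrite in_itv/= => /andP[ta tb]; apply: cvgM; first exact: cvg_cst.
  have [|_ _ h _] := hf t.
    by rewrite t1E tb andbT (le_trans _ ta)// subr_ge0.
  exact: derives_continuous h.
- exact: ltW.
- exact: ltW.
rewrite mulf_eq0 (negbTE Q0) /= => /eqP f2t0.
have t0lt : t0 < T + eta.
  rewrite lt_def t02 andbT; apply/eqP => e; move: posp; rewrite e f2t0 mulr0 ltxx.
  by [].
exists t0; first by rewrite t01.
split => //; apply: fpos.
  by rewrite t1E t02 andbT (le_trans _ t01)// subr_ge0.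
by rewrite ler_distl t01 t02.
Qed.

End return_geometry.

(** * Location and size of the first return *)

Section return_estimate.
Variables (R : realType) (s1 s2 m n k : nat) (P Q : {poly {poly R}}) (p q : nat ->
  {poly {poly R}}).
Variables (a b : R -> R) (T : R).
Hypotheses (s1_gt0 : (0 < s1)%N) (s2_gt0 : (0 < s2)%N).
Hypothesis hqh : quasi_homogeneous s1 s2 m P Q.
Hypotheses (hp : analytic_perturbation p) (hq : analytic_perturbation q).
Hypothesis hpn : forall i, (1 <= i)%N -> total_degree_le n (p i).
Hypothesis hqn : forall i, (1 <= i)%N -> total_degree_le n (q i).
Hypothesis T0 : 0 < T.
Hypotheses (a0 : a 0 = section_param s1 s2 1) (b0 : b 0 = 0).
Hypothesis hab : forall t, integral_curve P Q (fun=> 1) a b t.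
Hypothesis abT : forall t, a (t + T) = a t /\ b (t + T) = b t.
Hypothesis hw : forall t, wedge s1 s2 P Q a b t != 0.
Hypothesis hleft : forall t, 0 < t < T -> b t = 0 -> a t < 0.

Let al eps t r := alpha (mexp s1 s2 m (n := n)) (mcoef (n :=
  n) p q) k (mradial s1 s2 P Q a b (n := n)) eps t r.
Let be eps t r := alpha (mexp s1 s2 m (n := n)) (mcoef (n :=
  n) p q) k (mangular s1 s2 P Q a b (n := n)) eps t r.

Lemma section_param_ex (h : R) : 0 < h -> section_param s1 s2 h = a 0 * ex s1 (ln h).
Proof. by move=> h0; rewrite a0 exn lnK// /section_param expr1n mulr1. Qed.

Lemma ex_le (s : nat) (x y : R) : x <= y -> ex s x <= ex s y.
Proof. by move=> xy; rewrite ler_expR ler_wpM2l// ler0n. Qed.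

(** The exponential expands distances by at least [l] where it is at least [l], so its inverse
    contracts; the estimate e^v >= 1 + v is enough. *)
Lemma ex_inverse_lipschitz (s : nat) (l x y : R) : (0 < s)%N -> 0 < l ->
  l <= ex s x -> l <= ex s y -> `|x - y| <= `|ex s x - ex s y| / l.
Proof.
move=> s0 l0; wlog xy : x y / x <= y => [H lx ly|lx ly].
  case/orP: (le_total x y) => h; first exact: H.
  by rewrite distrC [X in _ <= X / _]distrC; exact: H.
rewrite distrC ger0_norm ?subr_ge0// distrC ger0_norm ?subr_ge0 ?ex_le//.
rewrite ler_pdivlMr//.
have -> : ex s y = ex s x * ex s (y - x).
  by rewrite /ex -expRD -mulrDr addrC subrK.
have h1 : 1 + (y - x) <= ex s (y - x).
  apply: le_trans (expR_ge1Dx _); rewrite lerD2l -[leLHS]mul1r ler_wpM2r ?subr_ge0//.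
  by rewrite -pmulrn ler1n.
have h2 : ex s x * (1 + (y - x)) <= ex s x * ex s (y - x) by rewrite ler_pM2l ?ex_gt0.
have h3 : l * (y - x) <= ex s x * (y - x) by rewrite ler_wpM2r// subr_ge0.
rewrite mulrC; apply: le_trans h3 _; rewrite mulrDr mulr1 in h2.
by rewrite lerBrDr addrC.
Qed.

Lemma return_estimate (h : R) : 0 < h -> exists C e1, [/\ 0 < C, 0 < e1, e1 <= 1 &
  forall eps, `|eps| <= e1 ->
  exists u du : R -> R, [/\ u 0 = ln h,
    forall t, 0 <= t <= T -> [/\ derives t u (du t), `|u t - ln h| <= 1 &
      `|du t - al eps t (u t) / (1 + be eps t (u t))| <= C * `|eps| ^+ k.+1] &
    forall h', first_return s1 s2 (perturbed_field P Q p q eps) h h' ->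
      `|ln h' - ln h| <= 1 /\ `|ln h' - u T| <= C * `|eps| ^+ k.+1]].
Proof.
move=> h0; pose r0 := ln h.
have A0 : 0 < a 0 by rewrite a0 section_param_gt0.
(* Tracking runs up to T + 1 because the return may occur as late as T + eta, with eta <= 1. *)
have S0 : 0 <= T + 1 by apply: addr_ge0 => //; exact: ltW.
have [C [e1 [C0 e10 e11 htrack]]] :=
  tracking k s1_gt0 s2_gt0 hqh hp hq hpn hqn T0 hab abT hw r0 S0.
have ca0 : 0 < ex s1 r0 := ex_gt0 s1 r0.
have cb0 : 0 < ex s2 r0 := ex_gt0 s2 r0.
have Q0 : Q.[a 0, b 0] != 0.
  have := hw 0; rewrite /wedge b0 mulr0 mul0r subr0.
  by rewrite mulf_eq0 negb_or => /andP[].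
have [eta [d0 [mu [/andP[eta0 eta1] etaT d00 mu0 [hd hgeo]]]]] :=
  return_geometry T0 ca0 cb0 hab abT A0 b0 Q0 hleft.
set qq := Q.[a 0, b 0] in Q0 hd.
have qn : 0 < `|qq| by rewrite normr_gt0.
have [D D0 hD] := @periodic_bounded R (fun t => P.[a t, b t]) T T0
  (@orbit_field_continuous R P Q a b hab P) (fun t => ltac:(by have [-> ->] := abT t)).
have [N N0 hN] := @tame_ex R setT r0 s1.
pose l1 := ex s1 (r0 - 1) : R; pose l2 := ex s2 (r0 - 1) : R.
have l10 : 0 < l1 := ex_gt0 _ _.
have l20 : 0 < l2 := ex_gt0 _ _.
(* [C1] bounds the error in the return time, [C2] the error in the x-coordinate at the return;
   dividing by [a 0] gives [C3], and taking logarithms gives [C4]. *)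
pose C1 := `|qq| * (C / l2) / d0.
have C10 : 0 < C1 by rewrite divr_gt0// mulr_gt0// divr_gt0.
pose C2 := C + (N * (D * C1) + a 0 * (N * (C * C1))).
have C20 : 0 < C2.
  have p1 : 0 < N * (D * C1) by apply: mulr_gt0 => //; exact: mulr_gt0.
  have p2 : 0 < N * (C * C1) by apply: mulr_gt0 => //; exact: mulr_gt0.
  by apply: addr_gt0 => //; apply: addr_gt0 => //; exact: mulr_gt0.
pose C3 := C2 / a 0.
have C30 : 0 < C3 by rewrite divr_gt0.
pose C4 := C3 / (l1 / 2).
have C40 : 0 < C4 by rewrite divr_gt0// divr_gt0.
(* The three bounds ensure closeness within [mu], a lower bound l1/2 for e^(s1 r') before logarithms
   are compared, and |ln h' - ln h| <= 1. *)
pose bound := Num.min (Num.min (mu / C) (l1 / 2 / C3)) (1 + (C4 + C))^-1.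
have CC : 0 < C4 + C by rewrite addr_gt0.
exists (C4 + C), (Num.min e1 bound); split => //.
- by rewrite !lt_min e10 divr_gt0//= divr_gt0 ?divr_gt0//= invr_gt0 addr_gt0.
- by rewrite ge_min e11.
move=> eps; rewrite !le_min => /andP[ee1 /andP[/andP[em el] ec]].
have eps0 := normr_ge0 eps.
have eps1 : `|eps| <= 1 by exact: le_trans e11.
pose E := `|eps| ^+ k.+1.
have E0 : 0 <= E by rewrite exprn_ge0.
have Eeps : E <= `|eps| by rewrite /E -[leRHS]expr1 ler_wiXn2l.
have [u [du [tau [kappa [[u0 tau0 hu htau kp] hS hg]]]]] := htrack eps ee1.
have tauS s t : s < t -> tau s < tau t.
  move=> st; have [c _ e] := mean_value (ltW st) (fun x _ => htau x).
  by rewrite -subr_gt0 e mulr_gt0// subr_gt0.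
have CE t : C * `|eps| ^+ t <= (C4 +
  C) * `|eps| ^+ t by rewrite ler_wpM2r ?exprn_ge0// lerDr ltW.
exists u, du; split => //.
  move=> t /andP[t0 tT]; have [|x1 _ _ x4] := hS t.
    by rewrite t0 (le_trans tT)// lerDl.
  by split => //; apply: le_trans x4 _; exact: CE.
move=> h' [h'0 [Tg [g [Tg0 gsol g0 gT gcross]]]].
have g0' : g 0 = (ex s1 r0 * a 0, ex s2 r0 * b 0).
  by rewrite g0 section_param_ex// b0 mulr0 mulrC.
have Cmu : C * `|eps| <= mu by rewrite mulrC -ler_pdivlMr.
pose f1 t := (g (tau t)).1; pose f2 t := (g (tau t)).2.
have step t1 : 0 <= t1 <= T + eta -> tau t1 <= Tg ->
    (forall t, 0 < t -> t <= t1 -> t <= T - eta -> ~ (0 < f1 t /\ f2 t = 0)) /\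
    (t1 = T + eta -> exists2 t0, T - eta <= t0 < T + eta & 0 < f1 t0 /\ f2 t0 = 0).
  move=> /andP[t10 t1T] tau1.
  have t1S : 0 <= t1 <= T + 1 by rewrite t10 (le_trans t1T)// lerD2l.
  have htr := hg Tg g gsol g0' t1 t1S tau1.
  have /choice[df2 hdf2] : forall t, exists d, 0 <= t <= t1 ->
      derives t f2 d /\ `|d - ex s2 r0 * Q.[a t, b t]| <= C * `|eps|.
    move=> t; case tt: (0 <= t <= t1); last by exists 0.
    by have [_ _ [d h1 h2]] := htr t tt; exists d.
  apply: (hgeo t1 f1 f2 df2).
    by rewrite /f2 tau0 g0'/= b0 mulr0.
  move=> t tt; have [_ [x1 x2] _] := htr t tt; have [h1 h2] := hdf2 t tt.
  by split => //; apply: le_trans Cmu.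
have TE0 : 0 <= T + eta by rewrite addr_ge0// ltW.
(* If the orbit lasted until [tau (T + eta)], it would cross the half-axis strictly before [Tg],
   contrary to [Tg] being the first return time. *)
have [tauT|tauT] := leP (tau (T + eta)) Tg.
  have [|_ /(_ erefl)[t0 /andP[t01 t02] [ft1 ft2]]] := step (T + eta) _ tauT.
    by rewrite TE0 lexx.
  exfalso; apply: (gcross (tau t0)) => //.
  rewrite -[X in X < _]tau0 tauS; last first.
    apply: lt_le_trans t01; rewrite subr_gt0; apply: lt_le_trans etaT _.
    by rewrite ler_pdivrMr// ler_pMr// ler1n.
  exact: lt_le_trans (tauS _ _ t02) tauT.
have [||| ts /andP[ts0 tsT] /eqP] := @ivt_zero R (fun t => tau t - Tg) 0 (T + eta) TE0.
- move=> t _; apply: cvgB; last exact: cvg_cst.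
  exact: derives_continuous (htau t).
- by rewrite tau0 sub0r oppr_le0 ltW.
- by rewrite subr_ge0 ltW.
rewrite subr_eq0 => /eqP tauts.
have tsp : 0 < ts.
  rewrite lt_def ts0 andbT; apply/eqP => e; move: Tg0; rewrite -tauts e tau0.
  by rewrite ltxx.
have tsdom : 0 <= ts <= T + eta by rewrite ts0.
have tsS : 0 <= ts <= T + 1 by rewrite ts0 (le_trans tsT)// lerD2l.
have tauTs : tau ts <= Tg by rewrite tauts.
have fts : f1 ts = section_param s1 s2 h' /\ f2 ts = 0 by rewrite /f1 /f2 tauts gT.
(* [ts] is the return time in the variable t; a crossing before T - eta is excluded, so it lies
   within [eta] of [T]. *)
have [no _] := step ts tsdom tauTs.
have tsn : `|ts - T| <= eta.
  rewrite ler_norml; apply/andP; split; last by rewrite lerBlDl.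
  rewrite leNgt; apply/negP => hh; apply: (no ts tsp (lexx _)).
    by move: hh; rewrite ltrBlDr addrC => /ltW.
  by have [-> ->] := fts; split => //; exact: section_param_gt0.
have [|[y1 y2] _ _] := hg Tg g gsol g0' ts tsS tauTs ts.
  by rewrite ts0 lexx.
rewrite -/(f1 ts) -/(f2 ts) in y1 y2.
rewrite (proj1 fts) in y1; rewrite (proj2 fts) in y2.
have [uts _ dub _] := hS ts tsS.
have TS : 0 <= T <= T + 1 by rewrite lerDl ler01 ltW.
have [uT1 uT2 _ _] := hS T TS.
(* At the return the second coordinate vanishes exactly, so b(ts) has order eps^(k+1);
   transversality then gives the same order for ts - T. *)
have bts : `|b ts| <= C / l2 * E.
  have : l2 * `|b ts| <= C * E.
    apply: le_trans y2; rewrite sub0r normrN normrM (gtr0_norm (ex_gt0 _ _)) ler_wpM2r//.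
    by apply: ex_le; move: uts; rewrite ler_norml lerBrDr addrC => /andP[].
  by rewrite mulrAC ler_pdivlMr// mulrC.
have bT : b T = 0 by have [_] := abT 0; rewrite add0r b0.
have tsT1 : `|ts - T| <= C1 * E.
  have dq s : derives s (fun s => qq * b s) (qq * Q.[a s, b s]).
    by have [_ hh] := hab s; apply: derives_val (derivesZ qq hh) _; rewrite mul1r.
  have key : d0 * `|ts - T| <= `|qq * b ts|.
    case/orP: (le_total T ts) => tsT'.
      rewrite ger0_norm ?subr_ge0//; apply: le_trans (ler_norm _).
      have := @derive_ge R _ _ T ts d0 tsT' (fun s _ => dq s); rewrite bT mulr0 subr0;
        apply=> s /andP[q1 q2].
      apply: hd; rewrite ger0_norm ?subr_ge0//; apply: le_trans tsn.
      by apply: le_trans (ler_norm _); rewrite lerD2r.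
    rewrite distrC ger0_norm ?subr_ge0// -normrN; apply: le_trans (ler_norm _).
    have := @derive_ge R _ _ ts T d0 tsT' (fun s _ => dq s); rewrite bT mulr0 sub0r;
      apply=> s /andP[q1 q2].
    apply: hd; rewrite distrC ger0_norm ?subr_ge0//; apply: le_trans tsn.
    by rewrite distrC; apply: le_trans (ler_norm _); rewrite lerD2l lerN2.
  have : `|qq * b ts| <= `|qq| * (C / l2 * E) by rewrite normrM ler_wpM2l.
  move=> /(le_trans key); rewrite mulrC -ler_pdivlMr// => hh; apply: le_trans hh _.
  by rewrite le_eqVlt; apply/orP; left; apply/eqP; rewrite /C1; ring.
have lip (f df : R -> R) M : (forall s : R, derives s f (df s)) ->
    (forall s, 0 <= s <= T + 1 -> `|df s| <= M) -> `|f ts - f T| <= M * `|ts - T|.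
  move=> hf hM; case/andP: tsS => ts1 ts2; case/orP: (le_total T ts) => tt.
    rewrite (ger0_norm (x := ts - T)) ?subr_ge0//; apply: derive_bound tt (fun s _ => hf s) _.
    by move=> s /andP[q1 q2]; apply: hM; rewrite (le_trans (ltW T0) q1) (le_trans q2).
  rewrite distrC [X in _ * X]distrC (ger0_norm (x := T - ts)) ?subr_ge0//.
  apply: derive_bound tt (fun s _ => hf s) _.
  move=> s /andP[q1 q2]; apply: hM; rewrite (le_trans ts1 q1) (le_trans q2)//.
  by rewrite lerDl.
have aT : a T = a 0 by have [] := abT 0; rewrite add0r.
have ats : `|a ts - a 0| <= D * (C1 * E).
  rewrite -aT; apply: (@le_trans _ _ (D * `|ts - T|)); last by rewrite ler_wpM2l// ltW.
  apply: (lip a (fun s => 1 * P.[a s, b s])); first by move=> s; have [] := hab s.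
  by move=> s _; rewrite mul1r.
have udiff : `|u ts - u T| <= C * (C1 * E).
  apply: (@le_trans _ _ (C * `|ts - T|)); last by rewrite ler_wpM2l// ltW.
  by apply: (lip u du C hu) => s /hS[].
have [exN exL] := hN 0 (u ts) (u T) I uts uT1.
pose r' := ln h'.
have main : `|ex s1 r' - ex s1 (u T)| <= C3 * E.
  rewrite /C3 mulrAC ler_pdivlMr//.
  rewrite -[X in _ * X <= _](gtr0_norm A0) -normrM mulrC mulrBr.
  have -> : a 0 * ex s1 r' - a 0 * ex s1 (u T) =
    (section_param s1 s2 h' - ex s1 (u ts) * a ts) +
    (ex s1 (u ts) * (a ts - a 0) + a 0 * (ex s1 (u ts) - ex s1 (u T))).
    by rewrite section_param_ex//; ring.
  rewrite /C2 !mulrDl; apply: le_trans (ler_normD _ _) _; apply: lerD => //.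
  apply: le_trans (ler_normD _ _) _; apply: lerD; rewrite normrM.
    by rewrite -[leRHS]mulrA -[X in _ <= _ * X]mulrA; apply: ler_pM; rewrite ?normr_ge0.
  rewrite (gtr0_norm A0) -[leRHS]mulrA ler_wpM2l ?(ltW A0)//.
  rewrite -[leRHS]mulrA -[X in _ <= _ * X]mulrA.
  by apply: le_trans exL _; rewrite ler_wpM2l// ltW.
have l1u : l1 <= ex s1 (u T).
  by apply: ex_le; move: uT1; rewrite ler_norml lerBrDr addrC => /andP[].
have C3E : C3 * E <= l1 / 2.
  apply: (@le_trans _ _ (C3 * `|eps|)); first by rewrite ler_wpM2l// ltW.
  by rewrite mulrC -ler_pdivlMr.
have l1r : l1 / 2 <= ex s1 r'.
  move: (le_trans main C3E); rewrite ler_distl => /andP[q1 _].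
  by apply: le_trans q1; rewrite lerBrDr -splitr.
have l1u2 : l1 / 2 <= ex s1 (u T).
  by apply: le_trans l1u; rewrite ler_pdivrMr// ler_pMr// ler1n.
have l12 : 0 < l1 / 2 by rewrite divr_gt0.
have fin : `|r' - u T| <= C4 * E.
  apply: le_trans (ex_inverse_lipschitz s1_gt0 l12 l1r l1u2) _.
  by rewrite /C4 mulrAC ler_wpM2r// invr_ge0 ltW.
split; last by apply: le_trans fin _; rewrite ler_wpM2r// lerDl ltW.
have -> : ln h' - ln h = (r' - u T) + (u T - ln h) by rewrite /r'; ring.
apply: le_trans (ler_normD _ _) _.
apply: (@le_trans _ _ ((C4 + C) * `|eps|)).
  rewrite mulrDl; apply: lerD => //; apply: le_trans fin _.
  by rewrite ler_wpM2l// ltW.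
have : (1 + (C4 + C)) * `|eps| <= 1.
  by rewrite mulrC -ler_pdivlMr ?mul1r// addr_gt0.
by apply: le_trans; rewrite ler_wpM2r// lerDr ler01.
Qed.

End return_estimate.

(** * Melnikov functions *)

Section taylor.
Variable R : realType.

Lemma taylor_coefficients_vanish (c : nat -> R) (k : nat) (C e1 : R) : 0 < e1 ->
  (forall e, `|e| <= e1 -> `|\sum_(1 <= i < k.+1) e ^+ i * c i| <= C * `|e| ^+ k.+1) ->
  forall i, (1 <= i <= k)%N -> c i = 0.
Proof.
move=> e10 h; elim/ltn_ind => i IH /andP[i1 ik].
pose S := \sum_(i.+1 <= j < k.+1) `|c j|.
have S0 : 0 <= S by apply: sumr_ge0.
have [//|ci] := eqVneq (c i) 0; exfalso.
pose x := `|c i|; have x0 : 0 < x by rewrite normr_gt0.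
(* The summand 1 yields the contradiction: with e <= x / M, the lowest coefficient would satisfy x
   <= (M - 1) e < M e <= x. *)
pose M := `|C| + S + 1.
have M0 : 0 < M by rewrite /M; have := normr_ge0 C; lra.
pose e := Num.min (Num.min e1 1) (x / M).
have e0 : 0 < e by rewrite !lt_min e10 ltr01 divr_gt0.
have [l1 l2 l3] : [/\ e <= e1, e <= 1 & e <= x / M].
  by rewrite /e !ge_min !lexx !orbT.
have en : `|e| = e by rewrite gtr0_norm.
have := h e; rewrite en => /(_ l1).
rewrite (big_cat_nat _ (n := i)) //=; last by rewrite ltnW.
rewrite big_nat big1 ?add0r; last first.
  by move=> j /andP[j1 ji]; rewrite IH ?mulr0// j1 ltnW// (leq_trans ji).
rewrite big_ltn ?ltnS// => h1.
have h2 : `|\sum_(i.+1 <= j < k.+1) e ^+ j * c j| <= e ^+ i.+1 * S.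
  apply: le_trans (ler_norm_sum _ _ _) _; rewrite /S big_distrr /=.
  rewrite big_nat [leRHS]big_nat; apply: ler_sum => j /andP[ij _].
  by rewrite normrM normrX en ler_wpM2r// ler_wiXn2l// ltW.
have h3 : C * e ^+ k.+1 <= `|C| * e ^+ i.+1.
  apply: (@le_trans _ _ (`|C| * e ^+ k.+1)).
    by rewrite ler_wpM2r ?ler_norm// exprn_ge0// ltW.
  by rewrite ler_wpM2l// ler_wiXn2l// ltW.
have h4 : e ^+ i * x <= (`|C| + S) * e ^+ i.+1.
  have -> : e ^+ i * x = `|e ^+ i * c i| by rewrite normrM normrX en.
  move: h1 h2; set t := \sum_(_ <= _ < _) _ => h1 h2.
  have -> : e ^+ i * c i = (e ^+ i * c i + t) - t by ring.
  apply: le_trans (ler_normB _ _) _; rewrite mulrDl [S * _]mulrC.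
  by apply: lerD => //; exact: le_trans h1 h3.
have h5 : x <= (`|C| + S) * e.
  by rewrite -(ler_pM2l (exprn_gt0 i e0)) mulrCA -exprSr.
have : M * e <= x by rewrite mulrC -ler_pdivlMr.
by rewrite /M mulrDl mul1r; lra.
Qed.

End taylor.

(** * Increments of the first integral and Melnikov functions *)

Section melnikov.
Variables (R : realType) (s1 s2 m n k : nat) (P Q : {poly {poly R}}) (p q : nat ->
  {poly {poly R}}).
Variable M : nat -> R -> R.
Hypothesis hM : melnikov_functions s1 s2 P Q p q M.

(** At eps = 0 all partial sums of the expansion equal h, so the hypothesis on [M] says that h = 1
    returns to itself. *)
Lemma unperturbed_return : first_return s1 s2 (vector_field P Q) 1 1.
Proof.
have [||e0 e00 he] := hM (K := [set 1]).
- exact: compact_set1.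
- by move=> _ ->; exact: ltr01.
have [||h' hr hl] := he 1 0; [by []|by rewrite normr0|].
have sum0 (f : nat -> R) N : \sum_(1 <= i < N) 0 ^+ i * f i = 0.
  rewrite big_nat big1// => i /andP[i1 _].
  by rewrite expr0n eqn0Ngt i1 mul0r.
have h'1 : h' = 1.
  have hl1 : (fun N => (1 : R) + \sum_(1 <= i < N) 0 ^+ i * M i 1) @ \oo --> (1 : R).
    under [fun N => _]funext do rewrite sum0 addr0.
    exact: cvg_cst.
  exact: cvg_unique hl hl1.
have <- : perturbed_field P Q p q 0 = vector_field P Q; last by move: hr; rewrite h'1.
apply/funext => z; rewrite /vector_field /perturbed_field; congr (_, _).
  by under [fun N => _]funext do rewrite sum0; rewrite lim_cst ?addr0.
by under [fun N => _]funext do rewrite sum0; rewrite lim_cst ?addr0.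
Qed.

Hypothesis hk : forall i, (1 <= i < k)%N -> forall h, 0 < h -> M i h = 0.
Hypothesis k1 : (1 <= k)%N.

Lemma return_map_expansion (h : R) : 0 < h -> exists C e1, [/\ 0 < C, 0 < e1 &
  forall eps, `|eps| <= e1 -> exists2 h',
    first_return s1 s2 (perturbed_field P Q p q eps) h h' &
    `|h' - h - eps ^+ k * M k h| <= C * `|eps| ^+ k.+1].
Proof.
move=> h0.
have [||e0 e00 he] := hM (K := [set h]).
- exact: compact_set1.
- by move=> _ ->.
pose r := e0 / 2.
have r0 : 0 < r by rewrite divr_gt0.
have cv eps h' : (fun N => h + \sum_(1 <= i < N) eps ^+ i * M i h) @ \oo --> h' ->
    (fun N => \sum_(1 <= i < N) eps ^+ i * M i h) @ \oo --> h' - h.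
  move=> hl; have -> : (fun N => \sum_(1 <= i < N) eps ^+ i * M i h) =
      (fun N => (h + \sum_(1 <= i < N) eps ^+ i * M i h) - h).
    by apply/funext => N; ring.
  by apply: cvgB => //; exact: cvg_cst.
have [C C0 hC] : exists2 C, 0 < C & forall e l : R, `|e| <= r / 2 ->
    (fun N => \sum_(1 <= i < N) e ^+ i * M i h) @ \oo --> l ->
    `|l - \sum_(1 <= i < k.+1) e ^+ i * M i h| <= C * `|e| ^+ k.+1.
  apply: power_series_limit => //.
  have [||h' _ /cv hl] := he h r; [by []|by rewrite gtr0_norm// /r; lra|].
  exact: cvgP hl.
exists C, (r / 2); split => //; first by rewrite divr_gt0.
move=> eps heps; have [||h' hr /cv hl] := he h eps; [by []|by rewrite /r in heps; lra|].
exists h' => //; have := hC eps _ heps hl.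
rewrite big_nat_recr//= [X in _ - (X + _)]big_nat big1 ?add0r// => i ik.
by rewrite hk ?mulr0.
Qed.

Variables (a b : R -> R) (T : R).
Hypotheses (s1_gt0 : (0 < s1)%N) (s2_gt0 : (0 < s2)%N).
Hypothesis hqh : quasi_homogeneous s1 s2 m P Q.
Hypotheses (hp : analytic_perturbation p) (hq : analytic_perturbation q).
Hypothesis hpn : forall i, (1 <= i)%N -> total_degree_le n (p i).
Hypothesis hqn : forall i, (1 <= i)%N -> total_degree_le n (q i).
Hypothesis T0 : 0 < T.
Hypotheses (a0 : a 0 = section_param s1 s2 1) (b0 : b 0 = 0).
Hypothesis hab : forall t, integral_curve P Q (fun=> 1) a b t.
Hypothesis abT : forall t, a (t + T) = a t /\ b (t + T) = b t.
Hypothesis hw : forall t, wedge s1 s2 P Q a b t != 0.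
Hypothesis hleft : forall t, 0 < t < T -> b t = 0 -> a t < 0.

Variables (c dc : nat -> int -> R -> R) (N : nat).
Hypothesis hI : first_integral (mexp s1 s2 m (n := n)) (mradial s1 s2 P Q a b (n := n))
  (mangular s1 s2 P Q a b (n := n)) (mcoef (n := n) p q) k c dc.
Hypothesis hN : forall i d t, (i <= k)%N -> (N < `|d|)%N -> c i d t = 0 /\ dc i d t = 0.
Hypothesis cdc : forall i d, (i <= k)%N -> continuous (dc i d).
Hypothesis c0 : forall d t, c 0%N d t = (d == 1)%:R.
Hypothesis N1 : (1 <= N)%N.

(** Conservation gives J(T, h') = J(0, h) up to order eps^(k+1). The term J_0 = r contributes h' - h
    = eps^k M_k + O(eps^(k+1)), and replacing h' by h in the terms of order at least 1 costs eps
    times eps^k; the coefficients of eps^i are then compared. *)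
Lemma first_integral_melnikov (h : R) : 0 < h ->
  let L i := \sum_(d <- int_box N) (c i d T - c i d 0) * ex d (ln h) in
  (forall i, (1 <= i < k)%N -> L i = 0) /\ L k = - M k h.
Proof.
move=> h0 L; pose r0 := ln h.
have er (x : R) : 0 < x -> ex 1 (ln x) = x.
  by move=> x0; rewrite /ex mul1r lnK.
have [C1 [e1 [C10 e10 hret]]] := return_map_expansion h0.
have [C2 [e2 [C20 e20 e21 hest]]] :=
  return_estimate k s1_gt0 s2_gt0 hqh hp hq hpn hqn T0 a0 b0 hab abT hw hleft h0.
have [C3 [e3 [C30 e30 hcons]]] := formal_conservation hI hN r0 (ltW T0)
  (fun x => mradial_bounded T0 hab abT hw x) (fun x => mangular_bounded T0 hab abT hw x) cdc
    C20.
pose K i (t r : R) := \sum_(d <- int_box N) c i d t * ex d r.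
pose D := [set t : R | 0 <= t <= T].
have tK i : (i <= k)%N -> tame D r0 (K i).
  move=> ik; exact: (tame_formal_value N hI T r0 ik).
have [C4 C40 h4] := tame_power_sum (l := 1) (n := k.+1) (V :=
  K) (fun j hj => tK j (proj2 (andP hj))).
have [C5 C50 h5] := tame_power_sum (l := 0) (n := k.+1) (V :=
  K) (fun j hj => tK j (proj2 (andP hj))).
have fv eps t r : formal_value k c N eps t r = ex 1 r + \sum_(1 <= i < k.+1) eps ^+ i * K i t r.
  rewrite /formal_value big_ltn// expr0 mul1r; congr (_ + _).
  transitivity (\sum_(d <- [:: 1 : int]) (d == 1)%:R * ex d r : R); last first.
    by rewrite big_seq1 eqxx mul1r.
  under eq_bigr do rewrite c0.
  apply: sum_over_support; rewrite ?int_box_uniq// => d.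
  have [->|d1] := eqVneq d 1; last by rewrite mul0r eqxx.
  by rewrite mem_int_box inE eqxx andbT.
pose l := ex 1 (r0 - 1) : R.
have l0 : 0 < l := ex_gt0 _ _.
pose C6 := (C1 + `|M k h|) / l.
have C60 : 0 <= C6.
  by apply: divr_ge0; [apply: addr_ge0 => //; exact: ltW|exact: ltW].
pose g i := L i + (i == k)%:R * M k h.
suff g0 i : (1 <= i <= k)%N -> g i = 0.
  split=> [i /andP[i1 ik]|].
    by have := g0 i; rewrite i1 (ltnW ik) /g (ltn_eqF ik) mul0r addr0; apply.
  have := g0 k; rewrite k1 leqnn => /(_ isT) /eqP.
  by rewrite /g eqxx mul1r addr_eq0 => /eqP.
pose e := Num.min (Num.min e1 e2) (Num.min e3 1).
have e0 : 0 < e by rewrite !lt_min e10 e20 e30 ltr01.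
apply: (@taylor_coefficients_vanish R g k (C3 + C5 * C2 + C1 + C4 * C6) e e0) => eps.
rewrite !le_min => /andP[/andP[ee1 ee2] /andP[ee3 ee4]].
have [h' hr hh'] := hret eps ee1.
have [u [du [u0 hu hest']]] := hest eps ee2.
have [n1 n2] := hest' h' hr.
have h'0 : 0 < h' by case: hr.
have r0r0 : `|r0 - r0| <= 1 by rewrite subrr normr0.
have TT : 0 <= T <= T by rewrite lexx ltW.
have DT : D T by [].
have E0 : 0 <= `|eps| ^+ k.+1 by rewrite exprn_ge0.
have cons := hcons eps u du T ee3 TT hu.
have [_ uT _] := hu T TT.
have [_ lip5] := h5 eps T (ln h') (u T) ee4 DT n1 uT.
have [_ lip4] := h4 eps T (ln h') r0 ee4 DT n1 r0r0.
rewrite expr0 mulr1 in lip5; rewrite expr1 in lip4.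
have A1 : `|formal_value k c N eps T (ln h') - formal_value k c N eps 0 r0| <= (C3 +
  C5 * C2) * `|eps| ^+ k.+1.
  rewrite (_ : _ - _ = (formal_value k c N eps T (u T) - formal_value k c N eps 0 (u 0))
    + (formal_value k c N eps T (ln h') - formal_value k c N eps T (u T)));
      last by rewrite u0; ring.
  rewrite mulrDl; apply: le_trans (ler_normD _ _) _; apply: lerD => //.
  by apply: le_trans lip5 _; rewrite -mulrA ler_wpM2l// ltW.
(* The lower orders of the return map vanish, so h' - h already has order eps^k. *)
have lnh : `|ln h' - r0| <= C6 * `|eps| ^+ k.
  apply: le_trans (ex_inverse_lipschitz (s := 1) isT l0 _ _) _.
  - by apply: ex_le; move: n1; rewrite ler_norml lerBrDr addrC => /andP[].
  - by apply: ex_le; rewrite gerBl.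
  rewrite /C6 mulrAC ler_wpM2r ?invr_ge0 ?(ltW l0)// !er//.
  rewrite (_ : h' - h = (h' - h - eps ^+ k * M k h) + eps ^+ k * M k h); last by ring.
  rewrite mulrDl; apply: le_trans (ler_normD _ _) _; apply: lerD.
    by apply: le_trans hh' _; rewrite ler_wpM2l ?(ltW C10)// exprS ler_piMl ?exprn_ge0.
  by rewrite normrM normrX mulrC.
have sumg : \sum_(1 <= i < k.+1) eps ^+ i * g i =
    (formal_value k c N eps T (ln h') - formal_value k c N eps 0 r0)
    - (h' - h - eps ^+ k * M k h)
    - (\sum_(1 <= i < k.+1) eps ^+ i * K i T (ln h') - \sum_(1 <=
      i < k.+1) eps ^+ i * K i T r0).
  rewrite !fv !er//.
  have -> : \sum_(1 <= i < k.+1) eps ^+ i * g i = \sum_(1 <= i < k.+1) eps ^+ i * K i T r0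
      - \sum_(1 <= i < k.+1) eps ^+ i * K i 0 r0 + eps ^+ k * M k h.
    have -> : eps ^+ k * M k h = \sum_(1 <= i < k.+1) eps ^+ i * ((i == k)%:R * M k h).
      rewrite big_nat_recr//= eqxx mul1r big_nat big1 ?add0r// => j /andP[_ jk].
      by rewrite (ltn_eqF jk) mul0r mulr0.
    rewrite -sumrB -big_split /=; apply: eq_bigr => j _.
    rewrite -mulrBr -mulrDr /g /L /K -sumrB; congr (_ * (_ + _)).
    by apply: eq_bigr => d _; rewrite mulrBl.
  by ring.
rewrite sumg !mulrDl.
apply: le_trans (ler_normB _ _) _; apply: lerD; last first.
  apply: le_trans lip4 _; apply: (@le_trans _ _ (C4 * `|eps| * (C6 * `|eps| ^+ k))).
    by rewrite ler_wpM2l// mulr_ge0// ltW.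
  by rewrite exprS le_eqVlt; apply/orP; left; apply/eqP; ring.
apply: le_trans (ler_normB _ _) _; apply: lerD => //.
by rewrite -mulrDl.
Qed.

End melnikov.

(** * Parity and the number of zeros *)

Section signs.
Variable R : realType.

Lemma exprz_sign (d : int) : (-1) ^ d = (-1) ^+ `|d|%N :> R.
Proof. by case: d => [//|i]; rewrite NegzE -exprz_inv invrN1. Qed.

Lemma exprz_sign_even (d : int) : (2 %| d)%Z -> (-1) ^ d = 1 :> R.
Proof.
move=> hd; rewrite exprz_sign -signr_odd.
have -> : odd `|d|%N = false by apply/negbTE; rewrite -dvdn2.
by [].
Qed.

Lemma exprz_sign_odd (d : int) : ~~ (2 %| d)%Z -> (-1) ^ d = -1 :> R.
Proof.
move=> hd; rewrite exprz_sign -signr_odd.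
have -> : odd `|d|%N by rewrite -[odd _]negbK -dvdn2.
by rewrite expr1.
Qed.

End signs.

(** * Behaviour of the coefficients under the reflection *)

Section reflection.
Variables (R : realType) (s1 s2 m n : nat) (P Q : {poly {poly R}}) (a b : R -> R) (c0 : R).
Hypotheses (s1_gt0 : (0 < s1)%N) (s2_gt0 : (0 < s2)%N).
Hypothesis hqh : quasi_homogeneous s1 s2 m P Q.

Let delta : R := (-1) ^+ m.+1.

Hypothesis hsym : forall t, a (delta * t + c0) = (-1) ^+ s1 * a t /\ b (delta * t + c0) =
  (-1) ^+ s2 * b t.
Hypothesis hdelta : delta = (-1) ^+ (s1 + s2).

Let sq (i : nat) : (-1) ^+ i * (-1) ^+ i = 1 :> R.
Proof. by rewrite -expr2 sqrr_sign. Qed.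

Lemma mexp_sign (x : monomial n) : (-1) ^ (mexp s1 s2 m x) =
  ((-1) ^+ s1) ^+ x.2.1 * ((-1) ^+ s2) ^+ x.2.2 * (-1) ^+ (if x.1 then s1 else s2) * delta.
Proof.
have N1 : -1 != 0 :> R by rewrite oppr_eq0 oner_eq0.
have dm : (-1) ^ (m%:Z - 1) = delta.
  by rewrite /delta expfzDr// exprSr -exprz_inv invrN1.
rewrite /mexp; move: (if x.1 then s1 else s2) => s.
rewrite -[X in _ - X]opprK opprK addrAC -[X in X - _]addrA.
rewrite -dm.
rewrite (_ : _ - _ = x.2.1%:Z * s1%:Z + x.2.2%:Z * s2%:Z - s%:Z - (m%:Z - 1)); last by ring.
have inv z : (-1) ^ (- z) = (-1) ^ z :> R by rewrite -exprz_inv invrN1.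
rewrite expfzDr// expfzDr// expfzDr// !inv.
by rewrite -!PoszM !(mulnC x.2.1, mulnC x.2.2) -!exprnP !exprM.
Qed.

(** The signs of the two coordinates and of the field multiply to 1 because delta = (-1)^(s1 +
    s2). *)
Lemma wedge_reflect t : wedge s1 s2 P Q a b (delta * t + c0) = wedge s1 s2 P Q a b t.
Proof.
have [h1 h2] := hsym t; rewrite /wedge h1 h2.
have [-> ->] := quasi_homogeneous_sign s1_gt0 s2_gt0 hqh (a t) (b t); rewrite -/delta.
have d1 : (-1) ^+ s1 * (-1) ^+ s2 * delta = 1 :> R by rewrite hdelta exprD mulrACA !sq mulr1.
transitivity ((-1) ^+ s1 * (-1) ^+ s2 * delta * wedge s1 s2 P Q a b t).
  by rewrite /wedge; ring.
by rewrite d1 mul1r.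
Qed.

Lemma mradial_reflect (x : monomial n) t :
  mradial s1 s2 P Q a b x (delta * t + c0) =
  delta * (-1) ^ (mexp s1 s2 m x) * mradial s1 s2 P Q a b x t.
Proof.
have [h1 h2] := hsym t; rewrite /mradial wedge_reflect h1 h2 mexp_sign.
have [-> ->] := quasi_homogeneous_sign s1_gt0 s2_gt0 hqh (a t) (b t); rewrite -/delta.
have dd : delta * delta = 1 by exact: sq.
have d1 : (-1) ^+ s1 * delta = (-1) ^+ s2 by rewrite hdelta exprD mulrA sq mul1r.
have d2 : (-1) ^+ s2 * delta = (-1) ^+ s1 by rewrite hdelta exprD mulrCA sq mulr1.
rewrite !exprMn; set u := ((-1) ^+ s1) ^+ x.2.1; set v := ((-1) ^+ s2) ^+ x.2.2.
case: (x.1).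
  transitivity (delta * delta * (u * v * ((-1) ^+ s2 * delta) *
    (a t ^+ x.2.1 * b t ^+ x.2.2 * Q.[a t, b t] / wedge s1 s2 P Q a b t))).
    by rewrite dd mul1r; ring.
  by rewrite d2; ring.
transitivity (delta * delta * (u * v * ((-1) ^+ s1 * delta) *
  (a t ^+ x.2.1 * b t ^+ x.2.2 * - P.[a t, b t] / wedge s1 s2 P Q a b t))).
  by rewrite dd mul1r; ring.
by rewrite d1; ring.
Qed.

Lemma mangular_reflect (x : monomial n) t :
  mangular s1 s2 P Q a b x (delta * t + c0) =
  (-1) ^ (mexp s1 s2 m x) * mangular s1 s2 P Q a b x t.
Proof.
have [h1 h2] := hsym t; rewrite /mangular wedge_reflect h1 h2 mexp_sign.
have d1 : (-1) ^+ s1 * delta = (-1) ^+ s2 by rewrite hdelta exprD mulrA sq mul1r.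
have d2 : (-1) ^+ s2 * delta = (-1) ^+ s1 by rewrite hdelta exprD mulrCA sq mulr1.
rewrite !exprMn; case: (x.1).
  by rewrite -[in RHS]mulrA d1; ring.
by rewrite -[in RHS]mulrA d2; ring.
Qed.

End reflection.

(** * Exponents produced at each order *)

Section exponents.
Variables (R : realType) (s1 s2 m n k : nat) (p q : nat -> {poly {poly R}}).
Hypothesis hpn : forall i, (1 <= i)%N -> total_degree_le n (p i).
Hypothesis hqn : forall i, (1 <= i)%N -> total_degree_le n (q i).

(* exponent_set at order 0 is empty, whereas the constant term 1 of a first integral
   divided by r has exponent 0. *)
Definition order_exponents (i : nat) (z : int) : Prop :=
  if i is 0%N then z = 0 else exponent_set s1 s2 m n.+1 i z.

(** The exponent of a monomial subtracts the weight of its own component only; raising the power of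
    the other variable by one makes it an element of S with l = 1 and total degree between 1 and n +
    1. Adding it raises l by one, which is allowed because at least one order in eps is consumed. *)
Lemma order_exponents_step (i j : nat) (x : monomial n) (z : int) : (1 <= j <= i)%N ->
  mcoef p q j x != 0 -> order_exponents (i - j) z -> order_exponents i (z + mexp s1 s2 m x).
Proof.
move=> /andP[j1 ji] mx hz.
have deg : (x.2.1 + x.2.2 <= n)%N.
  rewrite leqNgt; apply/negP => h; move: mx; rewrite /mcoef.
  by case: (x.1); rewrite ?hpn ?hqn ?eqxx.
have [i' [j' [ij' eij]]] : exists i' j' : nat, (1 <= i' + j' <= n.+1)%N /\
    mexp s1 s2 m x = i'%:Z * s1%:Z + j'%:Z * s2%:Z - (s1%:Z + s2%:Z + m%:Z - 1).
  have i1 (u v : nat) (A B C : int) : u%:Z * A + v%:Z * B - A - C = u%:Z * A +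
    v.+1%:Z * B - (A + B + C).
    by rewrite intS; ring.
  have i2 (u v : nat) (A B C : int) : u%:Z * A + v%:Z * B - B - C = u.+1%:Z * A +
    v%:Z * B - (A + B + C).
    by rewrite intS; ring.
  rewrite /mexp; case: (x.1).
    exists x.2.1, x.2.2.+1; split; first by rewrite addnS.
    by rewrite i1 addrA.
  exists x.2.1.+1, x.2.2; split; first by rewrite addSn.
  by rewrite i2 addrA.
case: i ji hz => [|i] ji; first by move: j1 ji; lia.
have hle : (i.+1 - j <= i)%N by lia.
case: (i.+1 - j)%N hle => [|l0] hl /=.
  move=> ->; rewrite add0r; exists i', j', 1%N; split; rewrite ?mul1n ?mul1r//.
move=> [i2 [j2 [l2 [h1 h2 ->]]]].
exists (i2 + i')%N, (j2 + j')%N, (l2 + 1)%N; split.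
- by rewrite mulnDl mul1n; lia.
- by lia.
by rewrite eij !PoszD; ring.
Qed.

Lemma exponent_set_bounded : exists N0 : nat, forall i z, (i <= k)%N ->
  order_exponents i z -> (`|z| <= N0)%N.
Proof.
exists (k * n.+1 * s1 + k * n.+1 * s2 + k * (s1 + s2 + m + 1))%N => i z ik.
case: i ik => [|i] ik /=; first by move=> ->.
move=> [i' [j' [l [/andP[h1 h2] /andP[h3 h4] ->]]]].
have lk : (l * n.+1 <= k * n.+1)%N by rewrite leq_mul2r (leq_trans h4) ?orbT.
have b1 : (i' * s1 <= k * n.+1 * s1)%N by rewrite leq_mul2r; apply/orP; right; lia.
have b2 : (j' * s2 <= k * n.+1 * s2)%N by rewrite leq_mul2r; apply/orP; right; lia.
have b3 : (l * (s1 + s2 + m + 1) <= k * (s1 + s2 + m + 1))%N.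
  by rewrite leq_mul2r (leq_trans h4) ?orbT.
move: b1 b2 b3; rewrite -!PoszM.
set u := (i' * s1)%N; set v := (j' * s2)%N => b1 b2 b3.
(* Trading - 1 for + 1 - 2 leaves a product of natural numbers and a linear term. *)
have b4 : l%:Z * (s1%:Z + s2%:Z + m%:Z - 1) = (l * (s1 + s2 + m + 1))%N%:Z - 2 * l%:Z.
  by rewrite PoszM !PoszD; ring.
have b5 : (l <= l * (s1 + s2 + m + 1))%N by rewrite leq_pmulr// addn1.
rewrite b4; move: b3 b5; set w := (l * _)%N; lia.
Qed.

End exponents.

(** * Counting zeros of combinations of powers *)

Section zeros.
Variable R : realType.

(** In the variable ln h, as many distinct zeros as exponents force all coefficients to vanish,
    contrary to [M] being nonzero somewhere. Finiteness follows too, since an infinite set contains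
    that many points. *)
Lemma exponential_sum_finite_zeros (ds : seq int) (c : int -> R) (M : R -> R) :
  uniq ds -> (forall h, 0 < h -> M h = \sum_(d <- ds) c d * ex d (ln h)) ->
  (exists2 h, 0 < h & M h <> 0) ->
  let zeros := [set h : R | 0 < h /\ M h = 0] in
  finite_set zeros /\ (#|` fset_set zeros| < size ds)%N.
Proof.
move=> uds hM [h0 h00 Mh0] zeros.
have key (zs : seq R) : uniq zs -> {in zs, forall z, zeros z} -> (size zs < size ds)%N.
  move=> uzs hzs; rewrite ltnNge; apply/negP => szs; apply: Mh0; rewrite hM//.
  pose ss := sort <=%R zs.
  have sss : sorted <%R ss by rewrite sort_lt_sorted.
  pose ts := map (@ln R) (take (size ds) ss).
  have sub z : z \in take (size ds) ss -> 0 < z /\ M z = 0.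
    by move=> /mem_take; rewrite mem_sort => /hzs.
  have c0 : forall d, d \in ds -> c d = 0.
    apply: (@exponential_sum_zeros R ds c ts) => //.
    - rewrite sorted_map.
      apply: (@sub_in_sorted _ (fun z => 0 < z) <%R) _ _ (take_sorted _ sss) => //=.
        by move=> x y x0 y0 xy; rewrite ltr_ln.
      by apply/allP => z /sub[].
    - by rewrite size_map size_take size_sort; case: ltngtP szs => // ->.
    - by move=> _ /mapP[z /sub[z0 Mz] ->]; rewrite -hM.
  by rewrite big_seq big1// => d /c0 ->; rewrite mul0r.
have fin : finite_set zeros.
  apply: contrapT => inf; have [B BZ sB] := infinite_set_fset (size ds) inf.
  have := key (enum_fset B) (fset_uniq B) (fun z zB => BZ z zB).
  by rewrite ltnNge sB.
split => //; apply: key; first exact: fset_uniq.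
by move=> z; rewrite in_fset_set// inE.
Qed.

Lemma exponential_sum_eq0 (ds : seq int) (c : int -> R) : uniq ds ->
  (forall h, 0 < h -> \sum_(d <- ds) c d * ex d (ln h) = 0) -> forall d, d \in ds -> c d = 0.
Proof.
move=> uds h; apply: (@exponential_sum_zeros R ds c [seq i%:R | i <- iota 0 (size ds)]) => //.
- rewrite sorted_map; apply: sub_sorted (iota_ltn_sorted 0 (size ds)) => i j /=.
  by rewrite ltr_nat.
- by rewrite size_map size_iota.
by move=> z _; have := h (expR z) (expR_gt0 _); rewrite expRK.
Qed.

End zeros.

Lemma int_box_finite (A : set int) (N : nat) : (forall z, A z -> (`|z| <= N)%N) -> finite_set A.
Proof.
move=> h; apply: sub_finite_set (finite_seq (int_box N)) => z /h zN.
by rewrite /= mem_int_box.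
Qed.

Lemma parity_exponent_setE (s1 s2 m N k : nat) (z : int) : coprime s1 s2 ->
  exponent_set s1 s2 m N k z -> ((2 %| z)%Z = ~~ odd (s1 + s2)) ->
  parity_exponent_set s1 s2 m N k z.
Proof.
move=> hcop hz hpar; rewrite /parity_exponent_set /even_integers.
case: ifP => [/andP[h1 h2] | h12].
  by split => //=; rewrite hpar oddD h1 h2.
split => //=; rewrite hpar oddD.
move: h12; case o1 : (odd s1); case o2 : (odd s2) => //= _.
(* Both weights even is the case that coprimality excludes. *)
have : (2 %| gcdn s1 s2)%N by rewrite dvdn_gcd !dvdn2 o1 o2.
by move/eqP: hcop => ->.
Qed.

Theorem theorem4p1 (R : realType) (s1 s2 m n k : nat)
    (P Q : {poly {poly R}}) (p q : nat -> {poly {poly R}}) (M : nat -> R -> R)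
    (hs2 : (1 <= s2)%N) (hs12 : (s2 <= s1)%N) (hcop : coprime s1 s2)
    (hqh : quasi_homogeneous s1 s2 m P Q)
    (hcenter : center_at_origin (vector_field P Q))
    (hp : analytic_perturbation p) (hq : analytic_perturbation q)
    (hpn : forall i, (1 <= i)%N -> total_degree_le n (p i))
    (hqn : forall i, (1 <= i)%N -> total_degree_le n (q i))
    (hM : melnikov_functions s1 s2 P Q p q M)
    (hk : first_nonvanishing M k) :
  let zeros := [set h : R | 0 < h /\ M k h = 0] in
  finite_set zeros /\
  (#|` fset_set zeros|)%:Z <=
    (#|` fset_set (parity_exponent_set s1 s2 m n.+1 k)|)%:Z - 1.
Proof.
have hs1 : (0 < s1)%N by exact: leq_trans hs12.
have [k1 hk0 hkn] := hk.
have [a [b [T [T0 [a0 b0] hab abT hcross]]]] :=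
  return_orbit hs1 hs2 hqh hcenter (unperturbed_return hM).
have hw t : wedge s1 s2 P Q a b t != 0.
  exact: (orbit_wedge_neq0 hs1 hs2 hqh hcenter a0 hab).
have hleft t : 0 < t < T -> b t = 0 -> a t < 0.
  exact: (orbit_left_of_origin hs1 hcenter a0 hab hcross).
have [c0 hsym] := orbit_symmetry hs1 hs2 hqh hcenter T0 a0 b0 hab abT hcross.
have hdelta := orbit_orientation hs1 hs2 hqh hcenter a0 hab hsym.
set delta : R := (-1) ^+ m.+1 in hsym hdelta.
have dd : delta * delta = 1 by rewrite /delta -expr2 sqrr_sign.
have [N0 hN0] := exponent_set_bounded s1 s2 m n k.
have cA (x : monomial n) : continuous (mradial s1 s2 P Q a b x).
  exact: (mradial_continuous hab hw).
have cB (x : monomial n) : continuous (mangular s1 s2 P Q a b x).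
  exact: (mangular_continuous hab hw).
have [c [dc [hI cO ci0 cdc cE]]] := first_integral_exists (e := mexp s1 s2 m (n := n))
  (mu := mcoef (n := n) p q) cA cB (E := order_exponents s1 s2 m n) k erefl
  (@order_exponents_step R s1 s2 m n p q hpn hqn).
(* [N0] bounds d - 1, the exponent after division by r, so [d] itself may reach N0 + 1. *)
pose N := N0.+1.
have hN i d t : (i <= k)%N -> (N < `|d|)%N -> c i d t = 0 /\ dc i d t = 0.
  move=> ik dN; apply: cE => // /hN0 => /(_ ik); move: dN; rewrite /N; lia.
have mel c' dc' N' := @first_integral_melnikov R s1 s2 m n k P Q p q M hM hk0 k1 a b T
  hs1 hs2 hqh hp hq hpn hqn T0 a0 b0 hab abT hw hleft c' dc' N'.
have melI := mel c dc N hI hN cdc cO isT.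
have cT0 i d : (0 < i < k)%N -> c i d T = c i d 0.
  move=> ik; have [dN|dN] := leqP `|d| N; last first.
    have ik' : (i <= k)%N by case/andP: ik => _ /ltnW.
    by have [-> _] := hN i d T ik' dN; have [-> _] := hN i d 0 ik' dN.
  apply/eqP; rewrite -subr_eq0; apply/eqP.
  apply: (@exponential_sum_eq0 R (int_box N) (fun d => c i d T - c i d 0)).
  - exact: int_box_uniq.
  - by move=> h h0; have [/(_ i ik)] := melI h h0.
  by rewrite mem_int_box.
(* Since the lower orders are now periodic, the increment over a period is the same from any
   starting time. *)
have shift t d : c k d (t + T) - c k d t = c k d T.
  have [] := first_integral_shift (fun x t => mradial_periodic s1 s2 P Q abT x t)
    (fun x t => mangular_periodic s1 s2 P Q abT x t) hI (fun d t => etrans (cO d t) (esym (cO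
      d 0))) cT0 d t (leqnn k).
  by move=> -> _; rewrite ci0 ?subr0// k1 leqnn.
have hJ := first_integral_reflect (c0 := c0) dd
  (fun x t => mradial_reflect hs1 hs2 hqh hsym hdelta x t)
  (fun x t => mangular_reflect hs1 hs2 hqh hsym hdelta x t) hI.
have melJ := mel _ _ N hJ.
have {}melJ h : 0 < h -> \sum_(d <- int_box N) - (-1) ^ d * delta * c k d T * ex d (ln h) =
  - M k h.
  move=> h0; have [|||_ <-] := melJ _ _ _ isT h h0.
  - move=> i d t ik dN; have [h1 h2] := hN i d (delta * t + c0) ik dN.
    by rewrite h1 h2 !mulr0.
  - move=> i d ik t; apply: cvgM; first exact: cvg_cst.
    apply: (@continuous_comp _ _ _ (fun t => delta * t + c0) (dc i d)); last exact: cdc.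
    exact: derives_continuous (derivesD (derivesZ delta (derives_id t)) (derives_cst t c0)).
  - move=> d t; rewrite cO; case: eqVneq => [->|_]; last by rewrite mulr0.
    by rewrite expr1z mulr1 opprK.
  apply: eq_bigr => d _; congr (_ * _); rewrite -mulrBr -mulrA; congr (_ * _).
  rewrite mulr0 add0r.
  (* For either sign, the reflected path covers one period, forwards or backwards, so its increment
     is delta times that of the original. *)
  have [->|->] : delta = 1 \/ delta = -1.
    by rewrite /delta -signr_odd; case: (odd _); [right; rewrite expr1|left].
    by rewrite !mul1r [T + c0]addrC shift.
  rewrite !mulN1r; have := shift (- T + c0) d; rewrite addrAC addNr add0r => <-; ring.
(* The mean of the two expressions of M_k; the factor is zero when (-1)^d = delta. *)
pose C d := - (2^-1 * (1 - delta * (-1) ^ d) * c k d T).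
have MC h : 0 < h -> M k h = \sum_(d <- int_box N) C d * ex d (ln h).
  move=> h0; have := melJ h h0; have [_] := melI h h0.
  move=> e1 e2.
  have -> : M k h = 2^-1 * (- (\sum_(d <- int_box N) (c k d T - c k d 0) * ex d (ln h))
    - \sum_(d <- int_box N) - (-1) ^ d * delta * c k d T * ex d (ln h)).
    by rewrite e1 e2; field.
  rewrite -sumrN -sumrB big_distrr /=; apply: eq_bigr => d _.
  by rewrite ci0 ?k1 ?leqnn// /C; field.
set PS := parity_exponent_set s1 s2 m n.+1 k.
have finPS : finite_set PS.
  apply: (@int_box_finite _ N0) => z; rewrite /PS /parity_exponent_set => hz.
  have {}hz : exponent_set s1 s2 m n.+1 k z by move: hz; case: ifP => _ [].
  by apply: (hN0 k) => //; case: (k) k1 hz.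
(* The shift by one restores the factor r removed when exponents of J_k / r are recorded; it does
   not change their number. *)
pose ds := [seq z + 1 | z <- enum_fset (fset_set PS)].
have uds : uniq ds by rewrite map_inj_uniq ?fset_uniq// => x y /addIr.
have Cds d : C d != 0 -> d \in ds.
  move=> Cd; have cd : c k d T != 0.
    by apply/eqP => c00; move: Cd; rewrite /C c00 mulr0 oppr0 eqxx.
  have pd : delta * (-1) ^ d != 1.
    by apply/eqP => c00; move: Cd; rewrite /C c00 subrr mulr0 mul0r oppr0 eqxx.
  have Ed : order_exponents s1 s2 m n k (d - 1).
    by apply: contrapT => nE; have [c00 _] := cE k d T (leqnn k) nE; rewrite c00 eqxx in cd.
  apply/mapP; exists (d - 1); last by rewrite subrK.
  rewrite in_fset_set// inE; apply: parity_exponent_setE => //.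
    by case: (k) k1 Ed.
  have par : (2 %| d - 1)%Z = ~~ (2 %| d)%Z by lia.
  rewrite par; congr (~~ _); move: pd; rewrite hdelta -signr_odd.
  case: (odd (s1 + s2)); case: (boolP (2 %| d)%Z) => [/(exprz_sign_even R) ->
    | /(exprz_sign_odd R) ->] //.
    by rewrite expr1 mulrNN mulr1 eqxx.
  by rewrite expr0 mulr1 eqxx.
have MD h : 0 < h -> M k h = \sum_(d <- ds) C d * ex d (ln h).
  move=> h0; rewrite MC//; apply: sum_over_support; rewrite ?int_box_uniq// => d.
  rewrite mulf_eq0 negb_or => /andP[Cd _]; rewrite Cds// andbT mem_int_box.
  rewrite leqNgt; apply/negP => dN; move: Cd; rewrite /C.
  by have [-> _] := hN k d T (leqnn k) dN; rewrite mulr0 oppr0 eqxx.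
move=> zeros; have [fz] := exponential_sum_finite_zeros uds MD hkn; rewrite -/zeros => cz.
split => //; rewrite lerBrDr -PoszD lez_nat addn1.
by move: cz; rewrite size_map.
Qed.
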